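(* Let $a:\mathbb{R}^2\times\mathfrak{M}_0\to\mathbb{R}^2$ be Lipschitz in both variables, let $\mu_0\in\mathfrak{M}_0$, and let $x(u,t)$, $\mu_t$ ($u\in\mathbb{R}^2$, $t\ge 0$) be the solution of the equation with interaction with coefficient $a$ and initial measure $\mu_0$. Let $m(du)=p(u)\,du$ be a measure on $\mathbb{R}^2$, and suppose that $p\in C^1(\mathbb{R}^2)$ is a bounded and nonnegative function. Then the solution preserves the measure $m$ if and only if $$\operatorname{div}\big(p(u)\,a(u,\mu_t)\big)=0\qquad\text{for all } t\ge 0,\ u\in\mathbb{R}^2 .$$
   Context: $\mathfrak{M}_0$ is the space of all probability measures on $\mathbb{R}^2$ with the Wasserstein distance $\gamma_0(\mu,\nu)=\inf_{\kappa}\iint \frac{\|u-v\|}{1+\|u-v\|}\,\kappa(du,dv)$, the infimum being over all couplings $\kappa$ of $\mu$ and $\nu$. Lipschitz in both variables means: there is $L$ with $\|a(u_1,\mu_1)-a(u_2,\mu_2)\|\le L(\|u_1-u_2\|+\gamma_0(\mu_1,\mu_2))$ for all arguments. The equation with interaction with coefficient $a$ and initial measure $\mu_0$ is the system $$dx(u,t)=a(x(u,t),\mu_t)\,dt,\quad x(u,0)=u\ (u\in\mathbb{R}^2),\quad \mu_t=\mu_0\circ x(\cdot,t)^{-1},$$ i.e. $\mu_t$ is the push-forward of $\mu_0$ under $x(\cdot,t)$. For Lipschitz $a$ it is known to have a unique solution, and each $x(\cdot,t)$ is a homeomorphism of $\mathbb{R}^2$. The solution preserves $m$ means that $m(x(A,t))=m(A)$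 for every bounded Borel set $A\subset\mathbb{R}^2$ and every $t\ge0$, where $x(A,t)=\{x(u,t):u\in A\}$. The divergence is $\operatorname{div}(p(u)a(u,\mu))=\sum_{i=1}^2\frac{\partial}{\partial u_i}\big(p(u)a_i(u,\mu)\big)$, with the measure argument $\mu$ held fixed.
   Formalization: As a is only Lipschitz, the divergence need not exist or vanish at every u; the condition is read, for all t ≥ 0, as: div(p a(·,μ_t)) exists and is 0 for almost every u, and is 0 at every u where p a(·,μ_t) is differentiable. *)

(* Defs.v *)
From HB Require Import structures.
From mathcomp Require Import all_boot all_order all_algebra.
From mathcomp Require Import all_classical all_reals all_analysis.

Set Implicit Arguments.
Unset Strict Implicit.
Unset Printing Implicit Defensive.

Import Order.TTheory GRing.Theory Num.Theory numFieldNormedType.Exports.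

Local Open Scope classical_set_scope.
Local Open Scope ring_scope.

Section Definitions.
Context {R : realType}.

(* The norm of the library on R * R is the max norm; it is used only through
   the topology and the bounded sets it defines. *)
Definition enorm (u : R * R) : R := Num.sqrt (u.1 ^+ 2 + u.2 ^+ 2).

Definition is_coupling (kappa : probability ((R * R) * (R * R))%type R)
    (mu nu : probability (R * R)%type R) : Prop :=
  forall A : set (R * R), measurable A ->
    kappa (fst @^-1` A) = mu A /\ kappa (snd @^-1` A) = nu A.

Definition gamma0 (mu nu : probability (R * R)%type R) : \bar R :=
  ereal_inf
    [set (\int[kappa]_z
            (enorm (z.1 - z.2) / (1 + enorm (z.1 - z.2)))%:E)%E
      | kappa in [set kappa | is_coupling kappa mu nu]].

Definition lipschitz_coefficient
    (a : R * R -> probability (R * R)%type R -> R * R) : Prop :=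
  exists L : R, forall u1 u2 mu1 mu2,
    ((enorm (a u1 mu1 - a u2 mu2))%:E <=
       L%:E * ((enorm (u1 - u2))%:E + gamma0 mu1 mu2))%E.

(* x t is the map u |-> x(u, t); being a measurable map, it has a push-forward
   mu_t = mu0 o x(., t)^-1, which is its distribution under mu0. *)
Definition image_measure (mu0 : probability (R * R)%type R)
    (x : R -> {mfun (R * R)%type >-> (R * R)%type}) (t : R) :
    probability (R * R)%type R :=
  distribution mu0 (x t).

(* The derivative in t is taken in [0, +oo[, hence one-sided at t = 0; the
   values of x at negative times are irrelevant. *)
Definition solves_interaction_equation
    (a : R * R -> probability (R * R)%type R -> R * R)
    (mu0 : probability (R * R)%type R)
    (x : R -> {mfun (R * R)%type >-> (R * R)%type}) : Prop :=
  (forall u, x 0 u = u) /\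
  (forall u (t : R), 0 <= t ->
     h^-1 *: (x (t + h) u - x t u)
       @[h --> within [set h : R | 0 <= t + h] 0^']
     --> a (x t u) (image_measure mu0 x t)).

Definition lebesgue2 := (@lebesgue_measure R \x @lebesgue_measure R)%E.

HB.instance Definition _ := Measure.on lebesgue2.

Definition density_measure (p : R * R -> R) (A : set (R * R)) : \bar R :=
  (\int[lebesgue2]_(u in A) (p u)%:E)%E.

Definition preserves (x : R -> R * R -> R * R) (m : set (R * R) -> \bar R) :
    Prop :=
  forall (t : R) (A : set (R * R)), 0 <= t ->
    measurable A -> bounded_set A -> m (x t @` A) = m A.

Definition e1 : R * R := (1, 0).
Definition e2 : R * R := (0, 1).

Definition C1 (p : R * R -> R) : Prop :=
  forall e, e = e1 \/ e = e2 ->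
    (forall u, derivable p u e) /\ continuous (fun u => 'D_e p u).

Definition divergence (F : R * R -> R * R) (u : R * R) : R :=
  'D_e1 (fun v => (F v).1) u + 'D_e2 (fun v => (F v).2) u.

(* 'D_e is a total operator, so the existence of the two partial derivatives
   has to be required separately. A locally Lipschitz field has them almost
   everywhere only. Moreover, at a point where both exist but the field is not
   differentiable, the divergence of an area-preserving field need not vanish:
   for H = xy(x^2-y^2)/(x^2+y^2), the field (-dH/dy, dH/dx) is Lipschitz and
   preserves area, but the mixed second derivatives of H at 0 are 1 and -1. *)
Definition divergence_exists (F : R * R -> R * R) (u : R * R) : Prop :=
  derivable (fun v => (F v).1) u e1 /\ derivable (fun v => (F v).2) u e2.

End Definitions.

(* Main.v *)
Require Import Defs.
From HB Require Import structures.
From mathcomp Require Import all_boot all_order all_algebra.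
From mathcomp Require Import all_classical all_reals all_analysis.
From mathcomp Require Import measurable_realfun ring lra.

Set Implicit Arguments.
Unset Strict Implicit.
Unset Printing Implicit Defensive.

Import Order.TTheory GRing.Theory Num.Theory numFieldNormedType.Exports.

Local Open Scope classical_set_scope.
Local Open Scope ring_scope.

(* Write [B_t = a(., mu_t)], [J f] for the Lebesgue integral of [f], and call
   [psi] a test function when it is Lipschitz with bounded support. Since
   [gamma0] vanishes on the diagonal and is at most 1, [B_t] is Lipschitz with
   linear growth, uniformly in [t]; so the maps [x_t o x_s^-1] are bi-Lipschitz,
   and the flow preserves [m] iff [J ((psi o x_t) p) = J (psi p)] for all [t] and
   all test functions. As [x_(t+h) o x_t^-1 = id + h B_t + o(h)], both
   implications reduce to the comparison, as [h] tends to [0+], of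
     [h^-1 J ((psi (u + h B_t u) - psi u) p u)]  and  [- J (psi D_h (p B_t))],
   where [D_h] is the divergence with difference quotients. Rademacher's theorem
   is not needed for it: a fine partition of unity freezes [B_t], and the
   translations are then moved from [psi] to the C^1 weight. Since [p B_t] is
   locally Lipschitz, its partial derivatives exist a.e. (one-dimensional
   Lebesgue differentiation and Fubini), and dominated convergence identifies
   the limit of [J (psi D_h (p B_t))]. At a point of differentiability the
   divergence is recovered with tent functions [max 0 (r - |u - u0|)].
   Conversely, a vanishing divergence gives [s |-> J ((psi o x_t o x_s^-1) p)],
   which is Lipschitz, a left derivative equal to 0 everywhere. *)

(** The obstacle is that the field and its flow are only Lipschitz: there is no Jacobian of the flow
    to differentiate in time. The invariance is therefore tested against functions, and these must
    form a class stable under composition with the maps [x_t o x_s^-1], which rules out anything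
    smoother than Lipschitz functions. Then neither [psi] nor [B_t] has a first-order expansion at
    every point; only the weight [p] has one. The price of freezing is proportional to the mesh of
    the partition, uniformly in [h]; the mesh is fixed first and [h] tends to 0 afterwards, so the
    finitely many cells are treated one by one. All estimates use the max norm, whose balls are
    squares; the Euclidean norm returns only where the hypothesis on [a] is read, and inside the
    Gronwall functionals, which have to be differentiable. *)

Section PlaneMeasure.
Context {R : realType}.
Local Notation T := (R * R)%type.
Local Notation mu := (@lebesgue_measure R).
Local Notation leb2 := (@lebesgue2 R).

Lemma norm_pairE (u : T) : `|u| = Num.max `|u.1| `|u.2|.
Proof. by []. Qed.

Lemma norm_pair_le (u : T) (M : R) : (`|u| <= M) = (`|u.1| <= M) && (`|u.2| <= M).
Proof. by rewrite norm_pairE ge_max. Qed.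

Lemma norm_fst_le (u : T) : `|u.1| <= `|u|.
Proof. by rewrite norm_pairE le_max lexx. Qed.

Lemma norm_snd_le (u : T) : `|u.2| <= `|u|.
Proof. by rewrite norm_pairE le_max lexx orbT. Qed.

(** The product sigma-algebra is generated by products of sets, so an open set is exhausted by the
    countably many squares with rational centre and radius [1/(k+1)] that it contains. *)
Lemma open_measurable_plane (U : set T) : open U -> measurable U.
Proof.
move=> oU.
pose box (k : rat * rat * nat) : set T :=
  ball (ratr k.1.1 : R) (k.2.+1%:R^-1) `*` ball (ratr k.1.2 : R) (k.2.+1%:R^-1).
have -> : U = \bigcup_k (if `[< box k `<=` U >] then box k else set0).
  apply/seteqP; split=> [[x y] Uxy|u [k _]]; last first.
    by case: asboolP => // kU /kU.
  have [e /= e0 eU] : nbhs_ball (x, y) U.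
    by apply/nbhs_ballP/open_nbhs_nbhs.
  (* [e / 2], because two points of a square lie within twice its radius of each other. *)
  have [n ne] : exists n : nat, n.+1%:R^-1 < e / 2.
    have [n _ H] := @near_infty_natSinv_lt R (PosNum (divr_gt0 e0 (ltr0Sn R 1))).
    by exists n; move: (H n (leqnn n)).
  have n0 : 0 < n.+1%:R^-1 :> R by rewrite invr_gt0.
  have [q xq] : exists q : rat, ball x (n.+1%:R^-1) (ratr q).
    have [z [Oz [q _ qz]]] := @dense_rat R (ball x (n.+1%:R^-1))
      (ex_intro _ x (ballxx _ n0)) (ball_open _ _).
    by exists q; rewrite qz.
  have [r yr] : exists q : rat, ball y (n.+1%:R^-1) (ratr q).
    have [z [Oz [r _ rz]]] := @dense_rat R (ball y (n.+1%:R^-1))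
      (ex_intro _ y (ballxx _ n0)) (ball_open _ _).
    by exists r; rewrite rz.
  exists ((q, r), n) => //.
  case: asboolP => [_|]; first by split; apply: ball_sym.
  case=> -[a b] [/= qa rb]; apply: eU; split => /=.
    apply: (@le_ball _ _ _ (n.+1%:R^-1 + n.+1%:R^-1)); first by rewrite [leRHS](splitr e) lerD// ltW.
    exact: ball_triangle xq qa.
  apply: (@le_ball _ _ _ (n.+1%:R^-1 + n.+1%:R^-1)); first by rewrite [leRHS](splitr e) lerD// ltW.
  exact: ball_triangle yr rb.
apply: countable_bigcupT_measurable; first exact: countableP.
move=> k; case: asboolP => // _; apply: measurableX; exact: measurable_ball.
Qed.

Lemma continuous_measurable_plane (f : T -> R) :
  continuous f -> measurable_fun setT f.
Proof.
move=> cf; apply: (measurability _ (RGenOpens.measurableE R)) => //.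
move=> _ [_ [a [b ->] <-]]; rewrite setTI.
apply: open_measurable_plane; move/continuousP : cf; apply.
exact: interval_open.
Qed.

Lemma continuous_fst : continuous (fst : T -> R).
Proof. by move=> [x y]; exact: cvg_fst. Qed.

Lemma continuous_snd : continuous (snd : T -> R).
Proof. by move=> [x y]; exact: cvg_snd. Qed.

Lemma continuous_measurable_plane2 (f : T -> T) :
  continuous f -> measurable_fun setT f.
Proof.
move=> cf; apply/measurable_fun_pairP; split;
  apply: continuous_measurable_plane => u.
- exact: (continuous_comp (cf u) (@continuous_fst (f u))).
- exact: (continuous_comp (cf u) (@continuous_snd (f u))).
Qed.

Definition box (N : R) : set T := `[- N, N]%classic `*` `[- N, N]%classic.

Lemma boxP N u : box N u <-> `|u| <= N.
Proof.
rewrite norm_pair_le /box /= !in_itv/= !ler_norml; split; first by case=> -> ->.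
by move/andP.
Qed.

Lemma measurable_box N : measurable (box N).
Proof. by apply: measurableX; exact: measurable_itv. Qed.

Lemma lebesgue2_box N : 0 <= N -> leb2 (box N) = ((2 * N) ^+ 2)%:E.
Proof.
move=> N0; rewrite /box /lebesgue2 product_measure1E//=.
rewrite lebesgue_measure_itv/= lte_fin; case: ltP => [_|NN].
  by rewrite -EFinB -EFinM; congr EFin; ring.
have -> : N = 0 by lra.
by rewrite mulr0 expr0n mule0.
Qed.

Definition J (f : T -> R) : R := \int[leb2]_u f u.

(** The indicator bounds size and support at once, so that one pair [N], [M] provides an integrable
    majorant for a whole family of functions. *)
Definition dominated (f : T -> R) (N M : R) :=
  forall u, `|f u| <= M * (`|u| <= N)%R%:R.

Definition Jable (f : T -> R) := leb2.-integrable setT (EFin \o f).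

Lemma integrable_box (N M : R) :
  leb2.-integrable setT (EFin \o (fun u : T => M * (`|u| <= N)%R%:R)).
Proof.
have -> : EFin \o (fun u : T => M * (`|u| <= N)%R%:R) =
    (EFin \o cst M) \_ (box N).
  apply/funext => u; rewrite patchE /=.
  have [uN|uN] := boolP (u \in box N).
    by move/set_mem/boxP : uN => ->; rewrite mulr1.
  have [h|_] := boolP (`|u| <= N); last by rewrite mulr0.
  by move/negP : uN => []; apply/mem_set/boxP.
have [+ _] := @integrable_mkcond _ _ _ leb2 _ (EFin \o cst M) (measurable_box N); apply.
apply: measurable_bounded_integrable => //.
- exact: measurable_box.
- have [N0|N0] := leP 0 N; first by rewrite /= lebesgue2_box// ltry.
  have -> : box N = set0.
    by apply/seteqP; split=> // u /boxP uN; move: (normr_ge0 u); lra.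
  by rewrite measure0.
- exists `|M|; split; first exact: num_real.
  by move=> r Mr x _ /=; exact: ltW.
Qed.

Lemma dominated_Jable f N M : measurable_fun setT f -> dominated f N M -> Jable f.
Proof.
move=> mf fNM; apply: (le_integrable measurableT _ _ (integrable_box N M)).
  exact/measurable_EFinP.
move=> u _; rewrite /= lee_fin (le_trans (fNM u))//; exact: ler_norm.
Qed.

Lemma le_J f g : Jable f -> Jable g -> (forall u, f u <= g u) -> J f <= J g.
Proof. by move=> ? ? fg; apply: le_Rintegral => // u _; exact: fg. Qed.

Lemma J_box (N M : R) : 0 <= N ->
  J (fun u : T => M * (`|u| <= N)%R%:R) = M * (2 * N) ^+ 2.
Proof.
move=> N0; rewrite /J.
rewrite (_ : (fun u : T => M * (`|u| <= N)%R%:R) = (cst M) \_ (box N)); last first.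
  apply/funext => u; rewrite patchE /=.
  have [uN|uN] := boolP (u \in box N).
    by move/set_mem/boxP : uN => ->; rewrite mulr1.
  have [h|_] := boolP (`|u| <= N); last by rewrite mulr0.
  by move/negP : uN => []; apply/mem_set/boxP.
rewrite -Rintegral_mkcond Rintegral_cst; last exact: measurable_box.
by rewrite /= lebesgue2_box.
Qed.

Lemma J_dominated f N M : 0 <= N -> measurable_fun setT f -> dominated f N M ->
  `|J f| <= M * (2 * N) ^+ 2.
Proof.
move=> N0 mf fNM; have fJ := dominated_Jable mf fNM.
rewrite (le_trans (le_normr_Rintegral _ fJ))//.
rewrite -(J_box M N0); apply: le_J => //; last exact: integrable_box.
exact: (integrable_norm fJ).
Qed.

Lemma JD f g : Jable f -> Jable g -> J (fun u => f u + g u) = J f + J g.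
Proof. by move=> ? ?; rewrite /J RintegralD. Qed.

Lemma JB f g : Jable f -> Jable g -> J (fun u => f u - g u) = J f - J g.
Proof. by move=> ? ?; rewrite /J RintegralB. Qed.

Lemma JZ k f : Jable f -> J (fun u => k * f u) = k * J f.
Proof. by move=> ?; rewrite /J RintegralZl. Qed.

Lemma JableD f g : Jable f -> Jable g -> Jable (fun u => f u + g u).
Proof. by move=> /integrableD h /h -/(_ measurableT). Qed.

Lemma JableZ k f : Jable f -> Jable (fun u => k * f u).
Proof. by move=> fJ; have := @integrableZl _ _ _ _ _ measurableT k _ fJ. Qed.

(** Translation preserves the length of half-open intervals, and these determine Lebesgue measure;
    [lebesgue2D] lifts this to the plane by uniqueness of the product measure. *)
Lemma lebesgue_measureD (A : set R) (z : R) : measurable A ->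
  mu [set x | A (x + z)] = mu A.
Proof.
move=> mA.
have mz : measurable_fun setT (fun x : R => x + z).
  by apply: measurable_funD => //; exact: measurable_id.
transitivity (pushforward mu ((fun x : R => x + z) : _ -> measurableTypeR R) A) => //.
apply/esym/lebesgue_measure_unique => //= _ [[a b]] _ <-.
rewrite /pushforward /=.
rewrite (_ : _ @^-1` _ = `]a - z, b - z]%classic); last first.
  by apply/seteqP; split=> x /=; rewrite !in_itv/=; lra.
by rewrite !lebesgue_measure_itv/= !lte_fin ltrD2r -!EFinB; case: ifP => // _; congr EFin; ring.
Qed.

(* Lebesgue measure is a measure on [measurableTypeR R], whose sigma-algebra
   is convertible to the one of [R] but carries another display. *)
Local Notation T' := (measurableTypeR R * measurableTypeR R)%type.

Lemma measurable_shift (z : T) :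
  measurable_fun (setT : set T') ((fun u : T => u + z) : T' -> T').
Proof.
apply: continuous_measurable_plane2 => u.
by apply: cvgD; [exact: cvg_id|exact: cvg_cst].
Qed.

Lemma lebesgue2D (A : set T) (z : T) : measurable A ->
  pushforward leb2 ((fun u : T => u + z) : T' -> T') A = leb2 A.
Proof.
move=> mA; apply/esym.
have H := @product_measure_unique _ _ _ _ _ mu mu
  (measure_function_pushforward__canonical__measure_function_Measure leb2 (measurable_shift z)).
apply: H mA => {}A B mA mB.
rewrite /= /pushforward.
rewrite (_ : _ @^-1` _ = [set x | A (x + z.1)] `*` [set x | B (x + z.2)]); last first.
  by [].
have m1 (C : set R) (r : R) : measurable C -> measurable [set x | C (x + r)].
  move=> mC; rewrite -[X in measurable X]setTI.
  have : measurable_fun setT (fun x : R => x + r).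
    by apply: measurable_funD => //; exact: measurable_id.
  exact.
rewrite /lebesgue2 product_measure1E//; [|exact: m1|exact: m1].
congr (_ * _)%E; exact: lebesgue_measureD.
Qed.

Lemma JableT f z : Jable f -> Jable (fun u => f (u + z)).
Proof.
move=> /integrableP[mf fJ]; apply/integrableP; split.
  exact: (measurableT_comp mf (measurable_shift z)).
have -> : (\int[leb2]_x `|(EFin \o (fun u => f (u + z)%R)) x| =
    \int[pushforward leb2 ((fun u : T => u + z)%R : T' -> T')]_x `|(EFin \o f) x|)%E.
  rewrite ge0_integral_pushforward//; first exact: measurable_shift.
  exact: measurableT_comp.
rewrite (eq_measure_integral leb2)//; first exact: measurable_shift.
by move=> mz A mA _; exact: lebesgue2D.
Qed.

(** All discrete integrations by parts below rest on this invariance. *)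
Lemma JT f z : Jable f -> J (fun u => f (u + z)) = J f.
Proof.
move=> fJ; have fzJ := JableT z fJ.
have mz := measurable_shift z.
rewrite /J /Rintegral; congr fine.
rewrite -[RHS](@eq_measure_integral _ _ _ _ leb2
  (measure_function_pushforward__canonical__measure_function_Measure leb2 mz)); last first.
  by move=> A mA _; exact: lebesgue2D.
rewrite integral_pushforward//.
by move/integrableP: fJ => [].
Qed.

End PlaneMeasure.

(** * Dominated convergence on the plane, along sequences and along [h] tending to [0+] *)

Section PlaneConvergence.
Context {R : realType}.
Local Notation T := (R * R)%type.
Local Notation leb2 := (@lebesgue2 R).

Lemma ae2S (P Q : T -> Prop) : (forall u, P u -> Q u) ->
  {ae leb2, forall u, P u} -> {ae leb2, forall u, Q u}.
Proof. by move=> PQ; apply: negligibleS => u /= nQ /PQ. Qed.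

Lemma ae2I (P Q : T -> Prop) : {ae leb2, forall u, P u} ->
  {ae leb2, forall u, Q u} -> {ae leb2, forall u, P u /\ Q u}.
Proof.
move=> p q; apply: negligibleS (negligibleU p q) => u /=.
by move=> /not_andP[]; [left|right].
Qed.

Lemma ae2W (P : T -> Prop) : (forall u, P u) -> {ae leb2, forall u, P u}.
Proof.
by move=> p; apply: negligibleS (negligible_set0 leb2) => u /=; apply; exact: p.
Qed.

Lemma J_cvgn (f_ : nat -> T -> R) (f : T -> R) N M :
  (forall n, measurable_fun setT (f_ n)) -> (forall n, dominated (f_ n) N M) ->
  measurable_fun setT f ->
  {ae leb2, forall u, f_ n u @[n --> \oo] --> f u} ->
  J (f_ n) @[n --> \oo] --> J f.
Proof.
move=> mf_ df_ mf ff.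
have [] := @dominated_convergence _ _ _ leb2 setT measurableT
  (fun n => EFin \o f_ n) (EFin \o f)
  (EFin \o (fun u : T => M * (`|u| <= N)%R%:R)).
- by move=> n; apply/measurable_EFinP; exact: mf_.
- by apply/measurable_EFinP; exact: mf.
- apply: ae2S ff => u h _.
  by apply: (cvg_comp _ _ h); apply: cvg_EFin => //; exact: nearW.
- exact: integrable_box.
- by apply: ae2W => u n _; rewrite /= lee_fin; exact: df_.
move=> fJ _ cJ; apply: fine_cvg.
have -> : (J f)%:E = (\int[leb2]_x (EFin \o f) x)%E.
  by rewrite /J /Rintegral fineK//; exact: integrable_fin_num.
exact: cJ.
Qed.

Lemma J_cvg_at_right (f_ : R -> T -> R) (f : T -> R) N M d : 0 < d ->
  (forall h, 0 < h < d -> measurable_fun setT (f_ h)) ->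
  (forall h, 0 < h < d -> dominated (f_ h) N M) ->
  measurable_fun setT f ->
  {ae leb2, forall u, f_ h u @[h --> 0^'+] --> f u} ->
  J (f_ h) @[h --> 0^'+] --> J f.
Proof.
move=> d0 mf_ df_ mf ff; apply/(@cvg_at_rightP _ (fun h => J (f_ h))) => u [u0 cu].
(* The hypotheses hold for [0 < h < d] only. The terms with [u n >= d] are replaced by [d / 2],
   which changes finitely many of them since [u] tends to 0. *)
pose v n := if u n < d then u n else d / 2.
have vd n : 0 < v n < d.
  by rewrite /v; case: ifPn => [ud|_]; [rewrite u0|apply/andP; split; lra].
have uv : \forall n \near \oo, u n = v n.
  near=> n; rewrite /v ifT//; near: n; exact: (cvgr_lt _ cu).
have cv : v n @[n --> \oo] --> 0.
  apply: cvg_trans cu; apply: near_eq_cvg; apply: filterS uv => n.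
  by move=> ->.
apply: (@cvg_trans _ (J (f_ (v n)) @[n --> \oo])).
  by apply: near_eq_cvg; apply: filterS uv => n ->.
apply: (@J_cvgn _ f N M) => //.
- by move=> n; exact: mf_.
- by move=> n; exact: df_.
apply: ae2S ff => w /cvg_at_rightP; apply; split=> // n.
by case/andP: (vd n).
Unshelve. all: by end_near. Qed.

Lemma J_cvg_at_right0 (f_ : R -> T -> R) N M d : 0 < d ->
  (forall h, 0 < h < d -> measurable_fun setT (f_ h)) ->
  (forall h, 0 < h < d -> dominated (f_ h) N M) ->
  {ae leb2, forall u, f_ h u @[h --> 0^'+] --> 0} ->
  J (f_ h) @[h --> 0^'+] --> 0.
Proof.
move=> d0 mf_ df_ ff.
have := @J_cvg_at_right f_ (cst 0) N M d d0 mf_ df_ (measurable_cst _) ff.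
by rewrite [X in _ --> X](_ : _ = 0)// /J Rintegral_cst// mul0r.
Qed.

End PlaneConvergence.

(** * Almost everywhere derivability of Lipschitz functions on the line *)

Section LipschitzDerivable.
Context {R : realType}.
Local Notation mu := (@lebesgue_measure R).

Lemma lebesgue_stieltjes_measure_itvoc (f : cumulative R R) (a b : R) : a <= b ->
  lebesgue_stieltjes_measure f `]a, b]%classic = (f b - f a)%:E.
Proof.
move=> ab.
rewrite /lebesgue_stieltjes_measure /measure_extension/= measurable_mu_extE/=.
  by rewrite wlength_itv_bnd.
exact: is_ocitv.
Qed.

(* If [g] and [x - g x] are both nondecreasing, the Stieltjes measure of [g]
   is at most Lebesgue measure, hence has a density. *)
Section StieltjesDensity.
Variable g : R -> R.
Let gC x := x - g x.
Hypotheses (g_nd : {homo g : x y / x <= y}) (gC_nd : {homo gC : x y / x <= y}).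

Let g_lip x y : x <= y -> `|g y - g x| <= y - x.
Proof.
move=> xy; rewrite ger0_norm; last by rewrite subr_ge0; exact: g_nd.
by have := gC_nd xy; rewrite /gC; lra.
Qed.

Let g_cont : continuous g.
Proof.
move=> x; apply/cvgrPdist_le => e e0; near=> y.
rewrite (@le_trans _ _ `|x - y|)//.
  have [xy|/ltW yx] := leP x y.
    by rewrite distrC [leRHS]distrC (le_trans (g_lip xy))// ler_norm.
  by rewrite (le_trans (g_lip yx))// ler_norm.
Unshelve. all: by end_near. Qed.

Let g_rc : forall x, g @ at_right x --> g x.
Proof. exact: right_continuousW g_cont. Qed.

Let gC_rc : forall x, gC @ at_right x --> gC x.
Proof.
apply: right_continuousW => x; apply: cvgB; [exact: cvg_id|exact: g_cont].
Qed.

HB.instance Definition _ := isCumulative.Build R _ R g g_nd g_rc.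
HB.instance Definition _ := isCumulative.Build R _ R gC gC_nd gC_rc.

Let nu := lebesgue_stieltjes_measure g.
Let nuC := lebesgue_stieltjes_measure gC.

Let nu_itv a b : a <= b -> nu `]a, b]%classic = (g b - g a)%:E.
Proof.
exact: lebesgue_stieltjes_measure_itvoc.
Qed.

(** The Stieltjes measures of [g] and [gC] add up to Lebesgue measure, because [g x + gC x = x]. *)
Let nu_le A : measurable A -> (nu A <= mu A)%E.
Proof.
move=> mA.
rewrite (@lebesgue_measure_unique _ (measure_add nu nuC)) => [| |//].
  by rewrite [leRHS](measure_addE _ _ A) leeDl.
move=> _ [[a b]] _ <-; rewrite [RHS](measure_addE _ _ _)/=.
have [ab|ba] := ltP a b; last first.
  by rewrite set_itv_ge ?bnd_simp -?leNgt// !measure0 adde0.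
rewrite /nu /nuC !lebesgue_stieltjes_measure_itvoc ?ltW// lebesgue_measure_itv/= lte_fin ab -?EFinD -?EFinB.
by congr EFin; rewrite /gC; ring.
Qed.

(** Radon-Nikodym gives a density on a bounded interval, and Lebesgue differentiation applies to its
    primitive [F], from which [g] differs by a constant there. *)
Lemma stieltjes_derivable_ae (n : R) :
  {ae mu, forall x, - n < x < n -> derivable g x 1}.
Proof.
pose D := `]- n, n]%classic.
have mD : measurable (D : set (measurableTypeR R)) by exact: measurable_itv.
have nufin : (nu D < +oo)%E.
  have [nn|nn] := leP (- n) n; first by rewrite nu_itv// ltry.
  have -> : D = set0; last by rewrite /nu measure0 ltry.
  by apply/seteqP; split=> // x; rewrite /D /= in_itv/=; lra.
have [//|phi [phi0 phifin iphi phiE]] :=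
    @radon_nikodym_sigma_finite _ _ _ mu (mfrestr mD nufin).
  apply/null_content_dominatesP => A mA A0.
  apply/eqP; rewrite eq_le measure_ge0 andbT -A0 (le_trans _ (nu_le mA))//.
  apply: (@le_measure _ _ _ (lebesgue_stieltjes_measure g)); rewrite ?inE//.
  exact: measurableI.
pose f0 x := fine (phi x).
have f0E : EFin \o f0 = phi by apply/funext => x /=; rewrite fineK.
have if0 : mu.-integrable setT (EFin \o f0) by rewrite f0E.
have if0y y : mu.-integrable [set` Interval (BRight (- n)) (BRight y)] (EFin \o f0).
  by apply: integrableS if0 => //; exact: measurable_itv.
have := FTC1 if0y (open_integrable_locally openT if0).
apply: filterS; first exact: (ae_filter_ringOfSetsType mu).
move=> x H /andP[nx xn]; have {H}[] := H nx.
move=> dF _.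
pose F y := (\int[mu]_(t in `]- n, y]) f0 t)%R.
have FE y : - n <= y <= n -> F y = g y - g (- n).
  move=> /andP[ny yn]; rewrite /F /Rintegral -/(EFin \o f0) f0E.
  rewrite -phiE; last exact: measurable_itv.
  rewrite /= /mfrestr /= /mrestr (_ : _ `&` _ = `]- n, y]%classic).
    by rewrite -[g y - _]/(fine (g y - g (- n))%:E) -nu_itv.
  by apply/seteqP; split=> z; rewrite /D/= !in_itv/=; lra.
(* The first summand is constant near [x] but perhaps not globally: [F] recovers [g] on [[-n, n]]
   only. *)
have -> : g = (fun y => (g y - F y) + F y) by apply/funext => y; rewrite subrK.
apply: derivableD; last exact: dF.
apply: (@near_eq_derivable _ _ _ (cst (g (- n)))) => //.
near=> y; rewrite /= FE ?subKr//; apply/andP; split; apply: ltW; near: y.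
  exact: lt_nbhsr.
exact: lt_nbhsl.
Unshelve. all: by end_near. Qed.

End StieltjesDensity.

Lemma ae_bigcap (P : nat -> R -> Prop) :
  (forall n, {ae mu, forall x, P n x}) -> {ae mu, forall x, forall n, P n x}.
Proof.
move=> p; apply: negligibleS (negligible_bigcup p) => x /= /existsNP[n nP].
by exists n.
Qed.

Lemma lipschitz_derivable_ae (f : R -> R) (K : R) :
  (forall x y, `|f x - f y| <= K * `|x - y|) ->
  {ae mu, forall x, derivable f x 1}.
Proof.
move=> fK; pose L := `|K| + 1.
have L0 : 0 < L by rewrite /L ltr_pwDr.
have {}fK x y : x <= y -> - (L * (y - x)) <= f y - f x <= L * (y - x).
  move=> xy; rewrite -ler_norml (le_trans (fK _ _))//.
  rewrite (ger0_norm (_ : 0 <= y - x)) ?subr_ge0//.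
  by rewrite ler_wpM2r ?subr_ge0// /L (le_trans (ler_norm K))// lerDl.
(* The slopes of [f / L] lie in [[-1, 1]]; averaging with the identity brings them into [[0, 1]], so
   that [g] and [x - g x] are both nondecreasing. *)
pose g x := (f x / L + x) / 2.
have fE : f = (fun x => L * (2 * g x - x)).
  by apply/funext => x; rewrite /g; field; rewrite gt_eqF.
have gle x y : x <= y -> - (y - x) <= (f y / L) - (f x / L) <= y - x.
  move=> /fK; rewrite -mulrBl ler_pdivlMr// ler_pdivrMr// => /andP[h1 h2].
  by apply/andP; split; [rewrite mulNr mulrC|rewrite mulrC].
have gnd : {homo g : x y / x <= y}.
  by move=> x y xy; have := gle _ _ xy; rewrite /g; lra.
have gCnd : {homo (fun x => x - g x) : x y / x <= y}.
  by move=> x y xy; have := gle _ _ xy; rewrite /g; lra.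
have := ae_bigcap (fun n => stieltjes_derivable_ae gnd gCnd n%:R).
apply: filterS; first exact: (ae_filter_ringOfSetsType mu).
move=> x H; rewrite fE.
have dg : derivable g x 1.
  by apply: (H (Num.bound `|x|)); rewrite -ltr_norml archi_boundP.
apply: (@derivableM _ _ (cst L)); first exact: derivable_cst.
apply: derivableB; last exact: derivable_id.
by apply: (@derivableM _ _ (cst 2)); [exact: derivable_cst|exact: dg].
Qed.

Definition clip (n x : R) := Num.max (- n) (Num.min x n).

Lemma clip_lipschitz n x y : `|clip n x - clip n y| <= `|x - y|.
Proof.
have h1 := ler_norm (x - y); have h2 := ler_norm (y - x); rewrite distrC in h2.
rewrite /clip !maxEle !minEle ler_norml.
by case: (leP x n) => xn; case: (leP y n) => yn; case: (leP (- n) x) => nx;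
  case: (leP (- n) y) => ny; case: (leP (- n) n) => nn; apply/andP; split; lra.
Qed.

Lemma clip_id n x : `|x| <= n -> clip n x = x.
Proof.
rewrite ler_norml => /andP[nx xn].
by rewrite /clip (min_idPl xn) (max_idPr nx).
Qed.

Lemma clip_le n x : 0 <= n -> `|clip n x| <= n.
Proof.
move=> n0; rewrite ler_norml /clip le_max lexx/= ge_max ge_min lexx orbT andbT.
by lra.
Qed.

(** Composition with [clip] makes [f] globally Lipschitz and leaves it unchanged near every point of
    the open interval. *)
Lemma locally_lipschitz_derivable_ae (f : R -> R) :
  (forall n, exists K, forall x y, `|x| <= n -> `|y| <= n ->
    `|f x - f y| <= K * `|x - y|) ->
  {ae mu, forall x, derivable f x 1}.
Proof.
move=> fK.
have H n : {ae mu, forall x, derivable (f \o clip n%:R) x 1}.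
  have [K fn] := fK n%:R; apply: (@lipschitz_derivable_ae _ `|K|) => x y.
  rewrite /= (le_trans (fn _ _ _ _)) ?clip_le//.
  rewrite (le_trans (ler_wpM2r (normr_ge0 _) (ler_norm K)))//.
  by rewrite ler_wpM2l//; exact: clip_lipschitz.
have := ae_bigcap H.
apply: filterS; first exact: (ae_filter_ringOfSetsType mu).
move=> x {}H; have xb : `|x| < (Num.bound `|x|)%:R by rewrite archi_boundP.
apply: (near_eq_derivable _ (H (Num.bound `|x|))).
near=> y; rewrite /= clip_id// ltW//; near: y.
exact: (@cvgr_norm_lt _ _ _ _ _ id x cvg_id).
Unshelve. all: by end_near. Qed.

End LipschitzDerivable.

(** * Locally Lipschitz functions on the plane *)

Section LocallyLipschitz.
Context {R : realType}.
Local Notation T := (R * R)%type.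

Definition lip (K : R) (f : T -> R) := forall u v, `|f u - f v| <= K * `|u - v|.

(** Unlike [lip], this class is closed under products, as the fluxes [p * B] and the products of
    cutoffs demand. *)
Definition loc_lip (f : T -> R) := forall N : R, exists2 K : R, 0 <= K &
  forall u v, `|u| <= N -> `|v| <= N -> `|f u - f v| <= K * `|u - v|.

Lemma lip_loc_lip K f : lip K f -> loc_lip f.
Proof.
move=> fK N; exists `|K| => // u v _ _; rewrite (le_trans (fK u v))//.
by rewrite ler_wpM2r// ler_norm.
Qed.

Lemma loc_lip_bounded f N : loc_lip f ->
  exists2 M : R, 0 <= M & forall u, `|u| <= N -> `|f u| <= M.
Proof.
move=> lf; have [N0|N0] := leP 0 N; last first.
  by exists 0 => // u uN; move: (normr_ge0 u); lra.
have [K K0 fK] := lf N; exists (`|f 0| + K * N).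
  by rewrite addr_ge0// mulr_ge0.
move=> u uN; have := fK u 0 uN; rewrite normr0 subr0 => /(_ N0) h.
rewrite -[f u](subrK (f 0)) (le_trans (ler_normD _ _))// addrC lerD2l.
by rewrite (le_trans h)// ler_wpM2l.
Qed.

Lemma loc_lip_continuous f : loc_lip f -> continuous f.
Proof.
move=> lf u; have [K K0 fK] := lf (`|u| + 1).
apply/cvgrPdist_lt => e e0; near=> v.
have uv1 : `|u - v| <= 1.
  by near: v; apply: (@cvgr_dist_le _ _ _ _ _ id u cvg_id).
have uve : `|u - v| < e / (K + 1).
  near: v; apply: (@cvgr_dist_lt _ _ _ _ _ id u cvg_id).
  by rewrite divr_gt0// ltr_wpDl.
have K1 : 0 < K + 1 by rewrite ltr_wpDl.
apply: (@le_lt_trans _ _ ((K + 1) * `|u - v|)); last first.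
  by rewrite mulrC -ltr_pdivlMr.
rewrite (le_trans (fK _ _ _ _))//; first by rewrite lerDl.
- have -> : v = u - (u - v) by rewrite opprB addrC subrK.
  by rewrite (le_trans (ler_normB _ _))// lerD2l.
- by rewrite ler_wpM2r// lerDl.
Unshelve. all: by end_near. Qed.

Lemma loc_lipM f g : loc_lip f -> loc_lip g -> loc_lip (fun u => f u * g u).
Proof.
move=> lf lg N; have [Kf Kf0 fK] := lf N; have [Kg Kg0 gK] := lg N.
have [Mf Mf0 fM] := loc_lip_bounded N lf; have [Mg Mg0 gM] := loc_lip_bounded N lg.
exists (Mf * Kg + Mg * Kf) => [|u v uN vN]; first by rewrite addr_ge0// mulr_ge0.
have -> : f u * g u - f v * g v = f u * (g u - g v) + g v * (f u - f v) by ring.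
rewrite (le_trans (ler_normD _ _))// !normrM mulrDl lerD// -mulrA ler_pM//.
- exact: fM.
- exact: gK.
- exact: gM.
- exact: fK.
Qed.

Lemma loc_lipD f g : loc_lip f -> loc_lip g -> loc_lip (fun u => f u + g u).
Proof.
move=> lf lg N; have [Kf Kf0 fK] := lf N; have [Kg Kg0 gK] := lg N.
exists (Kf + Kg) => [|u v uN vN]; first by rewrite addr_ge0.
rewrite opprD addrACA (le_trans (ler_normD _ _))// mulrDl lerD//.
  exact: fK.
exact: gK.
Qed.

Lemma loc_lip_shift f z : loc_lip f -> loc_lip (fun u => f (u + z)).
Proof.
move=> lf N; have [K K0 fK] := lf (N + `|z|); exists K => // u v uN vN.
have h w : `|w| <= N -> `|w + z| <= N + `|z|.
  by move=> wN; rewrite (le_trans (ler_normD _ _))// lerD2r.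
by rewrite (le_trans (fK _ _ (h _ uN) (h _ vN)))// opprD addrACA subrr addr0.
Qed.

Lemma loc_lipZ k f : loc_lip f -> loc_lip (fun u => k * f u).
Proof.
move=> lf; apply: loc_lipM => //; apply: (@lip_loc_lip 0) => u v.
by rewrite subrr normr0 mul0r.
Qed.

End LocallyLipschitz.

(** * Partial derivatives: existence almost everywhere, and the case of [C1] functions *)

Section PartialDerivatives.
Context {R : realType}.
Local Notation T := (R * R)%type.
Local Notation mu := (@lebesgue_measure R).
Local Notation leb2 := (@lebesgue2 R).

Section QuotientOscillation.
Variables (f : T -> R) (e : T).
Hypothesis f_cont : continuous f.

Let quot (h : R) (u : T) : R := h^-1 *: (f (h *: e + u) - f u).

Let punctured (m : nat) (h : R) := 0 < `|h| < m.+1%:R^-1.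

Let osc (n m : nat) (q : rat * rat) (u : T) :=
  [/\ punctured m (ratr q.1), punctured m (ratr q.2) &
      n.+1%:R^-1 < `|quot (ratr q.1) u - quot (ratr q.2) u| :> R].

(** This is the failure of Cauchy's criterion for the quotient. Rational increments suffice because
    the quotient is continuous in a nonzero increment, and they leave only countable set
    operations. *)
Let not_derivableE : [set u | ~ derivable f u e] =
  \bigcup_n \bigcap_m \bigcup_q [set u | osc n m q u].
Proof.
apply/seteqP; split => [u /= nd|u [n _ H] /= /cvg_ex[/= l]]; last first.
  move=> /cvgrPdist_lt /(_ (n.+1%:R^-1 / 2)) [].
    by rewrite divr_gt0// invr_gt0.
  move=> r /= r0 rl.
  have [m mr] : exists m : nat, m.+1%:R^-1 < r.
    have [m _ Hm] := @near_infty_natSinv_lt R (PosNum r0).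
    by exists m; move: (Hm m (leqnn m)).
  have {rl} rl h : punctured m h -> `|l - quot h u| < n.+1%:R^-1 / 2.
    move=> /andP[h0 hm]; apply: rl => /=; last by rewrite -normr_gt0.
    by rewrite sub0r normrN (lt_trans hm).
  have [q _ [p1 p2]] := H m I.
  rewrite ltNge => /negP; apply.
  have -> : quot (ratr q.1) u - quot (ratr q.2) u =
    (l - quot (ratr q.2) u) - (l - quot (ratr q.1) u) by ring.
  rewrite (le_trans (ler_normB _ _))// [leRHS]splitr lerD// ltW//; exact: rl.
apply: contrapT => nH; apply: nd; apply/cauchy_cvgP/cauchy_ballP => eps eps0.
have [n neps] : exists n : nat, n.+1%:R^-1 < eps.
  have [m _ Hm] := @near_infty_natSinv_lt R (PosNum eps0).
  by exists m; move: (Hm m (leqnn m)).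
have [m Hm] : exists m, forall q, ~ osc n m q u.
  apply: contrapT => /forallNP H; apply: nH; exists n => // m _.
  by have /existsNP[q /contrapT Hq] := H m; exists q.
have quot_cont h : h != 0 -> quot k u @[k --> h] --> quot h u.
  move=> h0; apply: cvgM; first exact: cvgV.
  apply: cvgB; last exact: cvg_cst.
  apply: (@cvg_comp _ _ _ (fun k => k *: e + u) f); last exact: f_cont.
  apply: cvgD; last exact: cvg_cst.
  by apply: cvgZ; [exact: cvg_id|exact: cvg_cst].
have appr h (d : R) : 0 < d -> punctured m h ->
    exists q : rat, punctured m (ratr q) /\ `|quot h u - quot (ratr q) u| < d.
  move=> d0 /andP[h0 hm].
  have : \forall k \near h, punctured m k /\ `|quot h u - quot k u| < d.
    near=> k; split.
      apply/andP; split; near: k.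
        apply: (@cvgr_norm_gt _ _ _ _ _ id h cvg_id) => //.
      exact: (@cvgr_norm_lt _ _ _ _ _ id h cvg_id).
    near: k; apply: cvgr_dist_lt => //; apply: quot_cont.
    by rewrite -normr_gt0.
  move=> [r /= r0 rh].
  have [z [Oz [q _ qz]]] := @dense_rat R (ball h r)
      (ex_intro _ h (ballxx _ r0)) (ball_open _ _).
  by exists q; rewrite qz; exact: rh.
have osc_le h k : punctured m h -> punctured m k ->
    `|quot h u - quot k u| <= n.+1%:R^-1.
  move=> ph pk; apply/ler_addgt0Pr => d d0.
  have [q [pq hq]] := appr h (d / 2) (divr_gt0 d0 (ltr0Sn R 1)) ph.
  have [r [pr kr]] := appr k (d / 2) (divr_gt0 d0 (ltr0Sn R 1)) pk.
  have /not_and3P := Hm (q, r); rewrite /= => -[//|//|/negP].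
  rewrite -leNgt => qr.
  have tri (a b c b' x y : R) : `|a - b| < x / 2 -> `|b - b'| <= y ->
      `|c - b'| < x / 2 -> `|a - c| <= y + x.
    rewrite !ltr_norml !ler_norml => /andP[? ?] /andP[? ?] /andP[? ?].
    by apply/andP; split; lra.
  exact: tri hq qr kr.
have p0 : (0^')%R (punctured m).
  exists (m.+1%:R^-1); first by rewrite /= invr_gt0.
  move=> h /=; rewrite sub0r normrN => hm h0.
  by rewrite /punctured normr_gt0 h0 hm.
exists ([set quot h u | h in punctured m], [set quot h u | h in punctured m]) => /=.
  by split; apply: filterS p0 => h ph; exists h.
move=> [a b] [/= [h ph <-] [k pk <-]]; rewrite /ball/=.
exact: le_lt_trans (osc_le _ _ ph pk) neps.
Unshelve. all: by end_near. Qed.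

(** The exceptional set has to be measurable before its measure can be computed from its slices. *)
Lemma measurable_not_derivable : measurable [set u | ~ derivable f u e].
Proof.
rewrite not_derivableE; apply: bigcupT_measurable => n.
apply: bigcapT_measurable => m.
apply: countable_bigcupT_measurable; first exact: countableP.
move=> q; have [pq|npq] := pselect (punctured m (ratr q.1) /\ punctured m (ratr q.2)); last first.
  rewrite (_ : [set u | _] = set0)//; apply/seteqP; split=> // u [? ? _].
  by apply: npq.
rewrite (_ : [set u | _] = (fun u => `|quot (ratr q.1) u - quot (ratr q.2) u|) @^-1`
  `]n.+1%:R^-1, +oo[%classic).
  rewrite -[X in measurable X]setTI; apply: continuous_measurable_plane => //.
  move=> u; apply: cvg_norm; apply: cvgB; apply: cvgM; try exact: cvg_cst.
  - apply: cvgB; last exact: f_cont.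
    apply: (@cvg_comp _ _ _ (fun u => ratr q.1 *: e + u) f); last exact: f_cont.
    by apply: cvgD; [exact: cvg_cst|exact: cvg_id].
  - apply: cvgB; last exact: f_cont.
    apply: (@cvg_comp _ _ _ (fun u => ratr q.2 *: e + u) f); last exact: f_cont.
    by apply: cvgD; [exact: cvg_cst|exact: cvg_id].
apply/seteqP; split=> u /=; rewrite in_itv/= andbT; first by case.
by case: pq.
Qed.

End QuotientOscillation.

Lemma quotient_e1E (f : T -> R) x y :
  (fun h : R => h^-1 *: ((f \o shift (x, y)) (h *: e1) - f (x, y))) =
  (fun h : R => h^-1 *: (((fun s => f (s, y)) \o shift x) (h *: 1) - f (x, y))).
Proof.
apply/funext => h; congr (_ *: (f _ - _)).
by rewrite /shift/= /e1; congr pair => /=; rewrite ?scaler0 ?add0r.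
Qed.

Lemma quotient_e2E (f : T -> R) x y :
  (fun h : R => h^-1 *: ((f \o shift (x, y)) (h *: e2) - f (x, y))) =
  (fun h : R => h^-1 *: (((fun s => f (x, s)) \o shift y) (h *: 1) - f (x, y))).
Proof.
apply/funext => h; congr (_ *: (f _ - _)).
by rewrite /shift/= /e2; congr pair => /=; rewrite ?scaler0 ?add0r.
Qed.

Lemma derivable_e1E (f : T -> R) x y :
  derivable f (x, y) e1 <-> derivable (fun s => f (s, y)) x 1.
Proof. by rewrite /derivable quotient_e1E. Qed.

Lemma derivable_e2E (f : T -> R) x y :
  derivable f (x, y) e2 <-> derivable (fun s => f (x, s)) y 1.
Proof. by rewrite /derivable quotient_e2E. Qed.

Lemma negligible_measure0 (A : set R) : measurable A -> mu.-negligible A -> mu A = 0%E.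
Proof.
move=> mA [B [mB B0 AB]]; apply/eqP; rewrite eq_le measure_ge0 andbT -B0.
by rewrite le_measure// ?inE.
Qed.

Lemma loc_lip_slice1 f y : loc_lip f -> {ae mu, forall x, derivable f (x, y) e1}.
Proof.
move=> lf; have : {ae mu, forall x, derivable (fun s => f (s, y)) x 1}.
  apply: locally_lipschitz_derivable_ae => n.
  have [K K0 fK] := lf (Num.max n `|y|); exists K => s t sn tn.
  rewrite (le_trans (fK _ _ _ _))//.
  - by rewrite norm_pair_le/= !le_max sn lexx orbT.
  - by rewrite norm_pair_le/= !le_max tn lexx orbT.
  - by rewrite ler_wpM2l// norm_pair_le/= subrr normr0 normr_ge0 lexx.
apply: filterS; first exact: (ae_filter_ringOfSetsType mu).
by move=> x; apply: (derivable_e1E f x y).2.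
Qed.

Lemma loc_lip_slice2 f x : loc_lip f -> {ae mu, forall y, derivable f (x, y) e2}.
Proof.
move=> lf; have : {ae mu, forall y, derivable (fun s => f (x, s)) y 1}.
  apply: locally_lipschitz_derivable_ae => n.
  have [K K0 fK] := lf (Num.max n `|x|); exists K => s t sn tn.
  rewrite (le_trans (fK _ _ _ _))//.
  - by rewrite norm_pair_le/= !le_max sn lexx orbT.
  - by rewrite norm_pair_le/= !le_max tn lexx orbT.
  - by rewrite ler_wpM2l// norm_pair_le/= subrr normr0 normr_ge0 lexx.
apply: filterS; first exact: (ae_filter_ringOfSetsType mu).
by move=> y; apply: (derivable_e2E f x y).2.
Qed.

Lemma loc_lip_derivable_e2_ae f : loc_lip f ->
  {ae leb2, forall u, derivable f u e2}.
Proof.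
move=> lf; have mN := measurable_not_derivable e2 (loc_lip_continuous lf).
exists [set u | ~ derivable f u e2]; split => //.
rewrite /lebesgue2 /product_measure1 integral0_eq// => x _.
apply: negligible_measure0; first exact: measurable_xsection.
apply: negligibleS (loc_lip_slice2 x lf) => y.
by rewrite /xsection/= inE.
Qed.

(** The product measure is defined by integrating vertical slices; the direction [e1] lives on
    horizontal ones, so Tonelli's theorem exchanges the order first. *)
Lemma loc_lip_derivable_e1_ae f : loc_lip f ->
  {ae leb2, forall u, derivable f u e1}.
Proof.
move=> lf; have mN := measurable_not_derivable e1 (loc_lip_continuous lf).
exists [set u | ~ derivable f u e1]; split => //.
have H := @indic_fubini_tonelli _ _ _ _ R mu mu _ mN.
rewrite indic_fubini_tonelli_FE// in H; rewrite [LHS]H.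
rewrite integral0_eq// => y _.
transitivity (mu (ysection [set u | ~ derivable f u e1] y)).
  exact: (congr1 (fun g => g y) (indic_fubini_tonelli_GE mu mN)).
apply: negligible_measure0; first exact: measurable_ysection.
apply: negligibleS (loc_lip_slice1 y lf) => x.
by rewrite /ysection/= inE.
Qed.

(** Total differentiability with the linear part in coordinates, which lets remainders be estimated
    by hand. *)
Definition frechet (f : T -> R) (u : T) := exists d1 d2 : R,
  forall eps, 0 < eps -> exists2 delta, 0 < delta & forall w : T, `|w| <= delta ->
    `|f (u + w) - f u - (d1 * w.1 + d2 * w.2)| <= eps * `|w|.

(** The mean value theorem for [f x - c * x]. It serves with [c = 0] for Lipschitz bounds and with
    [c] a partial derivative at the base point for remainders. *)
Lemma mean_value_bound (f df : R -> R) (a b c eps : R) :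
  (forall x : R, is_derive x (1 : R) f (df x)) ->
  (forall x, `|x - a| <= `|b - a| -> `|df x - c| <= eps) ->
  `|f b - f a - c * (b - a)| <= eps * `|b - a|.
Proof.
move=> fd dfc.
have fcont : continuous f.
  by move=> x; apply: differentiable_continuous; apply/derivable1_diffP.
have [ab|ba|->] := ltgtP a b; last by rewrite !subrr mulr0 subr0 normr0 mulr0.
- have [|k] := MVT ab (fun x _ => fd x); first exact: continuous_subspaceT.
  rewrite in_itv/= => /andP[ak kb] ->; rewrite -mulrBl normrM ler_wpM2r//.
  by apply: dfc; rewrite !ger0_norm; lra.
- have [|k] := MVT ba (fun x _ => fd x); first exact: continuous_subspaceT.
  rewrite in_itv/= => /andP[ak kb] H.
  have -> : f b - f a - c * (b - a) = (df k - c) * (b - a).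
    by rewrite -[f b - f a]opprB H; ring.
  rewrite normrM ler_wpM2r//.
  by apply: dfc; rewrite !ler0_norm; lra.
Qed.

Lemma is_derive_slice1 (p : T -> R) x y : derivable p (x, y) e1 ->
  is_derive x (1 : R) (fun s => p (s, y)) ('D_e1 p (x, y)).
Proof.
move=> dp; split; first exact: (derivable_e1E p x y).1 dp.
by rewrite /derive quotient_e1E.
Qed.

Lemma is_derive_slice2 (p : T -> R) x y : derivable p (x, y) e2 ->
  is_derive y (1 : R) (fun s => p (x, s)) ('D_e2 p (x, y)).
Proof.
move=> dp; split; first exact: (derivable_e2E p x y).1 dp.
by rewrite /derive quotient_e2E.
Qed.

Lemma compact_box (N : R) : compact (box N : set T).
Proof. by apply: compact_setX; exact: segment_compact. Qed.

Lemma continuous_bounded_box (f : T -> R) N : continuous f ->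
  exists2 M : R, 0 <= M & forall u, `|u| <= N -> `|f u| <= M.
Proof.
move=> cf; have := continuous_compact (continuous_subspaceT cf) (@compact_box N).
move=> /compact_bounded [M [_ H]]; exists (`|M| + 1); first by rewrite addr_ge0.
move=> u /boxP uN; apply: (H (`|M| + 1)); last by exists u.
by rewrite (le_lt_trans (ler_norm M))// ltrDl.
Qed.

Lemma continuous_normP (f : T -> R) u eps : continuous f -> 0 < eps ->
  exists2 r : R, 0 < r & forall v, `|u - v| < r -> `|f u - f v| <= eps.
Proof.
move=> cf e0; have /cvgrPdist_le /(_ _ e0) /nbhs_ballP [r /= r0 H] := cf u.
exists r => // v uv; apply: H; split; rewrite /ball/=.
  exact: (le_lt_trans (@norm_fst_le _ (u - v))).
exact: (le_lt_trans (@norm_snd_le _ (u - v))).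
Qed.

Lemma C1_loc_lip (p : T -> R) : C1 p -> loc_lip p.
Proof.
move=> pC1 N; have [d1 c1] := pC1 e1 (or_introl erefl).
have [d2 c2] := pC1 e2 (or_intror erefl).
(* [3 * N]: an intermediate point [z] satisfies [|z - s| <= |x - s| <= 2 * N] and [|s| <= N]. *)
have [M1 M10 m1] := continuous_bounded_box (3 * N) c1.
have [M2 M20 m2] := continuous_bounded_box (3 * N) c2.
exists (M1 + M2) => [|[x y] [s t] uN vN]; first by rewrite addr_ge0.
move: uN vN; rewrite !norm_pair_le/= => /andP[xN yN] /andP[sN tN].
have N0 : 0 <= N by rewrite (le_trans _ xN).
have -> : p (x, y) - p (s, t) = (p (x, y) - p (s, y) - 0 * (x - s)) +
  (p (s, y) - p (s, t) - 0 * (y - t)) by ring.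
rewrite (le_trans (ler_normD _ _))// mulrDl lerD//.
- rewrite (le_trans (@mean_value_bound _ _ s x 0 M1
    (fun z => is_derive_slice1 (d1 (z, y))) _))//.
    move=> z zs; rewrite subr0 m1// norm_pair_le/=; apply/andP; split; last lra.
    rewrite -(subrK s z) (le_trans (ler_normD _ _))//.
    by have := ler_normB x s; lra.
  by rewrite ler_wpM2l//; exact: (@norm_fst_le _ ((x, y) - (s, t))).
- rewrite (le_trans (@mean_value_bound _ _ t y 0 M2
    (fun z => is_derive_slice2 (d2 (s, z))) _))//.
    move=> z zs; rewrite subr0 m2// norm_pair_le/=; apply/andP; split; first lra.
    rewrite -(subrK t z) (le_trans (ler_normD _ _))//.
    by have := ler_normB y t; lra.
  by rewrite ler_wpM2l//; exact: (@norm_snd_le _ ((x, y) - (s, t))).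
Qed.

Lemma C1_frechet (p : T -> R) u : C1 p -> frechet p u.
Proof.
move=> pC1; have [d1 c1] := pC1 e1 (or_introl erefl).
have [d2 c2] := pC1 e2 (or_intror erefl).
exists ('D_e1 p u), ('D_e2 p u) => eps eps0.
have e20 : 0 < eps / 2 by rewrite divr_gt0.
have [r r0 H1] := continuous_normP u c1 e20.
have [s s0 H2] := continuous_normP u c2 e20.
have m0 : 0 < Num.min r s by rewrite lt_min r0.
exists (Num.min r s / 2); first by rewrite divr_gt0.
case: u c1 c2 H1 H2 => x y c1 c2 H1 H2 [h k] hk /=.
have near_u z : `|z| <= `|(h, k)| -> `|(x, y) - ((x, y) + z)| < Num.min r s.
  by move=> zw; rewrite opprD addrA subrr sub0r normrN; lra.
(* The path goes through the corner [(x, y + k)]; all intermediate points stay so close to the base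
   point that each partial derivative varies by at most [eps / 2]. *)
have -> : p ((x, y) + (h, k)) - p (x, y) -
    ('D_e1 p (x, y) * h + 'D_e2 p (x, y) * k) =
  (p (x + h, y + k) - p (x, y + k) - 'D_e1 p (x, y) * (x + h - x)) +
  (p (x, y + k) - p (x, y) - 'D_e2 p (x, y) * (y + k - y)).
  by rewrite (_ : (x, y) + (h, k) = (x + h, y + k))//; ring.
rewrite (le_trans (ler_normD _ _))// [eps]splitr mulrDl lerD//.
- rewrite (le_trans (@mean_value_bound _ _ x (x + h) _ (eps / 2)
    (fun z => is_derive_slice1 (d1 (z, y + k))) _))//.
    move=> z; rewrite [x + h]addrC addrK => zx; rewrite distrC.
    apply: H1; rewrite /= (_ : (z, y + k) = (x, y) + (z - x, k)); last first.
      by congr pair => /=; rewrite addrC subrK.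
    rewrite (lt_le_trans (near_u _ _)) ?ge_min ?lexx//.
    by rewrite norm_pair_le/= (le_trans zx (@norm_fst_le _ (h, k))) (@norm_snd_le _ (h, k)).
  rewrite [x + h]addrC addrK ler_wpM2l// ?(ltW e20)//; exact: (@norm_fst_le _ (h, k)).
- rewrite (le_trans (@mean_value_bound _ _ y (y + k) _ (eps / 2)
    (fun z => is_derive_slice2 (d2 (x, z))) _))//.
    move=> z; rewrite [y + k]addrC addrK => zx; rewrite distrC.
    apply: H2; rewrite /= (_ : (x, z) = (x, y) + (0, z - y)); last first.
      by congr pair => /=; rewrite ?addr0// addrC subrK.
    rewrite (lt_le_trans (near_u _ _)) ?ge_min ?lexx ?orbT//.
    by rewrite norm_pair_le/= normr0 normr_ge0 (le_trans zx (@norm_snd_le _ (h, k))).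
  rewrite [y + k]addrC addrK ler_wpM2l// ?(ltW e20)//; exact: (@norm_snd_le _ (h, k)).
Qed.

End PartialDerivatives.

(** * Test functions and their integrability *)

Section TestFunctions.
Context {R : realType}.
Local Notation T := (R * R)%type.

Definition supported (N : R) (f : T -> R) := forall u, N < `|u| -> f u = 0.

Definition test (f : T -> R) := (exists K, lip K f) /\ exists N, supported N f.

Lemma loc_lip_supported_lip f N : loc_lip f -> supported N f ->
  exists2 K, 0 <= K & lip K f.
Proof.
(* The unit margin: if [u] is in the support and [v] beyond the larger ball, then [|u - v| >= 1],
   and the bound [M] of [f] acts as a Lipschitz constant. *)
move=> lf sf; have [K K0 fK] := lf (`|N| + 1).
have [M M0 fM] := loc_lip_bounded (`|N| + 1) lf.
exists (K + M); first by rewrite addr_ge0.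
have NN : N <= `|N| by exact: ler_norm.
suff H u v : `|u| <= `|N| -> `|f u - f v| <= (K + M) * `|u - v|.
  move=> u v; have [uN|uN] := leP `|u| `|N|; first exact: H.
  have [vN|vN] := leP `|v| `|N|; first by rewrite distrC [X in _ * X]distrC; exact: H.
  rewrite (sf u) ?(le_lt_trans NN)// (sf v) ?(le_lt_trans NN)//.
  by rewrite subrr normr0 mulr_ge0// addr_ge0.
move=> uN; have [vN|vN] := leP `|v| (`|N| + 1).
  rewrite (le_trans (fK u v _ vN))//; first lra.
  by rewrite ler_wpM2r// lerDl.
rewrite (sf v) ?subr0; last lra.
rewrite (le_trans (fM u _))//; first lra.
have uv1 : 1 <= `|u - v|.
  have := ler_normD (v - u) u; rewrite subrK distrC; lra.
by rewrite -[leLHS]mulr1 ler_pM// lerDr.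
Qed.

Lemma test_loc_lip f : test f -> loc_lip f.
Proof. by case=> -[K fK] _; exact: lip_loc_lip fK. Qed.

Lemma test_continuous f : test f -> continuous f.
Proof. by move=> /test_loc_lip; exact: loc_lip_continuous. Qed.

Lemma testE f : test f <-> loc_lip f /\ exists N, supported N f.
Proof.
split=> [tf|[lf [N sf]]]; first by split; [exact: test_loc_lip|case: tf].
by have [K _ fK] := loc_lip_supported_lip lf sf; split; [exists K|exists N].
Qed.

Lemma test_supp f : test f ->
  exists K, exists N, [/\ 0 <= K, 0 <= N, lip K f & supported N f].
Proof.
move=> [[K fK] [N sf]]; exists `|K|, `|N|; split => //.
  by move=> u v; rewrite (le_trans (fK u v))// ler_wpM2r// ler_norm.
by move=> u uN; apply: sf; rewrite (le_lt_trans (ler_norm N)).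
Qed.

Lemma supported_dominated f N M : supported N f ->
  (forall u, `|u| <= N -> `|f u| <= M) -> dominated f N M.
Proof.
move=> sf fM u; have [uN|uN] := leP `|u| N; first by rewrite mulr1 fM.
by rewrite sf// normr0 mulr0.
Qed.

Lemma continuous_Jable f N : continuous f -> supported N f -> Jable f.
Proof.
move=> cf sf; have [M M0 fM] := continuous_bounded_box N cf.
apply: (@dominated_Jable _ _ N M); first exact: continuous_measurable_plane.
exact: supported_dominated.
Qed.

Lemma supportedMl f g N : supported N f -> supported N (fun u => f u * g u).
Proof. by move=> sf u uN; rewrite sf// mul0r. Qed.

Lemma supportedMr f g N : supported N g -> supported N (fun u => f u * g u).
Proof. by move=> sf u uN; rewrite sf// mulr0. Qed.

Lemma supported_shift f N z : supported N f ->
  supported (N + `|z|) (fun u => f (u + z)).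
Proof. by move=> sf u uN; apply: sf; have := ler_normB (u + z) z; rewrite addrK; lra. Qed.

Lemma continuous_shift (f : T -> R) (z : T) : continuous f -> continuous (fun u : T => f (u + z)).
Proof.
move=> cf u; apply: (@cvg_comp _ _ _ (fun u : T => u + z) f); last exact: cf.
by apply: cvgD; [exact: cvg_id|exact: cvg_cst].
Qed.

Lemma continuousM_plane (f g : T -> R) : continuous f -> continuous g ->
  continuous (fun u => f u * g u).
Proof. by move=> cf cg u; apply: cvgM; [exact: cf|exact: cg]. Qed.

Lemma continuousD_plane (f g : T -> R) : continuous f -> continuous g ->
  continuous (fun u => f u + g u).
Proof. by move=> cf cg u; apply: cvgD; [exact: cf|exact: cg]. Qed.

Lemma continuousB_plane (f g : T -> R) : continuous f -> continuous g ->
  continuous (fun u => f u - g u).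
Proof. by move=> cf cg u; apply: cvgB; [exact: cf|exact: cg]. Qed.

Lemma J_shiftM (f g : T -> R) (z : T) : Jable (fun u => f (u - z) * g u) ->
  J (fun u => f u * g (u + z)) = J (fun u => f (u - z) * g u).
Proof.
by move=> h; rewrite -(JT z h); congr J; apply/funext => u; rewrite addrK.
Qed.

End TestFunctions.

(** * Calculus of total differentiability, and a differentiable partition of unity *)

Section Frechet.
Context {R : realType}.
Local Notation T := (R * R)%type.

Lemma frechetZ (f : T -> R) k u : frechet f u -> frechet (fun u => k * f u) u.
Proof.
move=> [d1 [d2 H]]; exists (k * d1), (k * d2) => e e0.
have k0 : 0 < `|k| + 1 by rewrite ltr_wpDl.
have [d d0 Hd] := H (e / (`|k| + 1)) (divr_gt0 e0 k0); exists d => // w wd.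
have -> : k * f (u + w) - k * f u - (k * d1 * w.1 + k * d2 * w.2) =
  k * (f (u + w) - f u - (d1 * w.1 + d2 * w.2)) by ring.
rewrite normrM (le_trans (ler_wpM2l (normr_ge0 k) (Hd w wd)))//.
rewrite mulrA ler_wpM2r// mulrA mulrAC -[leRHS]mul1r ler_wpM2r ?(ltW e0)//.
by rewrite ler_pdivrMr// mul1r lerDl.
Qed.

Lemma frechetD (f g : T -> R) u : frechet f u -> frechet g u ->
  frechet (fun u => f u + g u) u.
Proof.
move=> [f1 [f2 Hf]] [g1 [g2 Hg]]; exists (f1 + g1), (f2 + g2) => e e0.
have e20 : 0 < e / 2 by rewrite divr_gt0.
have [d d0 Hd] := Hf _ e20; have [d' d'0 Hd'] := Hg _ e20.
exists (Num.min d d') => [|w]; first by rewrite lt_min d0.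
rewrite le_min => /andP[wd wd'].
have -> : f (u + w) + g (u + w) - (f u + g u) - ((f1 + g1) * w.1 + (f2 + g2) * w.2) =
  (f (u + w) - f u - (f1 * w.1 + f2 * w.2)) +
  (g (u + w) - g u - (g1 * w.1 + g2 * w.2)) by ring.
by rewrite (le_trans (ler_normD _ _))// [e]splitr mulrDl lerD// ?Hd ?Hd'.
Qed.

Lemma frechet_loc_bound (f : T -> R) u : frechet f u ->
  exists2 K, 0 <= K & exists2 d, 0 < d & forall w, `|w| <= d -> `|f (u + w) - f u| <= K * `|w|.
Proof.
move=> [d1 [d2 H]]; have [d d0 Hd] := H 1 ltr01.
exists (1 + `|d1| + `|d2|); first by rewrite !addr_ge0.
exists d => // w wd.
have h1 : `|d1 * w.1| <= `|d1| * `|w| by rewrite normrM ler_wpM2l// norm_fst_le.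
have h2 : `|d2 * w.2| <= `|d2| * `|w| by rewrite normrM ler_wpM2l// norm_snd_le.
have h3 := Hd w wd; rewrite mul1r in h3.
rewrite -(subrK (d1 * w.1 + d2 * w.2) (f (u + w) - f u)).
have h4 := ler_normD (f (u + w) - f u - (d1 * w.1 + d2 * w.2)) (d1 * w.1 + d2 * w.2).
have h5 := ler_normD (d1 * w.1) (d2 * w.2).
rewrite (le_trans h4)// !mulrDl mul1r; lra.
Qed.

Lemma frechetM (f g : T -> R) u : frechet f u -> frechet g u ->
  frechet (fun u => f u * g u) u.
Proof.
move=> ff fg.
have [Kf Kf0 [df df0 Hf]] := frechet_loc_bound ff.
have [Kg Kg0 [dg dg0 Hg]] := frechet_loc_bound fg.
(* With the coefficients [g u] and [f u] frozen, this already has the linear part of the product;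
   what remains is the product of two increments, of order [|w|^2]. *)
have := frechetD (frechetZ (g u) ff) (frechetZ (f u) fg).
move=> [d1 [d2 H]]; exists d1, d2 => e e0.
have e20 : 0 < e / 2 by rewrite divr_gt0.
have [d d0 Hd] := H _ e20.
have K1 : 0 < Kf * Kg + 1 by rewrite ltr_wpDl// mulr_ge0.
exists (Num.min (Num.min d (e / 2 / (Kf * Kg + 1))) (Num.min df dg)) => [|w].
  by rewrite !lt_min d0 df0 dg0 divr_gt0.
rewrite !le_min => /andP[/andP[wd we] /andP[wf wg]].
have -> : f (u + w) * g (u + w) - f u * g u - (d1 * w.1 + d2 * w.2) =
  (g u * f (u + w) + f u * g (u + w) - (g u * f u + f u * g u) - (d1 * w.1 + d2 * w.2)) +
  (f (u + w) - f u) * (g (u + w) - g u) by ring.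
rewrite (le_trans (ler_normD _ _))// [e]splitr [leRHS]mulrDl lerD//; first exact: Hd.
rewrite normrM (le_trans (ler_pM _ _ (Hf _ wf) (Hg _ wg)))//.
rewrite mulrACA mulrA ler_wpM2r//.
move: we; rewrite ler_pdivlMr// => we.
by rewrite (le_trans _ we)// mulrC ler_wpM2l// lerDl.
Qed.

(** The truncated power of degree 2, from which quadratic splines are built; it is C^1, with
    derivative [2 * Num.max 0 s]. *)
Definition pos2 (s : R) := (Num.max 0 s) ^+ 2.

Lemma pos2_derive (s h : R) : `|pos2 (s + h) - pos2 s - 2 * Num.max 0 s * h| <= h ^+ 2.
Proof.
rewrite /pos2 ler_norml; have [|] := leP 0 s => s0; have [|] := leP 0 (s + h) => sh;
  apply/andP; split; nra.
Qed.

Lemma frechet_pos2 (k1 k2 m : R) u :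
  frechet (fun u : T => pos2 (k1 * u.1 + k2 * u.2 + m)) u.
Proof.
pose s := k1 * u.1 + k2 * u.2 + m.
exists (2 * Num.max 0 s * k1), (2 * Num.max 0 s * k2) => e e0.
pose k := `|k1| + `|k2| + 1.
have k0 : 0 < k by rewrite ltr_wpDl// addr_ge0.
(* The remainder is at most [(k * |w|)^2], and [k^2 * |w| <= e] turns this into [e * |w|]. *)
exists (e / k ^+ 2) => [|w wd]; first by rewrite divr_gt0// exprn_gt0.
have -> : k1 * (u + w).1 + k2 * (u + w).2 + m = s + (k1 * w.1 + k2 * w.2).
  by rewrite /s /=; ring.
have -> : 2 * Num.max 0 s * k1 * w.1 + 2 * Num.max 0 s * k2 * w.2 =
  2 * Num.max 0 s * (k1 * w.1 + k2 * w.2) by ring.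
rewrite (le_trans (pos2_derive _ _))//.
have H : `|k1 * w.1 + k2 * w.2| <= k * `|w|.
  rewrite (le_trans (ler_normD _ _))// /k -addrA mulrDl !normrM lerD//.
    by rewrite ler_wpM2l// norm_fst_le.
  rewrite mulrDl mul1r (@le_trans _ _ (`|k2| * `|w|)) ?lerDl//.
  by rewrite ler_wpM2l// norm_snd_le.
rewrite -real_normK ?num_real// (@le_trans _ _ ((k * `|w|) ^+ 2))//.
  by rewrite ler_sqr ?nnegrE// mulr_ge0// ltW.
rewrite exprMn [`|w| ^+ 2]expr2 mulrA ler_wpM2r//.
by rewrite mulrC -ler_pdivlMr ?exprn_gt0.
Qed.

Lemma lip_max0 (k1 k2 m : R) :
  lip (`|k1| + `|k2|) (fun u : T => Num.max 0 (k1 * u.1 + k2 * u.2 + m)).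
Proof.
move=> u v.
have h (s t : R) : `|Num.max 0 s - Num.max 0 t| <= `|s - t|.
  have h1 := ler_norm (s - t); have h2 := ler_norm (t - s); rewrite distrC in h2.
  rewrite ler_norml !maxEle.
  by case: (leP 0 s) => ?; case: (leP 0 t) => ?; apply/andP; split; lra.
rewrite (le_trans (h _ _))//.
have -> : k1 * u.1 + k2 * u.2 + m - (k1 * v.1 + k2 * v.2 + m) =
  k1 * (u - v).1 + k2 * (u - v).2 by rewrite /=; ring.
rewrite (le_trans (ler_normD _ _))// mulrDl !normrM lerD// ler_wpM2l//.
  exact: norm_fst_le.
exact: norm_snd_le.
Qed.

Lemma loc_lip_pos2 (k1 k2 m : R) :
  loc_lip (fun u : T => pos2 (k1 * u.1 + k2 * u.2 + m)).
Proof.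
have h := lip_loc_lip (@lip_max0 k1 k2 m).
by have := loc_lipM h h; rewrite /pos2; under eq_fun do rewrite -expr2.
Qed.

End Frechet.

Section PartitionOfUnity.
Context {R : realType}.
Local Notation T := (R * R)%type.

(** Half the second difference of [pos2]: a C^1 step that rises from 0 at [s = 0] to 1 at [s = 2],
    being constant as soon as all three terms are genuine quadratics. *)
Let sig (s : R) := (pos2 s - 2 * pos2 (s - 1) + pos2 (s - 2)) / 2.

(* The quadratic B-spline; its integer translates sum to 1 because it is the
   backward difference of [sig], which is 0 on the left and 1 on the right. *)
Definition bspline (s : R) :=
  (pos2 s - 3 * pos2 (s - 1) + 3 * pos2 (s - 2) - pos2 (s - 3)) / 2.

Let bsplineE s : bspline s = sig s - sig (s - 1).
Proof.
rewrite /bspline /sig.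
have -> : s - 1 - 1 = s - 2 by ring.
have -> : s - 1 - 2 = s - 3 by ring.
by field.
Qed.

Let sig0 s : s <= 0 -> sig s = 0.
Proof.
move=> s0; rewrite /sig /pos2 !(max_idPl _); lra.
Qed.

Let sig1 s : 2 <= s -> sig s = 1.
Proof. by move=> s2; rewrite /sig /pos2 !(max_idPr _); lra. Qed.

Lemma bspline_ge0 s : 0 <= bspline s.
Proof.
rewrite /bspline divr_ge0// /pos2.
have [|] := leP 0 s => s0; have [|] := leP 0 (s - 1) => s1;
have [|] := leP 0 (s - 2) => s2; have [|] := leP 0 (s - 3) => s3; try lra; nra.
Qed.

Lemma bspline_neq0 s : bspline s != 0 -> `|s| <= 3.
Proof.
move=> bs; rewrite leNgt; apply/negP => s3; move/negP : bs; apply; apply/eqP.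
rewrite bsplineE; move: s3; rewrite lter_normr => /orP[s3|s3].
  by rewrite !sig1 ?subrr//; lra.
by rewrite !sig0 ?subrr//; lra.
Qed.

Lemma sum_bspline n s : 2 <= s <= n%:R -> \sum_(i < n) bspline (s - i%:R) = 1.
Proof.
move=> /andP[s2 sn].
have -> : \sum_(i < n) bspline (s - i%:R) = sig s - sig (s - n%:R).
  elim: n {sn} => [|n IH]; first by rewrite big_ord0 subr0 subrr.
  rewrite big_ord_recr/= IH bsplineE.
  by rewrite (_ : s - n%:R - 1 = s - n.+1%:R); [ring|rewrite -natr1; ring].
by rewrite sig1// sig0 ?subr0//; lra.
Qed.

Lemma loc_lip_bspline (k1 k2 m : R) :
  loc_lip (fun u : T => bspline (k1 * u.1 + k2 * u.2 + m)).
Proof.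
rewrite (_ : (fun u => _) = (fun u : T =>
    2^-1 * (pos2 (k1 * u.1 + k2 * u.2 + m) +
    (-3) * pos2 (k1 * u.1 + k2 * u.2 + (m - 1)) +
    3 * pos2 (k1 * u.1 + k2 * u.2 + (m - 2)) +
    (-1) * pos2 (k1 * u.1 + k2 * u.2 + (m - 3))))); last first.
  by apply/funext => u; rewrite /bspline !addrA; field.
apply: loc_lipZ; do 3 ?apply: loc_lipD; try apply: loc_lipZ; exact: loc_lip_pos2.
Qed.

Lemma frechet_bspline (k1 k2 m : R) u :
  frechet (fun u : T => bspline (k1 * u.1 + k2 * u.2 + m)) u.
Proof.
rewrite (_ : (fun u => _) = (fun u : T =>
    2^-1 * (pos2 (k1 * u.1 + k2 * u.2 + m) +
    (-3) * pos2 (k1 * u.1 + k2 * u.2 + (m - 1)) +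
    3 * pos2 (k1 * u.1 + k2 * u.2 + (m - 2)) +
    (-1) * pos2 (k1 * u.1 + k2 * u.2 + (m - 3))))); last first.
  by apply/funext => v; rewrite /bspline !addrA; field.
apply: frechetZ; do 3 ?apply: frechetD; try apply: frechetZ; exact: frechet_pos2.
Qed.

(** Products of B-splines in the two coordinates; tents would also sum to 1, but the cells must be
    differentiable everywhere to carry the increments moved off [psi]. *)
Lemma partition_of_unity (N delta : R) : 0 < delta ->
  exists (I : finType) (chi : I -> T -> R) (c : I -> T),
  [/\ forall i, loc_lip (chi i), forall i u, frechet (chi i) u,
      forall i u, 0 <= chi i u,
      forall i u, chi i u != 0 -> `|u - c i| <= delta &
      forall u, `|u| <= N -> \sum_i chi i u = 1].
Proof.
(* The scale [k] shrinks the bound 3 of [bspline_neq0] to [delta]. The shift [m] and the number [n]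
   of translates put [k * a + m] into [[2, n]] for all [|a| <= |N|], the range where [sum_bspline]
   gives 1. *)
move=> d0; pose k := 3 / delta; have k0 : 0 < k by rewrite divr_gt0.
pose m := k * `|N| + 2.
pose n := Num.bound (k * `|N| + m).
exists ('I_n * 'I_n)%type,
  (fun (i : 'I_n * 'I_n) u => bspline (k * u.1 + 0 * u.2 + (m - i.1%:R)) *
              bspline (0 * u.1 + k * u.2 + (m - i.2%:R))),
  (fun i : 'I_n * 'I_n => ((i.1%:R - m) / k, (i.2%:R - m) / k)); split.
- by move=> i; apply: loc_lipM; exact: loc_lip_bspline.
- by move=> i u; apply: frechetM; exact: frechet_bspline.
- by move=> i u; rewrite mulr_ge0// bspline_ge0.
- move=> i u; rewrite mulf_eq0 negb_or => /andP[/bspline_neq0 h1 /bspline_neq0 h2].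
  have H (a b : R) : `|k * a + (m - b)| <= 3 -> `|a - (b - m) / k| <= delta.
    have -> : k * a + (m - b) = k * (a - (b - m) / k) by field; rewrite gt_eqF.
    by rewrite normrM gtr0_norm// /k -ler_pdivlMl// invf_div divfK.
  rewrite norm_pair_le/=; apply/andP; split; apply: H.
    by rewrite mul0r addr0 in h1.
  by rewrite mul0r add0r in h2.
- move=> u uN; rewrite -(pair_big xpredT xpredT (fun i j : 'I_n =>
    bspline (k * u.1 + 0 * u.2 + (m - i%:R)) *
    bspline (0 * u.1 + k * u.2 + (m - j%:R))))/=.
  have H (a : R) : `|a| <= `|u| -> 2 <= k * a + m <= n%:R.
    move=> au; have : `|a| <= `|N| by rewrite (le_trans au)// (le_trans uN)// ler_norm.
    move=> aN; have kaN : `|k * a| <= k * `|N|.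
      by rewrite normrM gtr0_norm// ler_wpM2l// ltW.
    move: kaN; rewrite ler_norml => /andP[h1 h2].
    have nb : k * `|N| + m < n%:R.
      by rewrite archi_boundP// /m !addr_ge0// mulr_ge0// ltW.
    by apply/andP; split; rewrite /m in nb *; lra.
  transitivity ((\sum_(i < n) bspline (k * u.1 + m - i%:R)) *
                \sum_(j < n) bspline (k * u.2 + m - j%:R)).
    rewrite big_distrlr/=; apply: eq_bigr => i _; apply: eq_bigr => j _.
    by congr (bspline _ * bspline _); ring.
  by rewrite !sum_bspline ?mulr1 ?H ?norm_fst_le ?norm_snd_le.
Qed.

End PartitionOfUnity.

(** * The comparison for a constant velocity *)

Section FrozenField.
Context {R : realType}.
Local Notation T := (R * R)%type.

Lemma cvg_at_right0P (g : R -> R) : g h @[h --> 0^'+] --> 0 <->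
  forall eps, 0 < eps -> exists2 delta, 0 < delta &
    forall h, 0 < h < delta -> `|g h| <= eps.
Proof.
split=> [/cvgr0Pnorm_le H eps e0|H].
  have [d /= d0 Hd] := H _ e0; exists d => // h /andP[h0 hd].
  by apply: Hd => //=; rewrite sub0r normrN gtr0_norm.
apply/cvgr0Pnorm_le => eps e0; have [d d0 Hd] := H _ e0.
exists d => // h /= hd h0; apply: Hd; rewrite h0/=.
by move: hd; rewrite sub0r normrN gtr0_norm.
Qed.

Lemma J_linear4 (k : R) (f1 f2 f3 f4 : T -> R) :
  Jable f1 -> Jable f2 -> Jable f3 -> Jable f4 ->
  J (fun u => k * ((f1 u - f2 u) + (f3 u - f4 u))) =
    k * ((J f1 - J f2) + (J f3 - J f4)).
Proof.
move=> j1 j2 j3 j4.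
have jB (f g : T -> R) : Jable f -> Jable g -> Jable (fun u => f u - g u).
  move=> jf jg; rewrite (_ : (fun u => _) = (fun u => f u + (-1) * g u)).
    by apply: JableD => //; exact: JableZ.
  by apply/funext => u; rewrite mulN1r.
have j12 := jB _ _ j1 j2; have j34 := jB _ _ j3 j4.
rewrite (JZ k (JableD j12 j34)) (JD j12 j34) (JB j1 j2) (JB j3 j4).
by [].
Qed.

Lemma J_sum (I : finType) (f : I -> T -> R) : (forall i, Jable (f i)) ->
  Jable (fun u => \sum_i f i u) /\ J (fun u => \sum_i f i u) = \sum_i J (f i).
Proof.
move=> jf; elim: (index_enum I) => [|i s [IH1 IH2]].
  under eq_fun do rewrite big_nil; rewrite big_nil; split.
    by apply: (@continuous_Jable _ _ 0) => // u; exact: cvg_cst.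
  by rewrite /J Rintegral_cst// mul0r.
under eq_fun do rewrite big_cons; rewrite big_cons; split.
  exact: JableD.
by rewrite JD// IH2.
Qed.

(* [incr psi h w u] is [o(h)] at every point of differentiability of [psi]. *)
Definition incr (psi : T -> R) (h : R) (w u : T) : R :=
  psi (u + h *: w) - psi u + w.1 * (psi (u - h *: e1) - psi u)
    + w.2 * (psi (u - h *: e2) - psi u).

Lemma norm_e1 : `|e1 : T| = 1.
Proof. by rewrite norm_pairE/= normr1 normr0 max_l. Qed.

Lemma norm_e2 : `|e2 : T| = 1.
Proof. by rewrite norm_pairE/= normr1 normr0 max_r. Qed.

(** Each of the three terms contributes [K * h * |w - w'|]. This is the cost of freezing the
    velocity on a cell, and its factor [h] cancels the division by [h]. *)
Lemma incr_lip psi K h w w' u : lip K psi -> 0 <= K -> 0 <= h ->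
  `|incr psi h w u - incr psi h w' u| <= 3 * K * h * `|w - w'|.
Proof.
move=> psiK K0 h0; rewrite /incr.
have H1 : `|psi (u + h *: w) - psi (u + h *: w')| <= K * (h * `|w - w'|).
  rewrite (le_trans (psiK _ _))// ler_wpM2l// opprD addrACA subrr add0r.
  by rewrite -scalerBr normrZ ger0_norm.
have He (e : T) : `|e| = 1 -> `|psi (u - h *: e) - psi u| <= K * h.
  move=> ne; rewrite (le_trans (psiK _ _))// ler_wpM2l//.
  by rewrite addrC addrA addNr add0r normrN normrZ ne mulr1 ger0_norm.
have H2 : `|(w.1 - w'.1) * (psi (u - h *: e1) - psi u)| <= `|w - w'| * (K * h).
  by rewrite normrM ler_pM// ?He ?norm_e1//; exact: (@norm_fst_le _ (w - w')).
have H3 : `|(w.2 - w'.2) * (psi (u - h *: e2) - psi u)| <= `|w - w'| * (K * h).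
  by rewrite normrM ler_pM// ?He ?norm_e2//; exact: (@norm_snd_le _ (w - w')).
move: H1 H2 H3; set A := psi (u + _); set A' := psi (u + _).
set B := psi (u - _) - _; set C := psi (u - _) - _; set W := `|w - w'|.
move=> H1 H2 H3.
have -> : A - psi u + w.1 * B + w.2 * C - (A' - psi u + w'.1 * B + w'.2 * C) =
  (A - A') + ((w.1 - w'.1) * B + (w.2 - w'.2) * C) by ring.
have h4 := ler_normD (A - A') ((w.1 - w'.1) * B + (w.2 - w'.2) * C).
have h5 := ler_normD ((w.1 - w'.1) * B) ((w.2 - w'.2) * C).
have e1 : K * (h * W) = K * h * W by ring.
have e2 : W * (K * h) = K * h * W by ring.
rewrite e1 in H1; rewrite e2 in H2 H3.
have -> : 3 * K * h * W = 3 * (K * h * W) by ring.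
lra.
Qed.

Lemma continuous_incr psi h w : continuous psi -> continuous (incr psi h w).
Proof.
move=> cpsi; rewrite /incr; apply: continuousD_plane; first apply: continuousD_plane.
- by apply: continuousB_plane => //; exact: continuous_shift.
- apply: continuousM_plane; first by move=> u; exact: cvg_cst.
  by apply: continuousB_plane => //; exact: continuous_shift.
- apply: continuousM_plane; first by move=> u; exact: cvg_cst.
  by apply: continuousB_plane => //; exact: continuous_shift.
Qed.

(** For constant [w] every term of [incr] is a translate of [psi], so translation invariance moves
    the increments to [q]. There they are [o(h)] at every point by differentiability and [O(h)]
    uniformly by the Lipschitz bound. *)
Lemma frozen_cvg (psi q : T -> R) (N : R) (w : T) :
  test psi -> loc_lip q -> supported N q -> (forall u, frechet q u) ->
  J (fun u => h^-1 * (q u * incr psi h w u)) @[h --> 0^'+] --> 0.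
Proof.
move=> tpsi lq sq fq.
have [K [N' [K0 N'0 psiK spsi]]] := test_supp tpsi.
have [Kq Kq0 qK] := loc_lip_supported_lip lq sq.
have cpsi := test_continuous tpsi.
have cq := loc_lip_continuous lq.
(* The same combination with [psi] and [q] exchanged and every shift reversed. *)
pose g h u := psi u * (q (u - h *: w) - q u + w.1 * (q (u + h *: e1) - q u)
    + w.2 * (q (u + h *: e2) - q u)).
have jq (f : T -> R) : continuous f -> Jable (fun u => q u * f u).
  move=> cf; apply: (@continuous_Jable _ _ N); first exact: continuousM_plane.
  exact: supportedMl.
have jpsi (f : T -> R) : continuous f -> Jable (fun u => psi u * f u).
  move=> cf; apply: (@continuous_Jable _ _ N'); first exact: continuousM_plane.
  exact: supportedMl.
have swap (z : T) : J (fun u => q u * psi (u + z)) = J (fun u => psi u * q (u - z)).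
  rewrite J_shiftM; first by congr J; apply/funext => u; rewrite mulrC.
  rewrite (_ : (fun u => _) = (fun u => psi u * q (u - z))).
    by apply: jpsi; exact: continuous_shift.
  by apply/funext => u; rewrite mulrC.
have swap0 : J (fun u => q u * psi u) = J (fun u => psi u * q u).
  by congr J; apply/funext => u; rewrite mulrC.
(* One linearity statement for both sides of the exchange: [r] is the factor left in place and [r1]
   the translated one. *)
have expand (f : T -> R) (z z1 z2 : T) (r r1 : T -> R) (k : R) :
    (forall u, f u = k * ((r u * r1 (u + z) - r u * r1 u) +
      (w.1 * (r u * r1 (u + z1) - r u * r1 u) + w.2 * (r u * r1 (u + z2) - r u * r1 u)))) ->
    continuous r1 -> (forall f, continuous f -> Jable (fun u => r u * f u)) ->
    J f = k * ((J (fun u => r u * r1 (u + z)) - J (fun u => r u * r1 u)) +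
      (w.1 * (J (fun u => r u * r1 (u + z1)) - J (fun u => r u * r1 u)) +
       w.2 * (J (fun u => r u * r1 (u + z2)) - J (fun u => r u * r1 u)))).
  move=> fE cr jr.
  have j0 := jr _ cr.
  have js s := jr _ (continuous_shift (z := s) cr).
  rewrite (_ : f = (fun u => k * ((r u * r1 (u + z) - (1 + w.1 + w.2) * (r u * r1 u)) +
    (w.1 * (r u * r1 (u + z1)) - (- w.2) * (r u * r1 (u + z2)))))); last first.
    by apply/funext => u; rewrite fE; ring.
  rewrite J_linear4//; try exact: JableZ.
  by rewrite !JZ//; ring.
have E h : J (fun u => h^-1 * (q u * incr psi h w u)) = J (fun u => h^-1 * g h u).
  rewrite (expand _ (h *: w) (- (h *: e1)) (- (h *: e2)) q psi h^-1) => [| |//|//].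
    rewrite [RHS](expand _ (- (h *: w)) (h *: e1) (h *: e2) psi q h^-1) => [| |//|//].
      by rewrite !swap !swap0 !opprK.
    by move=> u; rewrite /g; ring.
  by move=> u; rewrite /incr; ring.
under eq_fun do rewrite E.
have [M M0 psiM] := continuous_bounded_box N' cpsi.
apply: (@J_cvg_at_right0 _ _ N' (M * (Kq * (`|w| + `|w| + `|w|))) 1) => //.
- move=> h _; apply: continuous_measurable_plane.
  have cc (r : R) : continuous (cst r : T -> R) by move=> u; exact: cvg_cst.
  apply: (continuousM_plane (cc _)); apply: continuousM_plane => //.
  apply: continuousD_plane; first apply: continuousD_plane.
  + by apply: continuousB_plane => //; exact: continuous_shift.
  + apply: (continuousM_plane (cc _)).
    by apply: continuousB_plane => //; exact: continuous_shift.
  + apply: (continuousM_plane (cc _)).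
    by apply: continuousB_plane => //; exact: continuous_shift.
- move=> h /andP[h0 _]; apply: supported_dominated.
    by move=> u uN; rewrite /g spsi// mul0r mulr0.
  move=> u uN; rewrite /g mulrCA normrM ler_pM ?psiM//.
  rewrite normrM gtr0_norm ?invr_gt0// ler_pdivrMl//.
  have H z : `|q (u + z) - q u| <= Kq * `|z|.
    by rewrite (le_trans (qK _ _))// addrC addKr.
  have H0 := H (- (h *: w)); have H1 := H (h *: e1); have H2 := H (h *: e2).
  rewrite normrN normrZ gtr0_norm// in H0.
  rewrite normrZ gtr0_norm// norm_e1 mulr1 in H1.
  rewrite normrZ gtr0_norm// norm_e2 mulr1 in H2.
  have h1 : `|w.1 * (q (u + h *: e1) - q u)| <= `|w| * (Kq * h).
    by rewrite normrM ler_pM// norm_fst_le.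
  have h2 : `|w.2 * (q (u + h *: e2) - q u)| <= `|w| * (Kq * h).
    by rewrite normrM ler_pM// norm_snd_le.
  rewrite (le_trans (ler_normD _ _))// (le_trans (lerD (ler_normD _ _) h2))//.
  rewrite (le_trans (lerD (lerD H0 h1) (lexx _)))// le_eqVlt; apply/orP; left.
  by apply/eqP; ring.
- apply: ae2W => u; apply/cvg_at_right0P => eps e0.
  have [d1 [d2 H]] := fq u.
  pose k := `|psi u| * (`|w| + `|w| + `|w|) + 1.
  have k0 : 0 < k by rewrite ltr_wpDl// mulr_ge0// !addr_ge0.
  have [d d0 Hd] := H _ (divr_gt0 e0 k0).
  (* The denominator keeps all three displacements [h w], [h e1] and [h e2] within [d]. *)
  exists (d / (`|w| + 1)) => [|h /andP[h0 hd]].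
    by rewrite divr_gt0// ltr_wpDl.
  have {}hd : h * `|w| + h <= d.
    by rewrite -{2}[h]mulr1 -mulrDr -ler_pdivlMr ?ltW// ltr_wpDl.
  have Hz z : `|z| <= h * `|w| + h ->
      `|q (u + z) - q u - (d1 * z.1 + d2 * z.2)| <= eps / k * `|z|.
    by move=> zh; apply: Hd; exact: le_trans zh hd.
  have hw0 : 0 <= h * `|w| by rewrite mulr_ge0// ltW.
  have H0 : `|q (u - h *: w) - q u + (d1 * (h * w.1) + d2 * (h * w.2))| <= eps / k * (h * `|w|).
    have := Hz (- (h *: w)); rewrite normrN normrZ gtr0_norm// lerDl => /(_ (ltW h0)).
    by rewrite /= !mulrN -opprD opprK.
  have H1 : `|q (u + h *: e1) - q u - d1 * h| <= eps / k * h.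
    have := Hz (h *: e1); rewrite normrZ gtr0_norm// norm_e1 mulr1 lerDr => /(_ hw0).
    by rewrite /= !scaler0 mulr0 addr0 -[h *: 1]/(h * 1) mulr1.
  have H2 : `|q (u + h *: e2) - q u - d2 * h| <= eps / k * h.
    have := Hz (h *: e2); rewrite normrZ gtr0_norm// norm_e2 mulr1 lerDr => /(_ hw0).
    by rewrite /= !scaler0 mulr0 add0r -[h *: 1]/(h * 1) mulr1.
  rewrite /g normrM gtr0_norm ?invr_gt0// ler_pdivrMl// normrM.
  set A := q (u - _) - _ in H0 *; set B := q (u + _) - _ in H1 *.
  set C := q (u + _) - _ in H2 *.
  (* The linear parts cancel: [- h w] contributes [- h (d1 w.1 + d2 w.2)], and the coordinate
     shifts, weighted by [w.1] and [w.2], restore it. *)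
  have -> : A + w.1 * B + w.2 * C = (A + (d1 * (h * w.1) + d2 * (h * w.2))) +
    (w.1 * (B - d1 * h) + w.2 * (C - d2 * h)) by ring.
  have h1 : `|w.1 * (B - d1 * h)| <= `|w| * (eps / k * h).
    by rewrite normrM ler_pM// norm_fst_le.
  have h2 : `|w.2 * (C - d2 * h)| <= `|w| * (eps / k * h).
    by rewrite normrM ler_pM// norm_snd_le.
  apply: (@le_trans _ _ (`|psi u| * (eps / k * h * (`|w| + `|w| + `|w|)))).
    rewrite ler_wpM2l// (le_trans (ler_normD _ _))//.
    rewrite (le_trans (lerD H0 (ler_normD _ _)))//.
    rewrite (le_trans (lerD (lexx _) (lerD h1 h2)))// le_eqVlt; apply/orP; left.
    by apply/eqP; ring.
  have -> : `|psi u| * (eps / k * h * (`|w| + `|w| + `|w|)) =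
    h * eps * ((`|psi u| * (`|w| + `|w| + `|w|)) / k) by ring.
  rewrite -[leRHS]mulr1 ler_wpM2l//; first by rewrite mulr_ge0// ltW.
  by rewrite ler_pdivrMr// mul1r /k lerDl.
Qed.

End FrozenField.

Section DivQuotient.
Context {R : realType}.
Local Notation T := (R * R)%type.

Definition div_quot (F1 F2 : T -> R) (h : R) (u : T) : R :=
  h^-1 * ((F1 (u + h *: e1) - F1 u) + (F2 (u + h *: e2) - F2 u)).

(** Summation by parts: forward differences of the flux become backward differences of [psi], whence
    the shifts [u - h *: e1] and [u - h *: e2] in [incr]. *)
Lemma div_quot_by_parts (F1 F2 psi : T -> R) (h : R) :
  continuous F1 -> continuous F2 -> test psi ->
  J (fun u => psi u * div_quot F1 F2 h u) =
  J (fun u => h^-1 * (F1 u * (psi (u - h *: e1) - psi u) +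
                      F2 u * (psi (u - h *: e2) - psi u))).
Proof.
move=> cF1 cF2 tpsi; have cpsi := test_continuous tpsi.
have [_ [N [_ N0 _ spsi]]] := test_supp tpsi.
have jl (f : T -> R) : continuous f -> Jable (fun u => psi u * f u).
  move=> cf; apply: (@continuous_Jable _ _ N); first exact: continuousM_plane.
  exact: supportedMl.
have jr (f : T -> R) (z : T) : continuous f -> Jable (fun u => f u * psi (u + z)).
  move=> cf; apply: (@continuous_Jable _ _ (N + `|z|)).
    by apply: continuousM_plane => //; exact: continuous_shift.
  by apply: supportedMr; exact: supported_shift.
have jr0 (f : T -> R) : continuous f -> Jable (fun u => f u * psi u).
  move=> cf; apply: (@continuous_Jable _ _ N); first exact: continuousM_plane.
  exact: supportedMr.
have swap (f : T -> R) (z : T) : continuous f ->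
    J (fun u => psi u * f (u + z)) = J (fun u => f u * psi (u - z)).
  move=> cf; rewrite J_shiftM; first by congr J; apply/funext => u; rewrite mulrC.
  rewrite (_ : (fun u => _) = (fun u => f u * psi (u - z))); first exact: jr.
  by apply/funext => u; rewrite mulrC.
have swap0 (f : T -> R) : J (fun u => psi u * f u) = J (fun u => f u * psi u).
  by congr J; apply/funext => u; rewrite mulrC.
transitivity (J (fun u => h^-1 *
    ((psi u * F1 (u + h *: e1) - psi u * F1 u) +
     (psi u * F2 (u + h *: e2) - psi u * F2 u)))).
  by congr J; apply/funext => u; rewrite /div_quot; ring.
transitivity (J (fun u => h^-1 *
    ((F1 u * psi (u - h *: e1) - F1 u * psi u) +
     (F2 u * psi (u - h *: e2) - F2 u * psi u)))); last first.
  by congr J; apply/funext => u; ring.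
rewrite !J_linear4; try exact: jr; try exact: jr0; try exact: jl;
  try (apply: jl; exact: continuous_shift).
by rewrite !swap// !swap0.
Qed.

End DivQuotient.

(** * Transport along a Lipschitz field against the divergence of its flux *)

Section AdvectionDivergence.
Context {R : realType}.
Local Notation T := (R * R)%type.
Variables (p : T -> R) (b : T -> T) (L : R).
Hypotheses (p_lip : loc_lip p) (p_frechet : forall u, frechet p u).
Hypotheses (L0 : 0 <= L) (b_lip : forall u v, `|b u - b v| <= L * `|u - v|).

(** The explicit Euler step [u + h *: b u] stands in for the flow; [push_advection_cvg] compares the
    two. *)
Definition advection (psi : T -> R) (h : R) : R :=
  J (fun u => h^-1 * ((psi (u + h *: b u) - psi u) * p u)).

Definition flux1 u := p u * (b u).1.
Definition flux2 u := p u * (b u).2.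

Definition div_quotient := div_quot flux1 flux2.

Lemma loc_lip_flux1 : loc_lip flux1.
Proof.
apply: loc_lipM => //; apply: (@lip_loc_lip _ L) => u v.
by rewrite (le_trans (@norm_fst_le _ (b u - b v))).
Qed.

Lemma loc_lip_flux2 : loc_lip flux2.
Proof.
apply: loc_lipM => //; apply: (@lip_loc_lip _ L) => u v.
by rewrite (le_trans (@norm_snd_le _ (b u - b v))).
Qed.

Lemma field_growth u : `|b u| <= (L + `|b 0|) * (1 + `|u|).
Proof.
have h1 : `|b u - b 0| <= L * `|u| by have := b_lip u 0; rewrite subr0.
have h2 : `|b u| <= `|b u - b 0| + `|b 0|.
  by have := ler_normD (b u - b 0) (b 0); rewrite subrK.
have h3 : 0 <= `|b 0| * `|u| by rewrite mulr_ge0.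
rewrite mulrDr mulr1 mulrDl.
by move: L0 => ?; lra.
Qed.

Let C := L + `|b 0|.

(** For such [h] the displacement is at most half of [1 + |u|], so points beyond [2 * N + 2] stay
    beyond [N], uniformly in [h]. Velocities within [L] of [b u] are allowed in order to include the
    value of [b] at a point at distance at most 1. *)
Lemma far_field (N : R) (w u : T) (h : R) : `|w - b u| <= L -> 0 <= h -> h * (2 * (L + C)) <= 1 ->
  2 * N + 2 < `|u| -> N < `|u + h *: w|.
Proof.
move=> wb h0 hC Nu.
have h1 := ler_normD (w - b u) (b u); rewrite subrK in h1.
have h2 := field_growth u; rewrite -/C in h2.
have h3 := ler_normB (u + h *: w) (h *: w); rewrite addrK normrZ ger0_norm// in h3.
have Lu : 0 <= L * `|u| by rewrite mulr_ge0.
have h4 : `|w| <= (L + C) * (1 + `|u|) by lra.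
have h5 : h * `|w| <= h * ((L + C) * (1 + `|u|)) by rewrite ler_wpM2l.
have h6 : h * (2 * (L + C)) * (1 + `|u|) <= 1 * (1 + `|u|).
  by rewrite ler_wpM2r// addr_ge0.
have h7 : h * (2 * (L + C)) * (1 + `|u|) = 2 * (h * ((L + C) * (1 + `|u|))) by ring.
rewrite h7 in h6; lra.
Qed.

Lemma continuous_field : continuous b.
Proof.
move=> u; apply/cvgrPdist_le => e e0.
have L1 : 0 < L + 1 by rewrite ltr_wpDl.
near=> v.
have uv : `|u - v| <= e / (L + 1).
  near: v; apply: (@cvgr_dist_le _ _ _ _ _ id u cvg_id).
  by rewrite divr_gt0.
rewrite (le_trans (b_lip _ _))// (@le_trans _ _ ((L + 1) * `|u - v|))//.
  by rewrite ler_wpM2r// lerDl.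
by rewrite mulrC -ler_pdivlMr.
Unshelve. all: by end_near. Qed.

Lemma continuous_push (psi : T -> R) (h : R) : continuous psi ->
  continuous (fun u : T => psi (u + h *: b u)).
Proof.
move=> cpsi u; apply: (@cvg_comp _ _ _ (fun u : T => u + h *: b u) psi); last exact: cpsi.
apply: cvgD; first exact: cvg_id.
by apply: cvgZ; [exact: cvg_cst|exact: continuous_field].
Qed.

Let cp : continuous p := loc_lip_continuous p_lip.
Let cF1 : continuous flux1 := loc_lip_continuous loc_lip_flux1.
Let cF2 : continuous flux2 := loc_lip_continuous loc_lip_flux2.

Lemma flux_by_parts (psi : T -> R) (h : R) : test psi ->
  J (fun u => psi u * div_quotient h u) =
  J (fun u => h^-1 * (flux1 u * (psi (u - h *: e1) - psi u) +
                      flux2 u * (psi (u - h *: e2) - psi u))).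
Proof. exact: div_quot_by_parts. Qed.

Lemma advection_supported (psi : T -> R) (N h : R) : 0 < h -> h * (2 * (L + C)) <= 1 -> 0 <= N ->
  supported N psi -> supported (2 * N + 2) (fun u : T => psi (u + h *: b u)).
Proof.
move=> h0 hC N0 spsi u uN; apply: spsi; apply: far_field => //.
  by rewrite subrr normr0.
exact: ltW.
Qed.

Lemma incr_far (psi : T -> R) (N h : R) (w u : T) : 0 < h -> h <= 1 -> h * (2 * (L + C)) <= 1 -> 0 <= N ->
  supported N psi -> `|w - b u| <= L -> 2 * N + 2 < `|u| -> incr psi h w u = 0.
Proof.
move=> h0 h1 hC N0 spsi wb uN; rewrite /incr.
have He (e : T) : `|e| = 1 -> psi (u - h *: e) = 0.
  move=> ne; apply: spsi.
  have := ler_normD (u - h *: e) (h *: e).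
  rewrite subrK normrZ ne gtr0_norm// mulr1; lra.
rewrite (spsi (u + _)); last by apply: far_field => //; exact: ltW.
rewrite !He ?norm_e1 ?norm_e2// (spsi u); last lra.
by rewrite subr0 !mulr0 !addr0.
Qed.

(** [incr] is defined so that, after summation by parts, the two integrands add up to exactly
    [p * incr / h]. *)
Lemma advection_add_flux (psi : T -> R) (h N : R) : test psi -> supported N psi -> 0 <= N ->
  0 < h -> h * (2 * (L + C)) <= 1 ->
  advection psi h + J (fun u => psi u * div_quotient h u) =
  J (fun u => h^-1 * (p u * incr psi h (b u) u)).
Proof.
move=> tpsi spsi N0 h0 hC; rewrite flux_by_parts// /advection.
have cpsi := test_continuous tpsi.
have cc (r : R) : continuous (cst r : T -> R) by move=> u; exact: cvg_cst.
rewrite -JD.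
- by congr J; apply/funext => u; rewrite /incr /flux1 /flux2; ring.
- apply: (@continuous_Jable _ _ (2 * N + 2)).
    apply: (continuousM_plane (cc _)); apply: continuousM_plane => //.
    by apply: continuousB_plane => //; exact: continuous_push.
  apply: supportedMr; apply: supportedMl => u uN.
  by rewrite (@advection_supported psi N)// spsi ?subrr//; lra.
- apply: (@continuous_Jable _ _ (N + `|h|)).
    apply: (continuousM_plane (cc _)); apply: continuousD_plane;
      apply: continuousM_plane => //; apply: continuousB_plane => //;
      exact: continuous_shift.
  apply: supportedMr => u uN.
  have He (e : T) : `|e| = 1 -> psi (u - h *: e) = 0.
    move=> ne; apply: spsi.
    have := ler_normD (u - h *: e) (h *: e).
    by rewrite subrK normrZ ne mulr1; lra.
  rewrite !He ?norm_e1 ?norm_e2// (spsi u); last by have := normr_ge0 h; lra.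
  by rewrite subrr !mulr0 addr0.
Qed.

Lemma advection_flux_cvg (psi : T -> R) : test psi ->
  (advection psi h + J (fun u => psi u * div_quotient h u)) @[h --> 0^'+] --> 0.
Proof.
move=> tpsi; apply/cvg_at_right0P => eps e0.
have cpsi := test_continuous tpsi.
have [K [N [K0 N0 psiK spsi]]] := test_supp tpsi.
pose N2 := 2 * N + 2.
have N20 : 0 <= N2 by rewrite /N2; lra.
have [M M0 pM] := loc_lip_bounded N2 p_lip.
pose k := M * (3 * K * L) * (2 * N2) ^+ 2.
have k0 : 0 <= k by rewrite !mulr_ge0// exprn_ge0// mulr_ge0.
have k1 : 0 < k + 1 by rewrite ltr_wpDl.
pose delta := Num.min 1 (eps / 2 / (k + 1)).
have d0 : 0 < delta by rewrite lt_min ltr01/= !divr_gt0.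
have [I [chi [c [chil chif chi0 chid chi1]]]] := partition_of_unity N2 d0.
pose fr i h := J (fun u => h^-1 * ((chi i u * p u) * incr psi h (b (c i)) u)).
have schi i : supported (`|c i| + delta) (chi i).
  move=> u uc; apply/eqP; apply/negPn/negP => /chid.
  by have := ler_normD (u - c i) (c i); rewrite subrK; lra.
have frc i : fr i h @[h --> 0^'+] --> 0.
  apply: (@frozen_cvg _ psi (fun u => chi i u * p u) (`|c i| + delta)) => //.
  - exact: loc_lipM.
  - exact: supportedMl.
  - by move=> u; exact: frechetM.
have frcvg : \sum_i fr i h @[h --> 0^'+] --> 0.
  elim: (index_enum I) => [|i s IH].
    by under eq_fun do rewrite big_nil; exact: cvg_cst.
  under eq_fun do rewrite big_cons.
  by have := cvgD (frc i) IH; rewrite addr0; apply.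
have [d1 d10 Hd1] := (cvg_at_right0P _).1 frcvg _ (divr_gt0 e0 (ltr0Sn R 1)).
have C0 : 0 <= L + C by rewrite /C !addr_ge0.
(* [h < D^-1] is the smallness that [far_field] asks for. *)
pose D := 2 * (L + C) + 1.
have D0 : 0 < D by rewrite /D ltr_wpDl// mulr_ge0.
exists (Num.min (Num.min d1 1) D^-1) => [|h].
  by rewrite !lt_min d10 ltr01 invr_gt0.
rewrite !lt_min => /andP[h0 /andP[/andP[hd1 h1] hD]].
have hC : h * (2 * (L + C)) <= 1.
  rewrite (@le_trans _ _ (h * D))//; first by rewrite ler_wpM2l ?(ltW h0)// /D lerDl.
  by rewrite -ler_pdivlMr// mul1r ltW.
rewrite (advection_add_flux tpsi spsi)//.
have cc (r : R) : continuous (cst r : T -> R) by move=> u; exact: cvg_cst.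
pose f u := h^-1 * (p u * incr psi h (b u) u).
pose fi i u := h^-1 * ((chi i u * p u) * incr psi h (b (c i)) u).
have jf : Jable f.
  apply: (@continuous_Jable _ _ N2).
    apply: (continuousM_plane (cc _)).
    rewrite (_ : (fun u => _) = (fun u => (psi (u + h *: b u) - psi u) * p u +
      flux1 u * (psi (u - h *: e1) - psi u) + flux2 u * (psi (u - h *: e2) - psi u))); last first.
      by apply/funext => u; rewrite /incr /flux1 /flux2; ring.
    apply: continuousD_plane; first apply: continuousD_plane;
      apply: continuousM_plane => //; apply: continuousB_plane => //;
      by [exact: continuous_shift|exact: continuous_push].
  apply: supportedMr; apply: supportedMr => u uN.
  by rewrite (@incr_far psi N)// ?subrr ?normr0// ltW.
have cfi i : continuous (fi i).
  apply: (continuousM_plane (cc _)); apply: continuousM_plane; last exact: continuous_incr.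
  by apply: continuousM_plane => //; exact: loc_lip_continuous.
have jfi i : Jable (fi i).
  apply: (@continuous_Jable _ _ (`|c i| + delta)) => //.
  by apply: supportedMr; do 2 apply: supportedMl.
have [jS JS] := J_sum jfi.
have -> : J f = \sum_i fr i h + J (fun u => f u - \sum_i fi i u).
  by rewrite JB// JS addrC subrK.
rewrite (le_trans (ler_normD _ _))// [eps]splitr lerD ?Hd1 ?h0//.
(* The cells sum to 1 only for [|u| <= N2]; beyond that radius all increments vanish, frozen or
   not. *)
have Mrem : dominated (fun u => f u - \sum_i fi i u) N2 (M * (3 * K * L * delta)).
  apply: supported_dominated => u uN.
    rewrite /f (@incr_far psi N)// ?subrr ?normr0// ?(ltW h1)//.
    rewrite !mulr0 sub0r big1 ?oppr0// => i _; rewrite /fi.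
    have [->|ci] := eqVneq (chi i u) 0; first by rewrite !mul0r mulr0.
    rewrite (@incr_far psi N) ?mulr0 ?(ltW h1)//.
    rewrite (le_trans (b_lip _ _))// distrC -[leRHS]mulr1 ler_wpM2l//.
    by rewrite (le_trans (chid _ _ ci))// ge_min lexx.
  have -> : f u - \sum_i fi i u =
      \sum_i chi i u * (p u * (h^-1 * (incr psi h (b u) u - incr psi h (b (c i)) u))).
    rewrite -[f u]mul1r -(chi1 u uN) mulr_suml -sumrB; apply: eq_bigr => i _.
    by rewrite /f /fi; ring.
  rewrite (le_trans (ler_norm_sum _ _ _))//.
  have -> : M * (3 * K * L * delta) = \sum_i chi i u * (M * (3 * K * L * delta)).
    by rewrite -mulr_suml chi1// mul1r.
  rewrite ler_sum// => i _.
  rewrite normrM (ger0_norm (chi0 i u)).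
  have [->|ci] := eqVneq (chi i u) 0; first by rewrite !mul0r.
  rewrite ler_wpM2l// normrM ler_pM ?pM// normrM gtr0_norm ?invr_gt0//.
  rewrite ler_pdivrMl// (le_trans (incr_lip _ _ _ psiK K0 (ltW h0)))//.
  have -> : h * (3 * K * L * delta) = 3 * K * h * (L * delta) by ring.
  rewrite ler_wpM2l// ?mulr_ge0// ?(ltW h0)//.
  by rewrite (le_trans (b_lip _ _))// ler_wpM2l// chid.
have jrem : measurable_fun setT (fun u => f u - \sum_i fi i u).
  apply: measurable_funB.
    by move/integrableP : jf => [/measurable_EFinP].
  by move/integrableP : jS => [/measurable_EFinP].
rewrite (le_trans (J_dominated N20 jrem Mrem))//.
have -> : M * (3 * K * L * delta) * (2 * N2) ^+ 2 = k * delta by rewrite /k; ring.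
rewrite (@le_trans _ _ ((k + 1) * delta))//.
  by rewrite ler_wpM2r ?(ltW d0)// lerDl.
by rewrite mulrC -ler_pdivlMr// ge_min lexx orbT.
Qed.

End AdvectionDivergence.

Lemma measurableM_plane {R : realType} (f g : R * R -> R) :
  measurable_fun setT f -> measurable_fun setT g ->
  measurable_fun setT (fun u => f u * g u).
Proof. by move=> mf mg; exact: measurable_funM. Qed.

(** * Weak and almost everywhere vanishing of the divergence *)

Section WeakDivergence.
Context {R : realType}.
Local Notation T := (R * R)%type.
Local Notation leb2 := (@lebesgue2 R).
Variable G : T -> T.
Let G1 u := (G u).1.
Let G2 u := (G u).2.
Hypotheses (G1_lip : loc_lip G1) (G2_lip : loc_lip G2).

Let dq := div_quot G1 G2.

Let cG1 : continuous G1 := loc_lip_continuous G1_lip.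
Let cG2 : continuous G2 := loc_lip_continuous G2_lip.

Lemma divergence_exists_ae : {ae leb2, forall u, divergence_exists G u}.
Proof.
exact: (ae2I (loc_lip_derivable_e1_ae G1_lip) (loc_lip_derivable_e2_ae G2_lip)).
Qed.

Lemma div_quot_cvg u : divergence_exists G u ->
  dq h u @[h --> 0^'+] --> divergence G u.
Proof.
case=> d1 d2.
have -> : dq ^~ u = (fun h : R => h^-1 *: ((G1 \o shift u) (h *: e1) - G1 u) +
    h^-1 *: ((G2 \o shift u) (h *: e2) - G2 u)).
  apply/funext => h; rewrite /dq /div_quot /= mulrDr.
  by rewrite [u + _]addrC [u + h *: e2]addrC.
by apply: cvgD; [exact: (cvg_dnbhs_at_right d1)|exact: (cvg_dnbhs_at_right d2)].
Qed.

Lemma div_quot_bounded N : exists2 M : R, 0 <= M &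
  forall h u, 0 < h <= 1 -> `|u| <= N -> `|dq h u| <= M.
Proof.
have [K1 K10 H1] := G1_lip (N + 1); have [K2 K20 H2] := G2_lip (N + 1).
exists (K1 + K2) => [|h u /andP[h0 h1] uN]; first by rewrite addr_ge0.
have He (e : T) : `|e| = 1 -> `|u + h *: e| <= N + 1.
  move=> ne; rewrite (le_trans (ler_normD _ _))// normrZ ne mulr1 gtr0_norm//.
  by rewrite lerD.
rewrite /dq /div_quot normrM gtr0_norm ?invr_gt0// ler_pdivrMl//.
have uN1 : `|u| <= N + 1 by rewrite (le_trans uN)// lerDl.
rewrite (le_trans (ler_normD _ _))// mulrDr lerD//.
  rewrite (le_trans (H1 _ _ (He _ norm_e1) uN1))//.
  by rewrite addrC addKr normrZ norm_e1 mulr1 gtr0_norm// mulrC.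
rewrite (le_trans (H2 _ _ (He _ norm_e2) uN1))//.
by rewrite addrC addKr normrZ norm_e2 mulr1 gtr0_norm// mulrC.
Qed.

Lemma loc_lip_div_quot h : loc_lip (dq h).
Proof.
have lN (f : T -> R) : loc_lip f -> loc_lip (fun u => - f u).
  move=> lf; rewrite (_ : (fun u => _) = (fun u => (-1) * f u)).
    exact: loc_lipZ.
  by apply/funext => u; rewrite mulN1r.
apply: loc_lipZ; apply: loc_lipD; apply: loc_lipD; try exact: lN; exact: loc_lip_shift.
Qed.

(** The distributional equation in discrete form. The quotient stays on [G], and [psi] is allowed to
    be merely Lipschitz, so [psi] may itself contain a difference quotient of [G]. *)
Definition weak_div_free := forall psi, test psi ->
  J (fun u => psi u * dq h u) @[h --> 0^'+] --> 0.

Lemma ae_div0_weak : {ae leb2, forall u, divergence G u = 0} -> weak_div_free.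
Proof.
move=> div0 psi tpsi; have [K [N [K0 N0 psiK spsi]]] := test_supp tpsi.
have cpsi := test_continuous tpsi.
have [M M0 psiM] := continuous_bounded_box N cpsi.
have [M' M'0 HM'] := div_quot_bounded N.
apply: (@J_cvg_at_right0 _ _ N (M * M') 1) => //.
- move=> h _; apply: continuous_measurable_plane; apply: continuousM_plane => //.
  exact: loc_lip_continuous (loc_lip_div_quot h).
- move=> h /andP[h0 h1]; apply: supported_dominated; first exact: supportedMl.
  by move=> u uN; rewrite normrM ler_pM ?psiM// HM'// h0 ltW.
- apply: ae2S (ae2I div0 divergence_exists_ae) => u [d0 du].
  have := div_quot_cvg du; rewrite d0 => H.
  by have := cvgM (@cvg_cst _ (psi u) _ _ _) H; rewrite mulr0; apply.
Qed.

Definition tent (r : R) (c u : T) : R := Num.max 0 (r - `|u - c|).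

Lemma lip_tent r c : lip 1 (tent r c).
Proof.
move=> u v; rewrite mul1r.
have h1 : `|u - c| <= `|u - v| + `|v - c|.
  by have := ler_normD (u - v) (v - c); rewrite addrA subrK.
have h2 : `|v - c| <= `|u - v| + `|u - c|.
  by have := ler_normD (v - u) (u - c); rewrite addrA subrK (distrC v u).
have h3 := normr_ge0 (u - v).
rewrite /tent ler_norml !maxEle.
by case: (leP 0 (r - `|u - c|)) => ?; case: (leP 0 (r - `|v - c|)) => ?;
  apply/andP; split; lra.
Qed.

Lemma test_tent r c : test (tent r c).
Proof.
split; first by exists 1; exact: lip_tent.
exists (r + `|c|) => u uN; rewrite /tent max_l//.
have := ler_normD (u - c) c; rewrite subrK; lra.
Qed.

(** The test function is a cutoff [chi] times the quotient [dq (k n)]. Sending the step of the other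
    quotient to 0, then [n] to infinity, gives that the integral of [chi] times the squared
    divergence is 0. *)
Lemma weak_div0_ae : weak_div_free -> {ae leb2, forall u, divergence G u = 0}.
Proof.
move=> W.
pose E := [set u : T | derivable G1 u e1 /\ derivable G2 u e2].
have mE : measurable E.
  have -> : E = ~` [set u | ~ derivable G1 u e1] `&` ~` [set u | ~ derivable G2 u e2].
    apply/seteqP; split=> [u [d1 d2]|u [/contrapT d1 /contrapT d2]].
      by split; [move=> n; exact: (n d1)|move=> n; exact: (n d2)].
    exact: (conj d1 d2).
  by apply: measurableI; apply: measurableC; exact: measurable_not_derivable.
pose k (n : nat) : R := n.+1%:R^-1.
have k0 n : 0 < k n by rewrite invr_gt0.
have k1 n : 0 < k n <= 1 by rewrite k0/= invf_le1// ler1n.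
have kcvg : k n @[n --> \oo] --> 0.
  apply/cvgr0Pnorm_lt => e e0; near=> n; rewrite gtr0_norm//.
  by near: n; exact: (@near_infty_natSinv_lt R (PosNum e0)).
(* Off [E] the total operator [divergence] has no meaning; the indicator makes [D0] an everywhere
   pointwise limit of measurable functions. *)
pose D0 u : R := divergence G u * \1_E u.
have dqE u : E u -> dq (k n) u @[n --> \oo] --> divergence G u.
  move=> Eu; have /cvg_at_rightP := @div_quot_cvg u Eu; apply.
  by split.
have mdq n : measurable_fun setT (dq (k n)).
  exact: continuous_measurable_plane (loc_lip_continuous (loc_lip_div_quot _)).
have mD0 : measurable_fun setT D0.
  apply: (@measurable_fun_cvg _ _ _ setT (fun n u => dq (k n) u * \1_E u)).
    by move=> n; apply: measurable_funM => //; exact: measurable_indic.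
  move=> u _; rewrite /D0 indicE; have [/set_mem Eu|_] := boolP (u \in E).
    by apply: cvgM; [exact: dqE|exact: cvg_cst].
  by rewrite mulr0; under eq_fun do rewrite mulr0; exact: cvg_cst.
have aeE : {ae leb2, forall u, E u} := divergence_exists_ae.
have aeD0 : {ae leb2, forall u, dq (k n) u @[n --> \oo] --> D0 u}.
  apply: ae2S aeE => u Eu; rewrite /D0 indicE mem_set// mulr1; exact: dqE.
(* It suffices to work on open balls of integer radius, where the cutoff [chi] is positive. *)
suff H N : {ae leb2, forall u, `|u| < N%:R -> D0 u = 0}.
  have : {ae leb2, forall u, forall N : nat, `|u| < N%:R -> D0 u = 0}.
    apply: negligibleS (negligible_bigcup H) => u /= /existsNP[N nN].
    by exists N.
  move=> /(ae2I aeE); apply: ae2S => u [Eu].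
  move=> /(_ (Num.bound `|u|)); rewrite archi_boundP// => /(_ erefl).
  by rewrite /D0 indicE mem_set// mulr1.
pose chi := tent N%:R 0 : T -> R.
have tchi : test chi := test_tent N%:R 0.
have schi : supported N%:R chi.
  by move=> u uN; rewrite /chi /tent subr0 max_l//; lra.
have chi0 u : 0 <= chi u by rewrite /chi /tent le_max lexx.
have chiN u : chi u <= N%:R by rewrite /chi /tent subr0 ge_max ler0n/= gerBl.
have [M M0 HM] := div_quot_bounded N%:R.
have mchi : measurable_fun setT chi.
  exact: continuous_measurable_plane (test_continuous tchi).
have D0M u : `|u| <= N%:R -> `|D0 u| <= M.
  move=> uN; rewrite /D0 indicE; have [/set_mem Eu|_] := boolP (u \in E); last first.
    by rewrite mulr0 normr0.
  rewrite mulr1; apply: (cvgr_to_le (cvg_norm (dqE u Eu))).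
  by apply: nearW => n; apply: HM.
have J0 n : J (fun u => chi u * dq (k n) u * D0 u) = 0.
  (* For a fixed step the quotient is locally Lipschitz, so its cutoff is admissible. *)
  have tn : test (fun u => chi u * dq (k n) u).
    apply/testE; split; last by exists N%:R; exact: supportedMl.
    apply: loc_lipM; [exact: test_loc_lip|exact: loc_lip_div_quot].
  have c1 : J (fun u => chi u * dq (k n) u * dq (k m) u) @[m --> \oo] --> 0.
    by have /cvg_at_rightP := W _ tn; apply; split.
  suff c2 : J (fun u => chi u * dq (k n) u * dq (k m) u) @[m --> \oo] -->
      J (fun u => chi u * dq (k n) u * D0 u).
    exact: (cvg_unique (@Rhausdorff R) c2 c1).
  apply: (@J_cvgn _ _ _ N%:R (N%:R * M * M)).
  - by move=> m; do 2 apply: measurableM_plane => //.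
  - move=> m; apply: supported_dominated; first by do 2 apply: supportedMl.
    move=> u uN; rewrite 2!normrM !ler_pM// ?mulr_ge0// ?HM//.
    by rewrite ger0_norm.
  - by do 2 apply: measurableM_plane => //.
  - apply: ae2S aeD0 => u cu; apply: cvgM => //; exact: cvg_cst.
have J00 : J (fun u => chi u * D0 u * D0 u) = 0.
  have c0 : J (fun u => chi u * dq (k n) u * D0 u) @[n --> \oo] --> 0.
    by under eq_fun do rewrite J0; exact: cvg_cst.
  suff c2 : J (fun u => chi u * dq (k n) u * D0 u) @[n --> \oo] -->
      J (fun u => chi u * D0 u * D0 u).
    exact: (cvg_unique (@Rhausdorff R) c2 c0).
  apply: (@J_cvgn _ _ _ N%:R (N%:R * M * M)).
  - by move=> n; do 2 apply: measurableM_plane => //.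
  - move=> n; apply: supported_dominated; first by do 2 apply: supportedMl.
    move=> u uN; rewrite 2!normrM !ler_pM// ?mulr_ge0// ?HM// ?D0M//.
    by rewrite ger0_norm.
  - by do 2 apply: measurableM_plane => //.
  - apply: ae2S aeD0 => u cu; apply: cvgM; last exact: cvg_cst.
    by apply: cvgM => //; exact: cvg_cst.
pose f u := chi u * D0 u * D0 u.
have f0 u : 0 <= f u by rewrite /f -mulrA mulr_ge0// -expr2 sqr_ge0.
have mf : measurable_fun setT f.
  by do 2 apply: measurableM_plane => //.
have jf : Jable f.
  apply: (@dominated_Jable _ _ N%:R (N%:R * M * M)) => //.
  apply: supported_dominated; first by do 2 apply: supportedMl.
  move=> u uN; rewrite 2!normrM !ler_pM// ?mulr_ge0// ?D0M//.
  by rewrite ger0_norm.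
have : (\int[leb2]_u `|(EFin \o f) u| = 0)%E.
  have -> : (\int[leb2]_u `|(EFin \o f) u| = \int[leb2]_u (EFin \o f) u)%E.
    by apply: eq_integral => u _; rewrite /= ger0_norm.
  rewrite -(@fineK _ (\int[leb2]_u (EFin \o f) u)); last exact: integrable_fin_num.
  by congr EFin.
have mfE : measurable_fun setT (EFin \o f) by apply/measurable_EFinP.
move/(ae_eq_integral_abs leb2 measurableT mfE).
apply: ae2S => u /= /(_ I) [fu] uN; move/eqP : fu.
rewrite /f (mulf_eq0 (chi u * D0 u)) (mulf_eq0 (chi u)) => /orP[/orP[|/eqP//]|/eqP//].
by rewrite /chi /tent subr0 max_r; [rewrite gt_eqF// subr_gt0|rewrite subr_ge0 ltW].
Unshelve. all: by end_near. Qed.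

End WeakDivergence.

(** * The divergence at a point of differentiability *)

Section DifferentiablePoint.
Context {R : realType}.
Local Notation T := (R * R)%type.

Definition frechet_with (f : T -> R) (u : T) (d1 d2 : R) :=
  forall eps, 0 < eps -> exists2 delta, 0 < delta & forall w : T, `|w| <= delta ->
    `|f (u + w) - f u - (d1 * w.1 + d2 * w.2)| <= eps * `|w|.

Lemma frechet_with_derive (f : T -> R) u d1 d2 : frechet_with f u d1 d2 ->
  'D_e1 f u = d1 /\ 'D_e2 f u = d2.
Proof.
move=> H.
have aux (e : T) d : `|e| = 1 -> d1 * e.1 + d2 * e.2 = d -> 'D_e f u = d.
  move=> ne de; apply: cvg_lim; first exact: Rhausdorff.
  apply/cvgrPdist_le => eps e0; have [r r0 Hr] := H _ e0.
  exists r => // h /= hr h0; rewrite sub0r normrN in hr.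
  have hw : `|h *: e| <= r by rewrite normrZ ne mulr1 ltW.
  have := Hr _ hw; rewrite normrZ ne mulr1 /=.
  rewrite [u + _]addrC.
  have -> : d1 * (h *: e.1) + d2 * (h *: e.2) = h * d.
    by rewrite -de -[h *: e.1]/(h * e.1) -[h *: e.2]/(h * e.2); ring.
  move=> le; rewrite -(ler_pM2l (_ : 0 < `|h|)) ?normr_gt0// -normrM.
  rewrite mulrBr -[h^-1 *: _]/(h^-1 * _) mulrA divff// mul1r distrC mulrC.
  by rewrite mulrC [`|h| * _]mulrC.
split; apply: aux; rewrite ?norm_e1 ?norm_e2//=; ring.
Qed.

Lemma differentiable_frechet (G : T -> T) u : differentiable G u ->
  (exists d1 d2, frechet_with (fun v => (G v).1) u d1 d2) /\
  (exists d1 d2, frechet_with (fun v => (G v).2) u d1 d2).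
Proof.
move=> dG; pose A := 'd G u.
have AE (w : T) : A w = w.1 *: A e1 + w.2 *: A e2.
  rewrite -!linearZ -linearD; congr (A _).
  case: w => w1 w2; rewrite /e1 /e2; congr pair; rewrite /= !scaler0 ?addr0 ?add0r.
    by rewrite -[w1 *: 1]/(w1 * 1) mulr1.
  by rewrite -[w2 *: 1]/(w2 * 1) mulr1.
have H eps : 0 < eps -> exists2 delta, 0 < delta & forall w : T, `|w| <= delta ->
    `|G (u + w) - G u - A w| <= eps * `|w|.
  move=> e0; have := diff_locally dG.
  move=> /eqaddoP /(_ _ e0) /nbhs_ballP [r /= r0 Hr].
  exists (r / 2) => [|w wr]; first by rewrite divr_gt0.
  have -> : G (u + w) - G u - A w = (G \o shift u - (cst (G u) + 'd G u)) w.
    by rewrite [u + w]addrC -addrA -opprD.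
  apply: (Hr w).
  have {}wr : `|w| < r by rewrite (le_lt_trans wr)// ltr_pdivrMr// ltr_pMr// ltr1n.
  split; rewrite /ball/= sub0r normrN.
    exact: le_lt_trans (@norm_fst_le _ w) wr.
  exact: le_lt_trans (@norm_snd_le _ w) wr.
split.
- exists (A e1).1, (A e2).1 => eps /H [d d0 Hd]; exists d => // w /Hd.
  apply: le_trans; apply: le_trans (@norm_fst_le _ _).
  have -> : (G (u + w) - G u - A w).1 =
      (G (u + w)).1 - (G u).1 - (w.1 * (A e1).1 + w.2 * (A e2).1) by rewrite AE.
  by rewrite ![_ * w.1]mulrC ![_ * w.2]mulrC.
- exists (A e1).2, (A e2).2 => eps /H [d d0 Hd]; exists d => // w /Hd.
  apply: le_trans; apply: le_trans (@norm_snd_le _ _).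
  have -> : (G (u + w) - G u - A w).2 =
      (G (u + w)).2 - (G u).2 - (w.1 * (A e1).2 + w.2 * (A e2).2) by rewrite AE.
  by rewrite ![_ * w.1]mulrC ![_ * w.2]mulrC.
Qed.

(** The tent is at least [r / 2] on the concentric square of side [r]. *)
Lemma J_tent_ge (r : R) (c : T) : 0 < r -> r ^+ 3 / 2 <= J (tent r c).
Proof.
move=> r0; have tt := @test_tent R r c.
have jt : Jable (tent r c).
  have [K [N [_ _ _ sN]]] := test_supp tt.
  exact: continuous_Jable (test_continuous tt) sN.
rewrite -(JT c jt).
have -> : r ^+ 3 / 2 = r / 2 * (2 * (r / 2)) ^+ 2 by field.
rewrite -J_box; last by rewrite divr_ge0 ?ltW.
apply: le_J; [exact: integrable_box|exact: JableT|].
move=> u; rewrite /tent addrK le_max.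
have [ur|ur] := leP `|u| (r / 2); last by rewrite mulr0 lexx.
by rewrite mulr1; apply/orP; right; lra.
Qed.

(** Near [u0] the field is affine up to a remainder of size [eta * |u - u0|]. Against a tent of
    radius [r] the affine part gives [c] times a mass of order [r^3], while the remainder gives
    [O(eta * r^3)]; hence [c = 0]. *)
Lemma weak_div0_differentiable (G : T -> T) u0 :
  loc_lip (fun u => (G u).1) -> loc_lip (fun u => (G u).2) ->
  weak_div_free G -> differentiable G u0 -> divergence G u0 = 0.
Proof.
move=> lG1 lG2 W /differentiable_frechet[[a1 [a2 Ha]] [b1 [b2 Hb]]].
rewrite /divergence (frechet_with_derive Ha).1 (frechet_with_derive Hb).2.
set c := a1 + b2.
apply/eqP; rewrite -normr_le0; apply/ler_addgt0Pr => eps e0; rewrite add0r.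
(* 129 comes from the final estimate [|c| * r^3 / 2 <= eta * r^3 / 2 + 64 * eta * r^3]. *)
pose eta := eps / 129.
have eta0 : 0 < eta by rewrite divr_gt0.
have [da da0 {}Ha] := Ha _ eta0; have [db db0 {}Hb] := Hb _ eta0.
(* Half, because tents shifted by [h <= r] reach out to distance [2 * r], where the expansions must
   still hold. *)
pose r := Num.min da db / 2.
have r0 : 0 < r by rewrite divr_gt0// lt_min da0.
pose psi := tent r u0.
have tpsi : test psi := test_tent r u0.
pose g1 u := (G u).1 - (G u0).1 - (a1 * (u - u0).1 + a2 * (u - u0).2).
pose g2 u := (G u).2 - (G u0).2 - (b1 * (u - u0).1 + b2 * (u - u0).2).
have r2 : 2 * r = Num.min da db by rewrite /r mulrC divfK.
have g1P u : `|u - u0| <= 2 * r -> `|g1 u| <= eta * (2 * r).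
  move=> ur; have := Ha (u - u0); rewrite [u0 + _]addrC subrK => H.
  rewrite (le_trans (H _))//; last by rewrite ler_wpM2l// ltW.
  by rewrite (le_trans ur)// r2 ge_min lexx.
have g2P u : `|u - u0| <= 2 * r -> `|g2 u| <= eta * (2 * r).
  move=> ur; have := Hb (u - u0); rewrite [u0 + _]addrC subrK => H.
  rewrite (le_trans (H _))//; last by rewrite ler_wpM2l// ltW.
  by rewrite (le_trans ur)// r2 ge_min lexx orbT.
have ccst (k : R) : continuous (cst k : T -> R) by move=> u; exact: cvg_cst.
have cc (k1 k2 : R) : continuous (fun u : T => k1 * (u - u0).1 + k2 * (u - u0).2).
  apply: continuousD_plane; apply: (continuousM_plane (ccst _)).
    exact: (continuous_shift (z := - u0) (@continuous_fst R)).
  exact: (continuous_shift (z := - u0) (@continuous_snd R)).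
have cg1 : continuous g1.
  apply: continuousB_plane (cc a1 a2); apply: continuousB_plane (ccst _).
  exact: loc_lip_continuous.
have cg2 : continuous g2.
  apply: continuousB_plane (cc b1 b2); apply: continuousB_plane (ccst _).
  exact: loc_lip_continuous.
have er0 : 0 < eta * r ^+ 3 / 2 by rewrite divr_gt0// mulr_gt0// exprn_gt0.
have [d d0 Hd] := (cvg_at_right0P _).1 (W _ tpsi) _ er0.
pose h := Num.min (d / 2) r.
have h0 : 0 < h by rewrite lt_min r0 andbT divr_gt0.
have hr : h <= r by rewrite ge_min lexx orbT.
have {Hd} Hd := Hd h.
have spsi u : r < `|u - u0| -> psi u = 0.
  by move=> ur; rewrite /psi /tent max_l//; lra.
have jpsi (f : T -> R) : continuous f -> Jable (fun u => psi u * f u).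
  move=> cf; have [_ [N [_ _ _ sN]]] := test_supp tpsi.
  apply: (@continuous_Jable _ _ N).
    by apply: continuousM_plane => //; exact: test_continuous.
  exact: supportedMl.
have cdq (F1 F2 : T -> R) : continuous F1 -> continuous F2 -> continuous (div_quot F1 F2 h).
  move=> cF1 cF2; apply: (continuousM_plane (ccst _)); apply: continuousD_plane;
  by apply: continuousB_plane => //; exact: continuous_shift.
(* The difference quotient of the affine part is exactly [c], whatever [h] is. *)
have splitE : J (fun u => psi u * div_quot (fun u => (G u).1) (fun u => (G u).2) h u) =
    c * J psi + J (fun u => psi u * div_quot g1 g2 h u).
  have jp : Jable psi.
    have := jpsi _ (ccst 1).
    by under eq_fun do rewrite mulr1.
  have jdq : Jable (fun u => psi u * div_quot g1 g2 h u) := (jpsi _ (cdq _ _ cg1 cg2)).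
  rewrite -(JZ c jp) -(JD (JableZ c jp) jdq).
  congr J; apply/funext => u; rewrite /div_quot /g1 /g2 /c /=.
  rewrite -[h *: 1]/(h * 1) -[h *: 0]/(h * 0).
  by field; rewrite gt_eqF.
have He (e : T) u : `|e| = 1 -> `|psi (u - h *: e) - psi u| <= h /\
    (2 * r < `|u - u0| -> psi (u - h *: e) - psi u = 0).
  move=> ne; split.
    have := @lip_tent R r u0 (u - h *: e) u.
    by rewrite mul1r addrAC subrr add0r normrN normrZ ne mulr1 gtr0_norm.
  move=> ur; rewrite !spsi ?subrr//; first lra.
  have := ler_normD (u - h *: e - u0) (h *: e).
  by rewrite addrAC subrK normrZ ne mulr1 gtr0_norm//; lra.
pose f u := h^-1 * (g1 u * (psi (u - h *: e1) - psi u) +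
                    g2 u * (psi (u - h *: e2) - psi u)).
have cpsi := test_continuous tpsi.
have cf : continuous f.
  apply: (continuousM_plane (ccst _)); apply: continuousD_plane;
    apply: continuousM_plane => //; apply: continuousB_plane => //;
    exact: continuous_shift.
have fz u : 2 * r < `|u - u0| -> f u = 0.
  move=> ur; rewrite /f (He e1 u (@norm_e1 R)).2// (He e2 u (@norm_e2 R)).2//.
  by rewrite !mulr0 addr0 mulr0.
have fdom : dominated (fun u => f (u + u0)) (2 * r) (2 * (eta * (2 * r))).
  apply: supported_dominated => u ur; first by apply: fz; rewrite addrK.
  have ur' : `|u + u0 - u0| <= 2 * r by rewrite addrK.
  rewrite /f normrM gtr0_norm ?invr_gt0// ler_pdivrMl//.
  rewrite (le_trans (ler_normD _ _))// !normrM.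
  have -> : h * (2 * (eta * (2 * r))) = eta * (2 * r) * h + eta * (2 * r) * h by ring.
  rewrite lerD// ler_pM ?g1P ?g2P//.
    exact: (He _ _ (@norm_e1 R)).1.
  exact: (He _ _ (@norm_e2 R)).1.
have jf : Jable f.
  rewrite (_ : f = (fun u => (fun u => f (u + u0)) (u + - u0))).
    apply: (JableT (f := fun u => f (u + u0))).
    apply: dominated_Jable fdom; apply: continuous_measurable_plane.
    exact: continuous_shift.
  by apply/funext => u; rewrite subrK.
(* [64 = 4 * 16]: the integrand is at most [4 * eta * r] on a square of side [4 * r]. *)
have fle : `|J (fun u => psi u * div_quot g1 g2 h u)| <= 64 * eta * r ^+ 3.
  rewrite div_quot_by_parts// -/f -(JT u0 jf).
  rewrite (le_trans (J_dominated _ _ fdom))//.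
  - by rewrite mulr_ge0// ltW.
  - by apply: continuous_measurable_plane; exact: continuous_shift.
  - by rewrite le_eqVlt; apply/orP; left; apply/eqP; ring.
have {}Hd : `|c * J psi + J (fun u => psi u * div_quot g1 g2 h u)| <= eta * r ^+ 3 / 2.
  rewrite -splitE; apply: Hd; rewrite h0/=.
  by rewrite gt_min ltr_pdivrMr// ltr_pMr// ltr1n.
have cJ : `|c| * (r ^+ 3 / 2) <= eta * r ^+ 3 / 2 + 64 * eta * r ^+ 3.
  rewrite (@le_trans _ _ (`|c * J psi|))//.
    rewrite normrM ler_wpM2l// (le_trans (J_tent_ge u0 r0))//; exact: ler_norm.
  have := ler_normB (c * J psi + J (fun u => psi u * div_quot g1 g2 h u))
    (J (fun u => psi u * div_quot g1 g2 h u)).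
  rewrite addrK; lra.
have r3 : 0 < r ^+ 3 / 2 by rewrite divr_gt0// exprn_gt0.
rewrite -(ler_pM2r r3) (le_trans cJ)// le_eqVlt; apply/orP; left; apply/eqP.
by rewrite /eta; field.
Qed.

End DifferentiablePoint.

(** * Surjectivity of perturbations of the identity, Gronwall's lemma, and flow estimates *)

Section NearIdentity.
Context {R : realType}.
Local Notation T := (R * R)%type.

Lemma geometric_increments_cvg (a : nat -> R) (D q : R) : 0 <= q -> q < 1 ->
  (forall n, `|a n.+1 - a n| <= D * q ^+ n) -> cvgn a.
Proof.
move=> q0 q1 aD.
have -> : a = (fun n => a 0%N + series (telescope a) n).
  by apply/funext => n; rewrite -eq_sum_telescope.
apply: is_cvgD; first exact: is_cvg_cst.
apply: normed_cvg; apply: (@series_le_cvg _ _ (geometric D q)).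
- by move=> n; exact: normr_ge0.
- by move=> n; rewrite (le_trans _ (aD n)).
- by move=> n; exact: aD.
- by apply: is_cvg_geometric_series; rewrite ger0_norm.
Qed.

(* Banach's fixed point argument; the library states it for complete normed
   modules, of which [R * R] is not an instance. *)
Lemma near_identity_surjective (g : T -> T) (q : R) : 0 <= q -> q < 1 ->
  (forall u v, `|(g u - u) - (g v - v)| <= q * `|u - v|) ->
  forall z, exists u, g u = z.
Proof.
(* A fixed point of [f] is a solution of [g u = z], and [f] contracts with the constant [q]. *)
move=> q0 q1 gq z; pose f := fun u : T => z - (g u - u).
have fq u v : `|f u - f v| <= q * `|u - v|.
  rewrite -normrN (le_trans _ (gq u v))// /f; set A := g u - u; set B := g v - v.
  by rewrite (opprB (z - A)) (opprB z A) addrC addrA subrK.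
pose y n := iter n f z.
have yq n : `|y n.+1 - y n| <= `|y 1%N - y 0%N| * q ^+ n.
  elim: n => [|n IH]; first by rewrite expr0 mulr1.
  rewrite (le_trans (fq (y n.+1) (y n)))// exprS mulrCA ler_wpM2l//.
have /cvg_ex[l1 c1] : cvgn (fun n => (y n).1).
  apply: (@geometric_increments_cvg _ (`|y 1%N - y 0%N|) q) => // n.
  by rewrite (le_trans _ (yq n))//; exact: (@norm_fst_le _ (y n.+1 - y n)).
have /cvg_ex[l2 c2] : cvgn (fun n => (y n).2).
  apply: (@geometric_increments_cvg _ (`|y 1%N - y 0%N|) q) => // n.
  by rewrite (le_trans _ (yq n))//; exact: (@norm_snd_le _ (y n.+1 - y n)).
pose l : T := (l1, l2).
have yl e : 0 < e -> exists N, forall n, (N <= n)%N -> `|l - y n| <= e.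
  move=> e0; have /cvgrPdist_le /(_ _ e0) [N1 _ H1] := c1.
  have /cvgrPdist_le /(_ _ e0) [N2 _ H2] := c2.
  exists (maxn N1 N2) => n; rewrite geq_max => /andP[n1 n2].
  by rewrite norm_pair_le/= (H1 n n1) (H2 n n2).
have fl : `|f l - l| <= 0.
  apply/ler_addgt0Pr => e e0; rewrite add0r.
  have [N HN] := yl (e / 2) (divr_gt0 e0 (ltr0Sn R 1)).
  have h1 := HN N (leqnn N); have h2 := HN N.+1 (leqnSn N).
  have -> : f l - l = (f l - f (y N)) - (l - y N.+1).
    by rewrite (_ : y N.+1 = f (y N))// (opprB l) addrA subrK.
  rewrite (le_trans (ler_normB _ _))// [e]splitr lerD//.
  rewrite (le_trans (fq _ _))// (le_trans _ h1)//.
  by rewrite -[leRHS]mul1r ler_wpM2r// ltW.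
exists l; move: fl; rewrite normr_le0 subr_eq0 /f => /eqP.
move=> /(congr1 (fun w => w + (g l - l))); rewrite subrK => ->.
by rewrite addrC subrK.
Qed.

End NearIdentity.

Section Gronwall.
Context {R : realType}.

(** Multiplication by [expR (- M * r)] makes [S] nonincreasing, and by [expR (M * r)] nondecreasing.
    The backward bound is what controls the inverse flow. The derivative is asked for inside the
    interval only, since the flow is merely one-sidedly derivable at time 0. *)
Lemma gronwall (S dS : R -> R) (M s t : R) : s <= t ->
  {within `[s, t], continuous S} ->
  (forall r, s < r < t -> is_derive r (1 : R) S (dS r)) ->
  (forall r, s < r < t -> `|dS r| <= M * S r) ->
  S t <= S s * expR (M * (t - s)) /\ S s <= S t * expR (M * (t - s)).
Proof.
rewrite le_eqVlt => /orP[/eqP <- *|st cS dSE dSM].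
  by rewrite subrr mulr0 expR0 mulr1.
have key (k : R) : exists c, s < c < t /\
    S t * expR (k * t) - S s * expR (k * s) = (dS c + k * S c) * expR (k * c) * (t - s).
  pose F r := S r * expR (k * r).
  have dE r : is_derive r (1 : R) (fun r => expR (k * r)) (k * expR (k * r)).
    have h3 : is_derive r (1 : R) (fun r => k * r) k.
      by have := @is_deriveZ _ _ _ id k r 1 1 (is_derive_id r 1); rewrite -[k *: 1]/(k * 1) mulr1.
    have := @is_derive1_comp _ expR (fun r => k * r) r _ _ (is_derive_expR (k * r)) h3.
    by rewrite mulrC.
  have [|//|c] := @MVT R F (fun r => (dS r + k * S r) * expR (k * r)) s t st.
  - move=> r; rewrite in_itv/= => rst.
    apply: (is_derive_eq (is_deriveM (dSE r rst) (dE r))).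
    by rewrite -![_ *: _]/(_ * _); ring.
  - move=> r; apply: cvgM; first exact: cS.
    apply: (@continuous_subspaceT _ _ `[s, t]%classic (fun r => expR (k * r))) => {}r.
    apply: differentiable_continuous; apply/derivable1_diffP.
    exact: (@ex_derive _ _ _ _ _ _ _ (dE r)).
  by rewrite in_itv/= => cst ->; exists c.
have ts : 0 < t - s by rewrite subr_gt0.
split.
- have [c [cst E]] := key (- M).
  have : S t * expR (- M * t) - S s * expR (- M * s) <= 0.
    rewrite E -oppr_ge0 -!mulNr !mulr_ge0 ?expR_ge0 ?(ltW ts)//.
    have := dSM c cst; rewrite ler_norml; lra.
  rewrite subr_le0 => H.
  have -> : M * (t - s) = - M * s + M * t by ring.
  rewrite expRD mulrA -[leLHS]mulr1 -(expR0 R).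
  have -> : 0 = - M * t + M * t by ring.
  by rewrite expRD mulrA ler_wpM2r// expR_ge0.
- have [c [cst E]] := key M.
  have : 0 <= S t * expR (M * t) - S s * expR (M * s).
    rewrite E !mulr_ge0 ?expR_ge0 ?(ltW ts)//.
    have := dSM c cst; rewrite ler_norml; lra.
  rewrite subr_ge0 => H.
  have -> : M * (t - s) = M * t + - M * s by ring.
  rewrite expRD mulrA -[leLHS]mulr1 -(expR0 R).
  have -> : 0 = M * s + - M * s by ring.
  by rewrite expRD mulrA ler_wpM2r// expR_ge0.
Qed.

End Gronwall.

Section Flow.
Context {R : realType}.
Local Notation T := (R * R)%type.
Variables (x : R -> T -> T) (B : R -> T -> T) (L C : R).
Hypotheses (L0 : 0 <= L) (C0 : 0 <= C).
Hypothesis x_init : forall u, x 0 u = u.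
Hypothesis x_derive : forall u (t : R), 0 <= t -> forall eps : R, 0 < eps ->
  exists2 delta : R, 0 < delta & forall h : R, `|h| < delta -> 0 <= t + h ->
    `|x (t + h) u - x t u - h *: B t (x t u)| <= eps * `|h|.
Hypothesis B_lip : forall (t : R) u v, 0 <= t -> `|B t u - B t v| <= L * `|u - v|.
Hypothesis B_growth : forall (t : R) u, 0 <= t -> `|B t u| <= C * (1 + `|u|).

Section Coordinate.
Variable c : T -> R.
Hypotheses (cB : forall u v, c (u - v) = c u - c v)
  (cZ : forall h u, c (h *: u) = h * c u) (c_le : forall u, `|c u| <= `|u|).

(** [c] stands for either projection: the mean value theorem concerns real-valued functions, so the
    equation is read one coordinate at a time. *)
Let coord_derive u (t : R) : 0 < t ->
  is_derive t (1 : R) (fun r => c (x r u)) (c (B t (x t u))).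
Proof.
move=> t0; have t0' := ltW t0.
have H : (h : R)^-1 *: (c (x (h *: 1 + t) u) - c (x t u)) @[h --> 0^'] --> c (B t (x t u)).
  apply/cvgrPdist_le => e e0; have [d d0 Hd] := @x_derive u t t0' e e0.
  have m0 : 0 < Num.min d t by rewrite lt_min d0.
  exists (Num.min d t) => // h /=; rewrite sub0r normrN lt_min => /andP[hd ht] h0.
  have th : 0 <= t + h by move: ht; rewrite ltr_norml => /andP[]; lra.
  have := le_trans (c_le _) (Hd h hd th); rewrite !cB cZ => H.
  rewrite -[h *: 1]/(h * 1) mulr1 [h + t]addrC.
  rewrite -(ler_pM2l (_ : 0 < `|h|)) ?normr_gt0// -normrM mulrBr.
  by rewrite -[h^-1 *: _]/(h^-1 * _) mulrA divff// mul1r distrC [leRHS]mulrC.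
split; last by apply: cvg_lim => //; exact: Rhausdorff.
by apply/cvg_ex; exists (c (B t (x t u))).
Qed.

Let coord_continuous u (s t : R) : 0 <= s ->
  {within `[s, t], continuous (fun r => c (x r u))}.
Proof.
move=> s0; apply/subspace_continuousP => r; rewrite /= in_itv/= => /andP[sr rt].
have r0 : 0 <= r := le_trans s0 sr.
have [d d0 Hd] := @x_derive u r r0 1 ltr01.
pose k := 1 + `|B r (x r u)|.
have k0 : 0 < k by rewrite ltr_pwDl.
apply/cvgrPdist_le => e e0.
have m0 : 0 < Num.min d (e / k) by rewrite lt_min d0 divr_gt0.
exists (Num.min d (e / k)) => // r' /=; rewrite lt_min distrC => /andP[rd re].
rewrite in_itv/= => /andP[sr' _]; rewrite distrC -cB (le_trans (c_le _))//.
have := Hd (r' - r) rd; rewrite addrC subrK => /(_ (le_trans s0 sr')).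
rewrite mul1r => H.
have := ler_normD (x r' u - x r u - (r' - r) *: B r (x r u)) ((r' - r) *: B r (x r u)).
rewrite subrK normrZ => H2.
have H3 : `|r' - r| * k <= e by rewrite -ler_pdivlMr// ltW.
rewrite /k mulrDr mulr1 in H3; lra.
Qed.

Lemma coord_pair_derive u w (t : R) : 0 < t ->
  is_derive t (1 : R) (fun r => c (x r u) - c (x r w))
    (c (B t (x t u)) - c (B t (x t w))).
Proof. by move=> t0; have := is_deriveB (coord_derive u t0) (coord_derive w t0). Qed.

Lemma coord_pair_continuous u w (s t : R) : 0 <= s ->
  {within `[s, t], continuous (fun r => c (x r u) - c (x r w))}.
Proof.
by move=> s0 r; apply: cvgB; [exact: (coord_continuous (u := u) (t := t) s0)|
  exact: (coord_continuous (u := w) (t := t) s0)].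
Qed.

Lemma coord_derive_continuous u :
  (forall t : R, 0 < t -> is_derive t (1 : R) (fun r => c (x r u)) (c (B t (x t u)))) /\
  (forall s t : R, 0 <= s -> {within `[s, t], continuous (fun r => c (x r u))}).
Proof. by split; [exact: coord_derive|move=> s t; exact: coord_continuous]. Qed.

Lemma coord_mean_value u w (s t : R) : 0 <= s -> s <= t ->
  exists r, s <= r <= t /\
    c (x t u) - c (x t w) - (c (x s u) - c (x s w)) =
    (c (B r (x r u)) - c (B r (x r w))) * (t - s).
Proof.
move=> s0; rewrite le_eqVlt => /orP[/eqP <-|st].
  by exists s; rewrite lexx !subrr mulr0.
have [r|r|r] := @MVT R (fun r => c (x r u) - c (x r w))
    (fun r => c (B r (x r u)) - c (B r (x r w))) s t st.
- rewrite in_itv/= => /andP[sr _]; apply: coord_pair_derive.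
  exact: le_lt_trans s0 sr.
- exact: (coord_pair_continuous (t := t) s0).
- rewrite in_itv/= => /andP[sr rt] ->; exists r; split=> //.
  by rewrite (ltW sr) (ltW rt).
Qed.

Lemma coord_mean_value1 u (s t : R) : 0 <= s -> s <= t ->
  exists r, s <= r <= t /\ c (x t u) - c (x s u) = c (B r (x r u)) * (t - s).
Proof.
move=> s0; rewrite le_eqVlt => /orP[/eqP <-|st].
  by exists s; rewrite lexx !subrr mulr0.
have [r|r|r] := @MVT R (fun r => c (x r u)) (fun r => c (B r (x r u))) s t st.
- rewrite in_itv/= => /andP[sr _]; apply: coord_derive.
  exact: le_lt_trans s0 sr.
- exact: (coord_continuous (t := t) s0).
- rewrite in_itv/= => /andP[sr rt] ->; exists r; split=> //.
  by rewrite (ltW sr) (ltW rt).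
Qed.

End Coordinate.

Let fstB (u v : T) : (u - v).1 = u.1 - v.1. Proof. by []. Qed.
Let fstZ (h : R) (u : T) : (h *: u).1 = h * u.1. Proof. by []. Qed.
Let sndB (u v : T) : (u - v).2 = u.2 - v.2. Proof. by []. Qed.
Let sndZ (h : R) (u : T) : (h *: u).2 = h * u.2. Proof. by []. Qed.

Let fstPC := @coord_pair_continuous fst fstB (@norm_fst_le R).
Let sndPC := @coord_pair_continuous snd sndB (@norm_snd_le R).

(** Gronwall's lemma needs a differentiable functional; the squared Euclidean norm replaces the max
    norm at the cost of a factor 2. *)
Let sqr_norm_bounds (u : T) :
  `|u| ^+ 2 <= u.1 ^+ 2 + u.2 ^+ 2 <= 2 * `|u| ^+ 2.
Proof.
have h1 : u.1 ^+ 2 <= `|u| ^+ 2.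
  by rewrite -real_normK ?num_real// ler_sqr ?nnegrE// norm_fst_le.
have h2 : u.2 ^+ 2 <= `|u| ^+ 2.
  by rewrite -real_normK ?num_real// ler_sqr ?nnegrE// norm_snd_le.
have h3 : `|u| ^+ 2 <= u.1 ^+ 2 + u.2 ^+ 2.
  rewrite norm_pairE; have := sqr_ge0 u.1; have := sqr_ge0 u.2.
  by case: (leP `|u.1| `|u.2|) => _; rewrite real_normK ?num_real//; lra.
by rewrite h3; lra.
Qed.

(** The squared distance grows at rate at most [4 * L], which the square root halves; the leading 2
    absorbs the [sqrt 2] lost between the norms. *)
Definition flow_const (tau : R) := 2 * expR (2 * L * tau).

Let flow_const_ge0 tau : 0 <= flow_const tau.
Proof. by rewrite mulr_ge0// expR_ge0. Qed.

Lemma flow_const_mono (s t : R) : s <= t -> flow_const s <= flow_const t.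
Proof.
by move=> st; rewrite ler_wpM2l// ler_expR ler_wpM2l// mulr_ge0.
Qed.

Let sqr_bound (a b tau M : R) : 0 <= a -> 0 <= b ->
  a ^+ 2 <= 4 * b ^+ 2 * expR (2 * M * tau) -> a <= 2 * expR (M * tau) * b.
Proof.
move=> a0 b0 H; rewrite -ler_sqr ?nnegrE//; last by rewrite !mulr_ge0// expR_ge0.
rewrite (le_trans H)// !exprMn -expRM_natl.
have -> : 2 * M * tau = 2 * (M * tau) by ring.
by rewrite le_eqVlt; apply/orP; left; apply/eqP; ring.
Qed.

Lemma flow_lip u w (s t : R) : 0 <= s -> s <= t ->
  `|x t u - x t w| <= flow_const (t - s) * `|x s u - x s w| /\
  `|x s u - x s w| <= flow_const (t - s) * `|x t u - x t w|.
Proof.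
move=> s0 st.
pose d1 r := (x r u).1 - (x r w).1; pose d2 r := (x r u).2 - (x r w).2.
pose d1' r := (B r (x r u)).1 - (B r (x r w)).1.
pose d2' r := (B r (x r u)).2 - (B r (x r w)).2.
pose S r := d1 r * d1 r + d2 r * d2 r.
pose dS r := 2 * (d1 r * d1' r + d2 r * d2' r).
have [|||H1 H2] := @gronwall _ S dS (2 * (2 * L)) s t st.
- have c1 : {within `[s, t], continuous d1} by exact: fstPC.
  have c2 : {within `[s, t], continuous d2} by exact: sndPC.
  by move=> r; apply: cvgD; apply: cvgM; by [exact: c1|exact: c2].
- move=> r /andP[sr _]; have r0 := le_lt_trans s0 sr.
  have D1 := coord_pair_derive fstB fstZ (@norm_fst_le R) u w r0.
  have D2 := coord_pair_derive sndB sndZ (@norm_snd_le R) u w r0.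
  apply: (is_derive_eq (is_deriveD (is_deriveM D1 D1) (is_deriveM D2 D2))).
  by rewrite -![_ *: _]/(_ * _) /dS /d1 /d2 /d1' /d2'; ring.
- move=> r /andP[sr _]; have r0 := ltW (le_lt_trans s0 sr).
  have BL := B_lip (x r u) (x r w) r0.
  have b1 : `|d1' r| <= L * `|x r u - x r w|.
    exact: le_trans (@norm_fst_le _ (B r (x r u) - B r (x r w))) BL.
  have b2 : `|d2' r| <= L * `|x r u - x r w|.
    exact: le_trans (@norm_snd_le _ (B r (x r u) - B r (x r w))) BL.
  have a1 : `|d1 r| <= `|x r u - x r w| := @norm_fst_le _ (x r u - x r w).
  have a2 : `|d2 r| <= `|x r u - x r w| := @norm_snd_le _ (x r u - x r w).
  have /andP[n1 _] := sqr_norm_bounds (x r u - x r w).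
  have {}n1 : `|x r u - x r w| ^+ 2 <= S r by rewrite /S -!expr2.
  have m1 : `|d1 r * d1' r| <= `|x r u - x r w| * (L * `|x r u - x r w|).
    by rewrite normrM ler_pM.
  have m2 : `|d2 r * d2' r| <= `|x r u - x r w| * (L * `|x r u - x r w|).
    by rewrite normrM ler_pM.
  rewrite /dS normrM ger0_norm//.
  have m3 := ler_normD (d1 r * d1' r) (d2 r * d2' r).
  have m4 : L * `|x r u - x r w| ^+ 2 <= L * S r by rewrite ler_wpM2l.
  have m5 : `|x r u - x r w| * (L * `|x r u - x r w|) = L * `|x r u - x r w| ^+ 2.
    by ring.
  rewrite m5 in m1 m2; lra.
have SE r : S r = (x r u - x r w).1 ^+ 2 + (x r u - x r w).2 ^+ 2.
  by rewrite /S -!expr2.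
have /andP[t1 t2] := sqr_norm_bounds (x t u - x t w).
have /andP[s1 s2] := sqr_norm_bounds (x s u - x s w).
rewrite -SE in t1 t2; rewrite -SE in s1 s2.
have E0 := expR_ge0 (2 * (2 * L) * (t - s)).
split; apply: sqr_bound => //.
- rewrite (le_trans t1)// (le_trans H1)// ler_wpM2r// (le_trans s2)// ler_wpM2r ?sqr_ge0//; lra.
- rewrite (le_trans s1)// (le_trans H2)// ler_wpM2r// (le_trans t2)// ler_wpM2r ?sqr_ge0//; lra.
Qed.

(** The functional is now 1 plus the squared Euclidean norm, whose rate [8 * C] is halved by the
    root; comparison with [(1 + |x|)^2] loses a factor 2 on each side, hence 2 after the root. *)
Definition growth_const (tau : R) := 2 * expR (4 * C * tau).

Lemma flow_growth u (s t : R) : 0 <= s -> s <= t ->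
  1 + `|x t u| <= growth_const (t - s) * (1 + `|x s u|) /\
  1 + `|x s u| <= growth_const (t - s) * (1 + `|x t u|).
Proof.
move=> s0 st.
pose y1 r := (x r u).1; pose y2 r := (x r u).2.
pose b1 r := (B r (x r u)).1; pose b2 r := (B r (x r u)).2.
pose S r := 1 + (y1 r * y1 r + y2 r * y2 r).
pose dS r := 2 * (y1 r * b1 r + y2 r * b2 r).
have [f1 f2] := coord_derive_continuous fstB fstZ (@norm_fst_le R) u.
have [g1 g2] := coord_derive_continuous sndB sndZ (@norm_snd_le R) u.
have [|||H1 H2] := @gronwall _ S dS (2 * (4 * C)) s t st.
- have c1 : {within `[s, t], continuous y1} by exact: f2.
  have c2 : {within `[s, t], continuous y2} by exact: g2.
  move=> r; apply: cvgD; first exact: cvg_cst.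
  by apply: cvgD; apply: cvgM; by [exact: c1|exact: c2].
- move=> r /andP[sr _]; have r0 := le_lt_trans s0 sr.
  have D : is_derive r (1 : R) (fun r => y1 r * y1 r + y2 r * y2 r) (dS r).
    apply: (is_derive_eq (is_deriveD (is_deriveM (f1 r r0) (f1 r r0))
      (is_deriveM (g1 r r0) (g1 r r0)))).
    by rewrite -![_ *: _]/(_ * _) /dS /y1 /y2 /b1 /b2; ring.
  by have := is_deriveD (is_derive_cst (1 : R) r (1 : R)) D; rewrite add0r.
- move=> r /andP[sr _]; have r0 := ltW (le_lt_trans s0 sr).
  have BC := B_growth (x r u) r0.
  have c1 : `|b1 r| <= C * (1 + `|x r u|) := le_trans (@norm_fst_le _ _) BC.
  have c2 : `|b2 r| <= C * (1 + `|x r u|) := le_trans (@norm_snd_le _ _) BC.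
  have a1 : `|y1 r| <= `|x r u| := @norm_fst_le _ _.
  have a2 : `|y2 r| <= `|x r u| := @norm_snd_le _ _.
  have /andP[n1 _] := sqr_norm_bounds (x r u).
  have {}n1 : 1 + `|x r u| ^+ 2 <= S r by rewrite /S -!expr2 lerD2l.
  have m1 : `|y1 r * b1 r| <= `|x r u| * (C * (1 + `|x r u|)).
    by rewrite normrM ler_pM.
  have m2 : `|y2 r * b2 r| <= `|x r u| * (C * (1 + `|x r u|)).
    by rewrite normrM ler_pM.
  rewrite /dS normrM ger0_norm//.
  have m3 := ler_normD (y1 r * b1 r) (y2 r * b2 r).
  have m4 : `|x r u| * (1 + `|x r u|) <= 2 * (1 + `|x r u| ^+ 2).
    by have := sqr_ge0 (`|x r u| - 1); have := sqr_ge0 (`|x r u| + 1); nra.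
  have m5 : C * (`|x r u| * (1 + `|x r u|)) <= C * (2 * S r).
    by rewrite ler_wpM2l// (le_trans m4)// ler_wpM2l.
  have m6 : `|x r u| * (C * (1 + `|x r u|)) = C * (`|x r u| * (1 + `|x r u|)).
    by ring.
  rewrite m6 in m1 m2; lra.
have SE r : S r = 1 + ((x r u).1 ^+ 2 + (x r u).2 ^+ 2) by rewrite /S -!expr2.
have bnd r : (1 + `|x r u|) ^+ 2 <= 2 * S r /\ S r <= 2 * (1 + `|x r u|) ^+ 2.
  rewrite SE; have /andP[r1 r2] := sqr_norm_bounds (x r u).
  have := sqr_ge0 (`|x r u| - 1); have := normr_ge0 (x r u).
  by move=> h1 h2; split; nra.
have E0 := expR_ge0 (2 * (4 * C) * (t - s)).
have E1 r r' : S r <= S r' * expR (2 * (4 * C) * (t - s)) ->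
    1 + `|x r u| <= growth_const (t - s) * (1 + `|x r' u|).
  move=> H; rewrite /growth_const; apply: sqr_bound; rewrite ?addr_ge0//.
  have [h1 _] := bnd r; have [_ h2] := bnd r'.
  have h3 : S r' * expR (2 * (4 * C) * (t - s)) <=
      2 * (1 + `|x r' u|) ^+ 2 * expR (2 * (4 * C) * (t - s)) by rewrite ler_wpM2r.
  lra.
by split; exact: E1.
Qed.

Lemma flow_speed u (s t : R) : 0 <= s -> s <= t ->
  `|x t u - x s u| <= (t - s) * (C * growth_const (t - s) * (1 + `|x s u|)).
Proof.
move=> s0 st.
have E0 tau : 0 <= growth_const tau by rewrite mulr_ge0// expR_ge0.
have key r : s <= r <= t ->
    `|B r (x r u)| <= C * growth_const (t - s) * (1 + `|x s u|).
  move=> /andP[sr rt]; rewrite (le_trans (B_growth _ (le_trans s0 sr)))//.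
  rewrite -mulrA ler_wpM2l// (le_trans (flow_growth u s0 sr).1)//.
  rewrite ler_wpM2r ?addr_ge0// ler_wpM2l// ler_expR ler_wpM2l ?mulr_ge0//.
  by rewrite lerD2r.
have ts0 : 0 <= t - s by rewrite subr_ge0.
rewrite norm_pair_le; apply/andP; split.
- have [r [rst E]] := coord_mean_value1 fstB fstZ (@norm_fst_le R) u s0 st.
  rewrite [X in `|X|]E normrM (ger0_norm ts0) mulrC ler_wpM2l//.
  exact: le_trans (@norm_fst_le _ _) (key r rst).
- have [r [rst E]] := coord_mean_value1 sndB sndZ (@norm_snd_le R) u s0 st.
  rewrite [X in `|X|]E normrM (ger0_norm ts0) mulrC ler_wpM2l//.
  exact: le_trans (@norm_snd_le _ _) (key r rst).
Qed.

(** The increment over a short time has a Lipschitz constant of order [t - s]. This makes the flow a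
    perturbation of the identity, and later yields the left derivative of the transition maps. *)
Lemma flow_increment_lip u w (s t : R) : 0 <= s -> s <= t ->
  `|(x t u - x s u) - (x t w - x s w)| <=
    (t - s) * (L * flow_const (t - s) * `|x s u - x s w|).
Proof.
move=> s0 st.
have key r : s <= r <= t ->
    `|B r (x r u) - B r (x r w)| <= L * flow_const (t - s) * `|x s u - x s w|.
  move=> /andP[sr rt]; rewrite (le_trans (B_lip _ _ (le_trans s0 sr)))//.
  rewrite -mulrA ler_wpM2l// (le_trans (flow_lip u w s0 sr).1)//.
  by rewrite ler_wpM2r// flow_const_mono// lerD2r.
have ts0 : 0 <= t - s by rewrite subr_ge0.
rewrite norm_pair_le; apply/andP; split.
- have [r [rst E]] := coord_mean_value fstB fstZ (@norm_fst_le R) u w s0 st.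
  rewrite (_ : (_ - _).1 = (B r (x r u) - B r (x r w)).1 * (t - s)); last first.
    by rewrite /= -E; ring.
  rewrite normrM (ger0_norm ts0) mulrC ler_wpM2l//.
  exact: le_trans (@norm_fst_le _ _) (key r rst).
- have [r [rst E]] := coord_mean_value sndB sndZ (@norm_snd_le R) u w s0 st.
  rewrite (_ : (_ - _).2 = (B r (x r u) - B r (x r w)).2 * (t - s)); last first.
    by rewrite /= -E; ring.
  rewrite normrM (ger0_norm ts0) mulrC ler_wpM2l//.
  exact: le_trans (@norm_snd_le _ _) (key r rst).
Qed.

Lemma flow_injective (t : R) : 0 <= t -> injective (x t).
Proof.
move=> t0 u w xuw; have [_] := flow_lip u w (lexx 0) t0.
by rewrite xuw subrr normr0 mulr0 normr_le0 subr_eq0 !x_init => /eqP.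
Qed.

(** Composed with a right inverse [y] of [x s], the map [x t] differs from the identity by a
    contraction of constant [1/2]. *)
Lemma flow_surjective_step (s t : R) : 0 <= s -> s <= t ->
  (t - s) * (L * flow_const (t - s)) <= 2^-1 ->
  (forall z, exists u, x s u = z) -> forall z, exists u, x t u = z.
Proof.
move=> s0 st small /choice[y xy] z.
have [|||v xv] := @near_identity_surjective R (x t \o y) 2^-1 _ _ _ z.
- by rewrite invr_ge0.
- by rewrite invf_lt1// ltr1n.
- move=> u v; have := flow_increment_lip (y u) (y v) s0 st.
  rewrite !xy => H; rewrite (le_trans H)// mulrA ler_wpM2r//.
by exists (y v).
Qed.

Lemma flow_surjective (t : R) : 0 <= t -> forall z, exists u, x t u = z.
Proof.
(* Time steps of length [k^-1 <= 1] make the contraction constant at most [1/2], and finitely many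
   of them cover [[0, t]]. *)
pose k := 2 * (L * flow_const 1) + 1.
have k1 : 1 <= k by rewrite lerDr !mulr_ge0.
have k0 : 0 < k by rewrite (lt_le_trans ltr01).
have small s t' : s <= t' -> t' - s <= k^-1 -> (t' - s) * (L * flow_const (t' - s)) <= 2^-1.
  move=> st ts.
  have ts1 : t' - s <= 1 by rewrite (le_trans ts)// invf_le1.
  have h : (t' - s) * (L * flow_const (t' - s)) <= k^-1 * (L * flow_const 1).
    rewrite ler_pM ?subr_ge0// ?mulr_ge0//.
    by rewrite ler_wpM2l// flow_const_mono.
  rewrite (le_trans h)// mulrC ler_pdivrMr// /k mulrDr mulKf ?pnatr_eq0//.
  by rewrite mulr1 lerDl invr_ge0.
suff H n (t' : R) : 0 <= t' -> t' <= n%:R / k -> forall z, exists u, x t' u = z.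
  move=> t0; apply: (H (Num.bound (t * k))) => //.
  by rewrite ler_pdivlMr// ltW// archi_boundP// mulr_ge0// ltW.
elim: n t' => [|n IH] t' t0 tn.
  move=> z; exists z; rewrite (_ : t' = 0) ?x_init//.
  by apply/eqP; rewrite eq_le t0 andbT; move: tn; rewrite mul0r.
have [tn'|tn'] := leP t' (n%:R / k); first exact: IH.
have nk0 : 0 <= n%:R / k by rewrite divr_ge0// ltW.
apply: (@flow_surjective_step (n%:R / k)) => //; first exact: ltW.
  apply: small; first exact: ltW.
  by rewrite lerBlDr (le_trans tn)// -natr1 mulrDl mul1r addrC.
exact: IH.
Qed.

End Flow.

(** * From test functions to measurable sets *)

Section RectangleBumps.
Context {R : realType}.
Local Notation T := (R * R)%type.

Lemma loc_lip_max (f g : T -> R) : loc_lip f -> loc_lip g ->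
  loc_lip (fun u => Num.max (f u) (g u)).
Proof.
move=> lf lg N; have [K K0 fK] := lf N; have [K' K'0 gK] := lg N.
exists (K + K') => [|u v uN vN]; first by rewrite addr_ge0.
have h1 := fK u v uN vN; have h2 := gK u v uN vN.
have h3 := normr_ge0 (u - v).
have h4 : 0 <= K * `|u - v| by rewrite mulr_ge0.
have h5 : 0 <= K' * `|u - v| by rewrite mulr_ge0.
move: h1 h2; rewrite mulrDl !ler_norml => /andP[? ?] /andP[? ?].
by case: (leP (f u) (g u)) => ?; case: (leP (f v) (g v)) => ?; apply/andP; split; lra.
Qed.

Lemma loc_lip_cst (k : R) : loc_lip (fun _ : T => k).
Proof. by apply: (@lip_loc_lip _ 0) => u v; rewrite subrr normr0 mul0r. Qed.

Lemma loc_lip_affine (k1 k2 k : R) : loc_lip (fun u : T => k1 * u.1 + k2 * u.2 + k).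
Proof.
apply: (@lip_loc_lip _ (`|k1| + `|k2|)) => u v.
have -> : k1 * u.1 + k2 * u.2 + k - (k1 * v.1 + k2 * v.2 + k) =
  k1 * (u - v).1 + k2 * (u - v).2 by rewrite /=; ring.
rewrite (le_trans (ler_normD _ _))// mulrDl !normrM lerD// ler_wpM2l//.
  exact: norm_fst_le.
exact: norm_snd_le.
Qed.

Lemma test_max0 (f : T -> R) : test f -> test (fun u => Num.max 0 (f u)).
Proof.
move=> /testE[lf [N sN]]; apply/testE; split.
  by apply: loc_lip_max => //; exact: loc_lip_cst.
by exists N => u uN; rewrite sN// maxxx.
Qed.

(* The distance to the complement of an open rectangle, scaled by [n] and
   truncated at 1, since [1 - max 0 (1 - s)] is the minimum of [s] and 1. *)
Definition rectangle_bump (a b c d : R) (n : nat) (u : T) : R :=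
  1 - Num.max 0 (1 - n%:R * Num.max 0
    (- Num.max (Num.max (a - u.1) (u.1 - b)) (Num.max (c - u.2) (u.2 - d)))).

Definition rectangle (a b c d : R) : set T := `]a, b[ `*` `]c, d[.

Lemma rectangleP a b c d (u : T) : rectangle a b c d u <->
  Num.max (Num.max (a - u.1) (u.1 - b)) (Num.max (c - u.2) (u.2 - d)) < 0.
Proof.
rewrite /rectangle /setX /= !in_itv /= !gt_max !subr_lt0; split.
  by move=> [/andP[-> ->] /andP[-> ->]].
by move=> /andP[/andP[-> ->] /andP[-> ->]].
Qed.

Lemma rectangle_box a b c d :
  rectangle a b c d `<=` box (`|a| + `|b| + `|c| + `|d|).
Proof.
move=> u /rectangleP; rewrite !gt_max !subr_lt0 -!andbA => /and4P[h1 h2 h3 h4].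
have := ler_norm a; have := ler_norm b; have := ler_norm c; have := ler_norm d.
have := ler_norm (- a); have := ler_norm (- c); rewrite !normrN.
have := normr_ge0 a; have := normr_ge0 b; have := normr_ge0 c; have := normr_ge0 d.
move=> *; apply/boxP.
by rewrite norm_pair_le !ler_norml; apply/andP; split; apply/andP; split; lra.
Qed.

Lemma rectangle_bump_le1 a b c d n u : `|rectangle_bump a b c d n u| <= 1.
Proof.
rewrite /rectangle_bump; set s := Num.max 0 (- _).
have s0 : 0 <= s by rewrite le_max lexx.
have ns0 : 0 <= n%:R * s by rewrite mulr_ge0.
by rewrite ler_norml; case: (leP 0 (1 - n%:R * s)) => ?; apply/andP; split; lra.
Qed.

Lemma rectangle_bump_out a b c d n u : ~ rectangle a b c d u ->
  rectangle_bump a b c d n u = 0.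
Proof.
move=> /rectangleP/negP; rewrite -leNgt => h; rewrite /rectangle_bump.
by rewrite (max_idPl (_ : - _ <= 0)) ?oppr_le0// mulr0 subr0 max_r// subrr.
Qed.

Lemma rectangle_bump_cvg a b c d u :
  rectangle_bump a b c d n u @[n --> \oo] --> (\1_(rectangle a b c d) u : R).
Proof.
have [/rectangleP h|h] := pselect (rectangle a b c d u); last first.
  rewrite indicE memNset//; under eq_fun do rewrite rectangle_bump_out//.
  exact: cvg_cst.
rewrite indicE mem_set; last exact/rectangleP.
apply: (@cvg_near_cst _ _ _ _ _).
rewrite /rectangle_bump; move: h; set s := Num.max _ _ => s0.
near=> n; rewrite (max_idPr (_ : 0 <= - s)) ?oppr_ge0 ?(ltW s0)//.
(* Inside the rectangle the bump equals 1 as soon as [n >= 1 / (- s)], so the sequence is eventually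
   constant. *)
rewrite (max_idPl _) ?subr0// subr_le0 -ler_pdivrMr ?oppr_gt0// div1r.
by near: n; exact: nbhs_infty_ger.
Unshelve. all: by end_near. Qed.

Lemma test_rectangle_bump a b c d n : test (rectangle_bump a b c d n).
Proof.
have l1 (k1 k2 k : R) := loc_lip_affine k1 k2 k.
have lmax : loc_lip (fun u : T =>
    Num.max (Num.max (a - u.1) (u.1 - b)) (Num.max (c - u.2) (u.2 - d))).
  apply: loc_lip_max; apply: loc_lip_max.
  - by rewrite (_ : (fun u => _) = (fun u : T => (-1) * u.1 + 0 * u.2 + a)); [exact: l1|apply/funext => u; ring].
  - by rewrite (_ : (fun u => _) = (fun u : T => 1 * u.1 + 0 * u.2 + (- b))); [exact: l1|apply/funext => u; ring].
  - by rewrite (_ : (fun u => _) = (fun u : T => 0 * u.1 + (-1) * u.2 + c)); [exact: l1|apply/funext => u; ring].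
  - by rewrite (_ : (fun u => _) = (fun u : T => 0 * u.1 + 1 * u.2 + (- d))); [exact: l1|apply/funext => u; ring].
have lN (f : T -> R) (lf : loc_lip f) : loc_lip (fun u => - f u).
  rewrite (_ : (fun u => _) = (fun u => (-1) * f u)); first exact: loc_lipZ.
  by apply/funext => u; rewrite mulN1r.
apply/testE; split.
  apply: (@loc_lipD _ (cst 1)); first exact: loc_lip_cst.
  apply: (lN _ _); apply: loc_lip_max; first exact: loc_lip_cst.
  apply: (@loc_lipD _ (cst 1)); first exact: loc_lip_cst.
  apply: (lN _ _); apply: loc_lipZ; apply: loc_lip_max; first exact: loc_lip_cst.
  exact: lN.
exists (`|a| + `|b| + `|c| + `|d|) => u uN; apply: rectangle_bump_out.
by move=> /rectangle_box /boxP; lra.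
Qed.

End RectangleBumps.

Section RectangleSigmaAlgebra.
Context {R : realType}.
Local Notation T := (R * R)%type.
Local Notation T' := (measurableTypeR R * measurableTypeR R)%type.

Definition rectangles : set (set T') :=
  [set Q | exists a b c d, Q = rectangle a b c d].

Lemma rectangles_setI_closed : setI_closed rectangles.
Proof.
move=> _ _ [a [b [c [d ->]]]] [a' [b' [c' [d' ->]]]].
exists (Num.max a a'), (Num.min b b'), (Num.max c c'), (Num.min d d').
apply/seteqP; split=> u; rewrite /rectangle /setX /= !in_itv /= !gt_max !lt_min.
  by move=> [[/andP[-> ->] /andP[-> ->]] [/andP[-> ->] /andP[-> ->]]].
by move=> [/andP[/andP[-> ->] /andP[-> ->]] /andP[/andP[-> ->] /andP[-> ->]]].
Qed.

Lemma measurable_rectangle (a b c d : R) : measurable (rectangle a b c d : set T').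
Proof. by apply: measurableX; exact: measurable_itv. Qed.

Lemma rectangles_cover : \bigcup_k rectangle (- k%:R) k%:R (- k%:R) (k%:R : R) = [set: T].
Proof.
apply/seteqP; split=> // u _; have [k uk] : exists k, `|u| < k%:R :> R.
  by exists (Num.truncn `|u|).+1; exact: truncnS_gt.
exists k => //; rewrite /rectangle /setX /= !in_itv /= -!ltr_norml.
by rewrite (le_lt_trans (@norm_fst_le _ u) uk) (le_lt_trans (@norm_snd_le _ u) uk).
Qed.

(** With [rectangles_setI_closed] and [rectangles_cover], this lets two measures be compared on open
    rectangles only. *)
Lemma measurable_rectangles : @measurable _ T' = <<s rectangles >>.
Proof.
apply/seteqP; split; last first.
  apply: smallest_sub; first exact: sigma_algebra_measurable.
  by move=> _ [a [b [c [d ->]]]]; exact: measurable_rectangle.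
(* On the plane with the sigma-algebra generated by rectangles both projections are measurable,
   hence so are all products of measurable sets. *)
pose U := g_sigma_algebraType rectangles.
have mrect (a b c d : R) : measurable (rectangle a b c d : set U).
  by apply: sub_sigma_algebra; exists a, b, c, d.
have mfst : measurable_fun setT (fst : U -> R).
  apply: (measurability _ (RGenOpens.measurableE R)) => //.
  move=> _ [_ [a [b ->] <-]]; rewrite setTI.
  rewrite (_ : _ @^-1` _ = \bigcup_k rectangle a b (- k%:R) (k%:R : R)).
    by apply: bigcup_measurable => k _; exact: mrect.
  apply/seteqP; split=> u; last by move=> [k _ []].
  move=> uab; have : [set: T] u by []; rewrite -rectangles_cover => -[k _ [_ ?]].
  by exists k.
have msnd : measurable_fun setT (snd : U -> R).
  apply: (measurability _ (RGenOpens.measurableE R)) => //.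
  move=> _ [_ [a [b ->] <-]]; rewrite setTI.
  rewrite (_ : _ @^-1` _ = \bigcup_k rectangle (- k%:R) (k%:R : R) a b).
    by apply: bigcup_measurable => k _; exact: mrect.
  apply/seteqP; split=> u; last by move=> [k _ []].
  move=> uab; have : [set: T] u by []; rewrite -rectangles_cover => -[k _ [? _]].
  by exists k.
rewrite measurable_prod_measurableType.
apply: smallest_sub; first exact: smallest_sigma_algebra.
move=> _ [A1 mA1 [A2 mA2 <-]].
have -> : A1 `*` A2 = (fst : U -> R) @^-1` A1 `&` (snd : U -> R) @^-1` A2 by [].
apply: (@measurableI _ U).
  by rewrite -[X in _ X]setTI; exact: mfst.
by rewrite -[X in _ X]setTI; exact: msnd.
Qed.

End RectangleSigmaAlgebra.

Section PushForward.
Context {R : realType}.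
Local Notation T := (R * R)%type.
Local Notation T' := (measurableTypeR R * measurableTypeR R)%type.
Local Notation leb2 := (@lebesgue2 R).
Variable p : T -> R.
Hypotheses (p_cont : continuous p) (p_ge0 : forall u, 0 <= p u).

Let m : set T' -> \bar R := density_measure p.

Let mp (D : set T') : measurable_fun D (fun u : T' => (p u)%:E).
Proof. by apply/measurable_EFinP; apply: measurable_funTS; exact: continuous_measurable_plane. Qed.

Let m0 : m set0 = 0%E. Proof. exact: integral_set0. Qed.

Let m_ge0 A : (0 <= m A)%E.
Proof. by apply: integral_ge0 => u _; rewrite lee_fin. Qed.

Let m_sigma_additive : semi_sigma_additive m.
Proof.
move=> F mF tF mUF; rewrite /m /density_measure.
rewrite ge0_integral_bigcup//; last by move=> u _; rewrite lee_fin.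
apply: is_cvg_ereal_nneg_natsum_cond => n _ _.
by apply: integral_ge0 => u _; rewrite lee_fin.
Qed.

HB.instance Definition _ := isMeasure.Build _ _ _ m m0 m_ge0 m_sigma_additive.

Lemma J_indicE (A : set T) N : measurable A -> A `<=` box N ->
  density_measure p A = (J (fun u => \1_A u * p u))%:E /\
  Jable (fun u => \1_A u * p u).
Proof.
move=> mA AN.
have [M M0 pM] := continuous_bounded_box N p_cont.
have jA : Jable (fun u => \1_A u * p u).
  apply: (@dominated_Jable _ _ N M).
    apply: measurableM_plane; first exact: measurable_indic.
    exact: continuous_measurable_plane.
  apply: supported_dominated => u uN.
    rewrite indicE memNset ?mul0r// => /AN /boxP; lra.
  rewrite indicE; case: (u \in A); rewrite ?mul1r ?mul0r ?normr0//; exact: pM.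
split=> //; rewrite /J /Rintegral fineK; last exact: integrable_fin_num.
rewrite /density_measure [LHS]integral_mkcond; congr integral; apply/funext => u.
by rewrite /patch /= indicE; case: (u \in A); rewrite ?mul1r ?mul0r.
Qed.

(** Bumps increase to the indicator of an open rectangle, which settles rectangles; uniqueness of
    measures extends the equality. Properness keeps the preimages of rectangles bounded, so the
    integrals stay dominated. *)
Lemma density_measure_preimage (phi : T -> T) : continuous phi ->
  (forall N, exists N', forall u, `|phi u| <= N -> `|u| <= N') ->
  (forall psi, test psi -> J (fun u => psi (phi u) * p u) = J (fun u => psi u * p u)) ->
  forall A, measurable A -> density_measure p (phi @^-1` A) = density_measure p A.
Proof.
move=> cphi phi_proper phi_test A mA.
have mphi : measurable_fun setT (phi : T' -> T') by exact: continuous_measurable_plane2.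
have mQ (a b c d : R) : density_measure p (phi @^-1` rectangle a b c d) =
    density_measure p (rectangle a b c d).
  set N := `|a| + `|b| + `|c| + `|d|; have [N' phiN] := phi_proper N.
  have QN : rectangle a b c d `<=` box N := @rectangle_box _ a b c d.
  have mQ := measurable_rectangle a b c d.
  have phiQN : phi @^-1` rectangle a b c d `<=` box N'.
    by move=> u /QN /boxP /phiN /boxP.
  have mphiQ : measurable (phi @^-1` rectangle a b c d : set T').
    by rewrite -[X in measurable X]setTI; exact: mphi.
  have [-> _] := J_indicE mphiQ phiQN; have [-> _] := J_indicE mQ QN; congr (_%:E).
  (* Stated for a general [f], to be used with [phi] and with the identity. *)
  have lim (f : T -> T) K : continuous f -> (forall u, ~ box K u -> ~ rectangle a b c d (f u)) ->
      measurable (f @^-1` rectangle a b c d : set T') ->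
      J (fun u => rectangle_bump a b c d n (f u) * p u) @[n --> \oo] -->
      J (fun u => \1_(f @^-1` rectangle a b c d) u * p u).
    move=> cf fK mf; have [M M0 pM] := continuous_bounded_box K p_cont.
    have mp' : measurable_fun setT (p : T -> R) by exact: continuous_measurable_plane.
    apply: (@J_cvgn _ _ _ K M).
    - move=> n; apply: measurableM_plane => //; apply: continuous_measurable_plane.
      move=> u; apply: (@cvg_comp _ _ _ f); first exact: cf.
      exact: (test_continuous (@test_rectangle_bump _ a b c d n)).
    - move=> n; apply: supported_dominated => u uK.
        rewrite rectangle_bump_out ?mul0r//; apply: fK => /boxP; lra.
      rewrite normrM -[leRHS]mul1r ler_pM//; first exact: rectangle_bump_le1.
      exact: pM.
    - by apply: measurableM_plane => //; exact: measurable_indic.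
    apply: aeW => u; apply: cvgM; last exact: cvg_cst.
    exact: (@rectangle_bump_cvg _ a b c d (f u)).
  have l1 := lim phi N' cphi _ mphiQ.
  have cid : continuous (id : T -> T) by move=> u; exact: cvg_id.
  have l2 := lim id N cid _ mQ.
  have {}l1 := l1 (fun u uN' Q => uN' (phiQN u Q)).
  have {}l2 := l2 (fun u uN' Q => uN' (QN u Q)).
  apply: (cvg_unique (@Rhausdorff R) l1).
  rewrite (_ : (fun n => _) = (fun n => J (fun u => rectangle_bump a b c d n u * p u))).
    exact: l2.
  by apply/funext => n; apply: phi_test; exact: test_rectangle_bump.
apply: (@measure_unique _ _ _ rectangles (fun k => rectangle (- k%:R) k%:R (- k%:R) k%:R)
  measurable_rectangles rectangles_setI_closed _ rectangles_cover
  (measure_function_pushforward__canonical__measure_function_Measure m mphi) m) => //.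
- by move=> k; exists (- k%:R), k%:R, (- k%:R), k%:R.
- by move=> _ [a [b [c [d ->]]]]; exact: mQ.
- move=> k; apply: (@le_lt_trans _ _ (density_measure p (rectangle (- k%:R) k%:R (- k%:R) k%:R))).
    by rewrite -mQ.
  by have [-> _] := J_indicE (measurable_rectangle (- k%:R) k%:R (- k%:R) k%:R) (@rectangle_box _ _ _ _ _); rewrite ltry.
Qed.

End PushForward.

(** * From measurable sets to test functions *)

Section LayerCake.
Context {R : realType}.
Local Notation T := (R * R)%type.
Local Notation T' := (measurableTypeR R * measurableTypeR R)%type.
Variable p : T -> R.
Hypothesis p_cont : continuous p.

(** The heights start at [k.+1], not at 0: this keeps the sets inside the support of [psi], hence
    bounded. *)
Definition level_set (psi : T -> R) (n k : nat) : set T :=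
  [set u | k.+1%:R <= n.+1%:R * psi u].

(** For nonnegative [psi] this is [psi] rounded down to a multiple of [1/(n+1)] and capped at
    [K/(n+1)], written with indicators of sets on which [phi_preserves] can act. *)
Definition staircase (psi : T -> R) (n K : nat) (u : T) : R :=
  n.+1%:R^-1 * \sum_(k < K) \1_(level_set psi n k) u.

Lemma measurable_level_set psi n k : continuous psi ->
  measurable (level_set psi n k : set T').
Proof.
move=> cpsi; have mpsi : measurable_fun setT (fun u : T' => n.+1%:R * psi u).
  by apply: continuous_measurable_plane; apply: continuousM_plane => // u; exact: cvg_cst.
rewrite (_ : level_set _ _ _ = (fun u : T' => n.+1%:R * psi u) @^-1` `[k.+1%:R, +oo[).
  by rewrite -[X in measurable X]setTI; apply: mpsi => //; exact: measurable_itv.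
by apply/seteqP; split=> u; rewrite /= in_itv /= andbT.
Qed.

Lemma sum_ltn_minn (t K : nat) : (\sum_(k < K) (k < t)%N = minn t K)%N.
Proof.
elim: K => [|K IH]; first by rewrite big_ord0 minn0.
rewrite big_ord_recr /= IH; case: (ltnP K t) => h /=.
  by rewrite (minn_idPr h) addn1.
by rewrite (minn_idPl (leqW h)) addn0.
Qed.

Lemma staircase_dist psi n K u : 0 <= psi u -> n.+1%:R * psi u < K%:R ->
  `|staircase psi n K u - psi u| <= n.+1%:R^-1.
Proof.
move=> psi0 psiK; have n0 : (0 : R) < n.+1%:R by [].
have np0 : 0 <= n.+1%:R * psi u by rewrite mulr_ge0.
have -> : staircase psi n K u = n.+1%:R^-1 * (Num.truncn (n.+1%:R * psi u))%:R.
  rewrite /staircase; congr (_ * _).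
  have -> : Num.truncn (n.+1%:R * psi u) = minn (Num.truncn (n.+1%:R * psi u)) K.
    by apply/esym/minn_idPl; rewrite ltnW// truncn_lt_nat.
  rewrite -sum_ltn_minn natr_sum; apply: eq_bigr => k _.
  rewrite truncn_gt_nat indicE; congr (_%:R); congr nat_of_bool.
  by apply/idP/idP; rewrite inE.
have /andP[h1 h2] := truncn_itv np0.
have -> : psi u = n.+1%:R^-1 * (n.+1%:R * psi u) by rewrite mulKf// gt_eqF.
rewrite -mulrBr normrM gtr0_norm ?invr_gt0// mulKf ?gt_eqF//.
rewrite ler_piMr ?invr_ge0 ?ltW//.
rewrite -[X in _ < X]natr1 in h2; move: h1 h2; set t := (X in X <= _); move=> h1 h2.
by rewrite ltr_norml; apply/andP; split; lra.
Qed.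

Variables (phi : T -> T).
Hypothesis phi_cont : continuous phi.
Hypothesis phi_proper : forall N, exists N', forall u, `|phi u| <= N -> `|u| <= N'.
Hypothesis phi_preserves : forall A (N : R), measurable A -> A `<=` box N ->
  density_measure p (phi @^-1` A) = density_measure p A.

Let measurable_phi : measurable_fun setT (phi : T' -> T').
Proof. exact: continuous_measurable_plane2. Qed.

Lemma J_indic_preimage A N : measurable A -> A `<=` box N ->
  [/\ Jable (fun u => \1_A (phi u) * p u), Jable (fun u => \1_A u * p u) &
      J (fun u => \1_A (phi u) * p u) = J (fun u => \1_A u * p u)].
Proof.
move=> mA AN; have [N' phiN] := phi_proper N.
have phiA : phi @^-1` A `<=` box N' by move=> u /AN /boxP /phiN /boxP.
have mphiA : measurable (phi @^-1` A : set T').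
  by rewrite -[X in measurable X]setTI; exact: measurable_phi.
have [h1 j1] := J_indicE p_cont mphiA phiA.
have [h2 j2] := J_indicE p_cont mA AN.
by split=> //; apply: EFin_inj; rewrite -h1 -h2; exact: (phi_preserves mA AN).
Qed.

Lemma J_staircase psi n K : test psi ->
  [/\ Jable (fun u => staircase psi n K (phi u) * p u),
      Jable (fun u => staircase psi n K u * p u) &
      J (fun u => staircase psi n K (phi u) * p u) = J (fun u => staircase psi n K u * p u)].
Proof.
move=> tpsi; have cpsi := test_continuous tpsi.
have [_ [N [_ N0 _ spsi]]] := test_supp tpsi.
have h k : [/\ Jable (fun u => \1_(level_set psi n k) (phi u) * p u),
      Jable (fun u => \1_(level_set psi n k) u * p u) &
      J (fun u => \1_(level_set psi n k) (phi u) * p u) =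
      J (fun u => \1_(level_set psi n k) u * p u)].
  apply: (@J_indic_preimage _ N); first exact: measurable_level_set.
  move=> u; rewrite /level_set/= => ku; apply/boxP; rewrite leNgt; apply/negP.
  by move=> /spsi psi0; move: ku; rewrite psi0 mulr0 lern0.
pose s f u : R := n.+1%:R^-1 * \sum_(k < K) (\1_(level_set psi n k) (f u) * p u).
have E f : (fun u => staircase psi n K (f u) * p u) = s f.
  by apply/funext => u; rewrite /s /staircase -mulrA mulr_suml.
have [j1 e1] := @J_sum _ 'I_K (fun k u => \1_(level_set psi n k) (phi u) * p u)
  (fun k => let: And3 h _ _ := h k in h).
have [j2 e2] := @J_sum _ 'I_K (fun k u => \1_(level_set psi n k) u * p u)
  (fun k => let: And3 _ h _ := h k in h).
rewrite E (E id); split; [exact: JableZ|exact: JableZ|].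
rewrite /s JZ// JZ//; congr (_ * _); rewrite e1 e2.
by apply: eq_bigr => k _; have [] := h k.
Qed.

Lemma J_preimage_ge0 psi : test psi -> (forall u, 0 <= psi u) ->
  J (fun u => psi (phi u) * p u) = J (fun u => psi u * p u).
Proof.
move=> tpsi psi0; have cpsi := test_continuous tpsi.
have [_ [N [_ N0 _ spsi]]] := test_supp tpsi.
have [M M0 psiM] := loc_lip_bounded N (test_loc_lip tpsi).
have psiM' u : psi u <= M.
  have [uN|uN] := leP `|u| N; last by rewrite spsi.
  exact: le_trans (ler_norm _) (psiM _ uN).
(* Enough levels for the cap never to be reached. *)
pose K n := (Num.truncn (n.+1%:R * M)).+1.
have KE n u : n.+1%:R * psi u < (K n)%:R.
  by rewrite (le_lt_trans _ (truncnS_gt _))// ler_wpM2l.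
have dist n u := @staircase_dist psi n (K n) u (psi0 u) (KE n u).
have lim (f : T -> T) N' : continuous f -> (forall u, `|f u| <= N -> `|u| <= N') ->
    J (fun u => staircase psi n (K n) (f u) * p u) @[n --> \oo] -->
    J (fun u => psi (f u) * p u).
  move=> cf fN; have [P P0 pP] := continuous_bounded_box N' p_cont.
  have mp : measurable_fun setT (p : T -> R) by exact: continuous_measurable_plane.
  have mf : measurable_fun setT (f : T' -> T') by exact: continuous_measurable_plane2.
  apply: (@J_cvgn _ _ _ N' ((M + 1) * P)).
  - move=> n; apply: measurableM_plane => //.
    apply: (@measurableM_plane _ (fun=> _)); first exact: measurable_cst.
    apply: measurable_sum => k.
    apply: (measurableT_comp _ mf); apply: measurable_indic; exact: measurable_level_set.
  - move=> n; apply: supported_dominated => u uN'.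
      have fuN : N < `|f u|.
        by rewrite ltNge; apply/negP => /fN; move: uN'; lra.
      rewrite /staircase big1 ?mulr0 ?mul0r// => k _.
      by rewrite indicE memNset// /level_set/= spsi// mulr0 lern0.
    rewrite normrM ler_pM//; last exact: pP.
    have := dist n (f u); have : n.+1%:R^-1 <= (1 : R) by rewrite invf_le1 ?ler1n.
    have := psi0 (f u); have := psiM' (f u).
    move: (staircase _ _ _ _) (n.+1%:R^-1 : R) => s c.
    rewrite !ler_norml => ? ? ? /andP[h1 h2]; apply/andP; split; lra.
  - apply: measurableM_plane => //; apply: continuous_measurable_plane.
    by move=> u; apply: (@cvg_comp _ _ _ f); [exact: cf|exact: cpsi].
  apply: aeW => u; apply: cvgM; last exact: cvg_cst.
  apply/cvgrPdist_le => e e0; near=> n.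
  rewrite distrC (le_trans (dist n (f u)))//.
  by apply: ltW; near: n; exact: (near_infty_natSinv_lt (PosNum e0)).
have [N' phiN] := phi_proper N.
have cid : continuous (id : T -> T) by move=> u; exact: cvg_id.
have l1 := lim phi N' phi_cont phiN; have l2 := lim id N cid (fun u h => h).
apply: (cvg_unique (@Rhausdorff R) l1).
rewrite (_ : (fun n => _) = (fun n => J (fun u => staircase psi n (K n) u * p u)))//.
by apply/funext => n; have [_ _] := @J_staircase psi n (K n) tpsi.
Unshelve. all: by end_near. Qed.

(** Positive and negative parts of a test function are again test functions. *)
Lemma J_preimage psi : test psi ->
  J (fun u => psi (phi u) * p u) = J (fun u => psi u * p u).
Proof.
move=> tpsi; have cpsi := test_continuous tpsi.
have [_ [N [_ N0 _ spsi]]] := test_supp tpsi; have [N' phiN] := phi_proper N.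
have tN : test (fun u => - psi u).
  apply/testE; split; last by exists N => u uN; rewrite spsi ?oppr0.
  rewrite (_ : (fun u => _) = (fun u => (-1) * psi u)).
    by apply: loc_lipZ; exact: test_loc_lip.
  by apply/funext => u; rewrite mulN1r.
have t1 := test_max0 tpsi; have t2 := test_max0 tN.
have E u : psi u = Num.max 0 (psi u) - Num.max 0 (- psi u).
  by case: (leP 0 (psi u)) => ?; case: (leP 0 (- psi u)) => ?; lra.
have EJ f : (forall u, `|f u| <= N -> `|u| <= N \/ `|u| <= N') -> continuous f ->
    J (fun u => psi (f u) * p u) =
    J (fun u => Num.max 0 (psi (f u)) * p u) - J (fun u => Num.max 0 (- psi (f u)) * p u).
  move=> fN cf.
  have j g : test g -> supported N g -> Jable (fun u => g (f u) * p u).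
    move=> tg sg; apply: (@continuous_Jable _ _ (Num.max N N')).
      apply: continuousM_plane => // u; apply: (@cvg_comp _ _ _ f); first exact: cf.
      exact: (test_continuous tg).
    move=> u uN; rewrite sg ?mul0r//; rewrite ltNge; apply/negP => /fN.
    by move: uN; rewrite gt_max => /andP[? ?] []; lra.
  rewrite -JB.
  - by congr J; apply/funext => u; rewrite {1}(E (f u)) mulrBl.
  - by apply: (j _ t1) => u uN; rewrite spsi ?maxxx.
  - by apply: (j _ t2) => u uN; rewrite spsi ?oppr0 ?maxxx.
have cid : continuous (id : T -> T) by move=> u; exact: cvg_id.
rewrite (EJ phi)//; last by move=> u /phiN; right.
rewrite (EJ id)//; last by left.
rewrite (J_preimage_ge0 t1); last by move=> u; rewrite le_max lexx.
by rewrite (J_preimage_ge0 t2)// => u; rewrite le_max lexx.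
Qed.

End LayerCake.

(** * The flow against its Euler step *)

Section PushLimit.
Context {R : realType}.
Local Notation T := (R * R)%type.
Variables (p : T -> R) (b : T -> T) (L : R).
Hypotheses (p_cont : continuous p) (L0 : 0 <= L)
  (b_lip : forall u v, `|b u - b v| <= L * `|u - v|).
Variables (y : R -> T -> T) (C d : R).
Hypotheses (C0 : 0 <= C) (d0 : 0 < d)
  (y_cont : forall h : R, 0 < h < d -> continuous (y h))
  (y_speed : forall (h : R) u, 0 < h < d -> `|y h u - u| <= h * (C * (1 + `|u|)))
  (y_derive : forall u (eps : R), 0 < eps -> exists2 delta : R, 0 < delta &
     forall h : R, 0 < h < delta -> `|y h u - u - h *: b u| <= eps * h).

(** As [psi] is Lipschitz, the two integrands differ by at most [K * |p|] times the error of the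
    Euler step over [h], which tends to 0 pointwise by [y_derive] and is dominated thanks to
    [y_speed]. *)
Lemma push_advection_cvg psi : test psi ->
  (J (fun u => h^-1 * ((psi (y h u) - psi u) * p u)) - advection p b psi h)
    @[h --> 0^'+] --> 0.
Proof.
move=> tpsi; have cpsi := test_continuous tpsi.
have [K [N [K0 N0 psiK spsi]]] := test_supp tpsi.
(* The constant [L + C] required by [advection_supported]. *)
pose C' := L + (L + `|b 0|); have C'0 : 0 <= C' by rewrite !addr_ge0.
pose N2 : R := 2 * N + 2; have N20 : 0 <= N2 by rewrite /N2; lra.
have [P P0 pP] := continuous_bounded_box N2 p_cont.
(* Below [d'] both displacements are at most half of [1 + |u|], so all integrands vanish outside the
   same ball of radius [N2]. *)
pose d' := Num.min d ((2 * (C + C') + 1)^-1).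
have CC : 0 < 2 * (C + C') + 1 by move: C0 => ?; lra.
have d'0 : 0 < d' by rewrite lt_min d0 invr_gt0.
have small (h : R) : 0 < h < d' -> [/\ 0 < h, 0 < h < d, h * (2 * C) <= 1 & h * (2 * C') <= 1].
  rewrite lt_min => /andP[h0 /andP[-> hd]]; rewrite h0.
  have hCC : h * (2 * (C + C') + 1) <= 1 by rewrite -ler_pdivlMr// div1r ltW.
  have := mulr_ge0 (ltW h0) C0; have := mulr_ge0 (ltW h0) C'0.
  by split=> //; lra.
have suppY (h : R) : 0 < h < d' -> supported N2 (fun u => psi (y h u)).
  move=> /small[h0 hd hC _] u uN; apply: spsi.
  have h1 := y_speed u hd; have h2 := ler_normB (y h u) (y h u - u).
  rewrite subKr in h2.
  have h3 : h * (2 * C) * (1 + `|u|) <= 1 * (1 + `|u|) by rewrite ler_wpM2r// addr_ge0.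
  have h4 : h * (2 * C) * (1 + `|u|) = 2 * (h * (C * (1 + `|u|))) by ring.
  by rewrite h4 in h3; move: uN; rewrite /N2; lra.
have suppB (h : R) : 0 < h < d' -> supported N2 (fun u : T => psi (u + h *: b u)).
  by move=> /small[h0 _ _ hC]; exact: (advection_supported L0 b_lip h0 hC N0 spsi).
have contY (h : R) : 0 < h < d' -> continuous (fun u => psi (y h u)).
  move=> /small[_ hd _ _] u; apply: (@cvg_comp _ _ _ (y h) psi); last exact: cpsi.
  exact: y_cont.
have contB (h : R) : continuous (fun u : T => psi (u + h *: b u)) by exact: (continuous_push L0 b_lip).
have supp0 : supported N2 psi by move=> u; rewrite /N2 => uN; apply: spsi; lra.
pose f_ (h : R) (u : T) : R := h^-1 * ((psi (y h u) - psi (u + h *: b u)) * p u).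
have JE (h : R) : 0 < h < d' ->
    J (fun u => h^-1 * ((psi (y h u) - psi u) * p u)) - advection p b psi h = J (f_ h).
  move=> hd; rewrite /advection -JB.
  - by congr J; apply/funext => u; rewrite /f_; ring.
  - apply: (@continuous_Jable _ _ N2).
      apply: continuousM_plane; first by move=> u; exact: cvg_cst.
      by apply: continuousM_plane => //; apply: continuousB_plane => //; exact: contY.
    by move=> u uN; rewrite (suppY h)// supp0// subrr mul0r mulr0.
  - apply: (@continuous_Jable _ _ N2).
      apply: continuousM_plane; first by move=> u; exact: cvg_cst.
      by apply: continuousM_plane => //; exact: continuousB_plane.
    by move=> u uN; rewrite (suppB h)// supp0// subrr mul0r mulr0.
suff /cvg_at_right0P H : J (f_ h) @[h --> 0^'+] --> 0.
  apply/cvg_at_right0P => eps e0; have [r r0 Hr] := H _ e0.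
  exists (Num.min r d'); first by rewrite lt_min r0.
  move=> h /andP[h0]; rewrite lt_min => /andP[hr hd'].
  by rewrite JE ?h0//; apply: Hr; rewrite h0.
have f_le (h : R) u : 0 < h -> `|f_ h u| <= h^-1 * (K * `|y h u - u - h *: b u| * `|p u|).
  move=> h0; rewrite /f_ !normrM gtr0_norm ?invr_gt0// ler_wpM2l ?invr_ge0 ?(ltW h0)//.
  by rewrite ler_wpM2r// (le_trans (psiK _ _))// opprD addrA.
apply: (@J_cvg_at_right0 _ _ N2 (K * ((C + C') * (1 + N2)) * P) d' d'0).
- move=> h hd; apply: continuous_measurable_plane.
  apply: continuousM_plane; first by move=> u; exact: cvg_cst.
  by apply: continuousM_plane => //; apply: continuousB_plane => //; exact: contY.
- move=> h hd; have [h0 hd0 _ _] := small _ hd.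
  apply: supported_dominated => u uN.
    by rewrite /f_ (suppY h)// (suppB h)// subrr mul0r mulr0.
  rewrite (le_trans (f_le h u h0))//.
  have h1 : `|y h u - u - h *: b u| <= h * ((C + C') * (1 + N2)).
    rewrite (le_trans (ler_normB _ _))// normrZ gtr0_norm// mulrDl mulrDr.
    have uN' : 1 + `|u| <= 1 + N2 by rewrite lerD2l.
    apply: lerD.
      rewrite (le_trans (y_speed u hd0))// ler_wpM2l ?(ltW h0)//.
      by rewrite ler_wpM2l.
    rewrite ler_wpM2l ?(ltW h0)// (le_trans (field_growth L0 b_lip u))//.
    by rewrite ler_pM// ?addr_ge0// /C'; move: L0 => ?; lra.
  rewrite ler_pdivrMl// mulrA ler_pM//; last exact: pP.
    by rewrite mulr_ge0.
  by rewrite mulrCA ler_wpM2l.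
apply: aeW => u; apply/cvg_at_right0P => eps e0.
have KP0 : 0 < K * `|p u| + 1 by rewrite ltr_wpDl ?mulr_ge0.
have [r r0 Hr] := y_derive u (divr_gt0 e0 KP0).
exists r => // h hr; have /andP[h0 _] := hr.
rewrite (le_trans (f_le h u h0))// ler_pdivrMl//.
rewrite (@le_trans _ _ (K * (eps / (K * `|p u| + 1) * h) * `|p u|))//.
  by rewrite ler_wpM2r// ler_wpM2l// Hr.
rewrite (_ : _ * _ * _ = h * (eps * ((K * `|p u|) / (K * `|p u| + 1)))); last by ring.
rewrite ler_wpM2l ?(ltW h0)// ler_piMr ?(ltW e0)//.
by rewrite ler_pdivrMr// mul1r lerDl.
Qed.

End PushLimit.

(** Let [m] be the infimum of the times [s] with [|g s - g t| <= eps * (t - s)]. It satisfies the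
    inequality by continuity, and if it were positive the left derivative would carry the inequality
    below it. *)
Lemma zero_left_derivative {R : realType} (g : R -> R) (t K : R) : 0 <= t ->
  (forall r s, 0 <= r -> r <= s -> s <= t -> `|g r - g s| <= K * (s - r)) ->
  (forall s, 0 < s <= t -> forall eps, 0 < eps -> exists2 delta, 0 < delta &
    forall h, 0 < h < delta -> h <= s -> `|g (s - h) - g s| <= eps * h) ->
  g 0 = g t.
Proof.
move=> t0 gK g_left; suff H eps : 0 < eps -> `|g 0 - g t| <= eps * t.
  apply/eqP; rewrite -subr_eq0 -normr_le0; apply/ler_addgt0Pl => e e0.
  have t1 : 0 < t + 1 by lra.
  rewrite addr0 (le_trans (H _ (divr_gt0 e0 t1)))// -mulrA ler_piMr ?(ltW e0)//.
  by rewrite mulrC ler_pdivrMr//; lra.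
move=> e0.
pose S := [set s | 0 <= s <= t /\ `|g s - g t| <= eps * (t - s)].
have St : S t by rewrite /S/= t0 lexx !subrr normr0 mulr0.
have S_inf : has_inf S by split; [exists t|exists 0 => s [/andP[]]].
set m := inf S.
have m0 : 0 <= m by apply: lb_le_inf; [exists t|move=> s [/andP[]]].
have mt : m <= t by apply: ge_inf => //; exact: S_inf.2.
have Sm : S m.
  split; first by rewrite m0.
  apply/ler_addgt0Pl => e e0'; have K1 : 0 < `|K| + 1 by rewrite ltr_wpDl.
  have d0 : 0 < e / (`|K| + 1) by rewrite divr_gt0.
  have [s [/andP[s0 st] gs] sm] := inf_adherent d0 S_inf; rewrite -/m in sm.
  have ms : m <= s.
    by apply: ge_inf; [exact: S_inf.2|split; rewrite ?s0].
  have h1 := gK m s m0 ms st.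
  have h2 : `|K| * (s - m) <= e.
    rewrite (@le_trans _ _ ((`|K| + 1) * (s - m)))//.
      by rewrite ler_wpM2r ?subr_ge0// lerDl.
    by rewrite mulrC -ler_pdivlMr//; lra.
  have h3 : K * (s - m) <= `|K| * (s - m) by rewrite ler_wpM2r ?subr_ge0// ler_norm.
  have h4 := ler_distD (g s) (g m) (g t).
  have h5 : eps * (t - s) <= eps * (t - m) by rewrite ler_wpM2l ?(ltW e0)// lerD2l lerN2.
  lra.
move: m0; rewrite le_eqVlt => /orP[/eqP m0|m0].
  by have [_] := Sm; rewrite -m0 subr0.
have [|d d0 Hd] := g_left m _ eps e0; first by rewrite m0.
pose h := Num.min (d / 2) m.
have h0 : 0 < h by rewrite lt_min m0 andbT divr_gt0.
have hm : h <= m by rewrite ge_min lexx orbT.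
have hd : h < d by rewrite gt_min; apply/orP; left; lra.
have h1 := Hd h (introT andP (conj h0 hd)) hm.
have : m <= m - h.
  apply: ge_inf; first exact: S_inf.2.
  split; first by apply/andP; split; lra.
  have h2 := ler_distD (g m) (g (m - h)) (g t); have [_ h3] := Sm.
  rewrite (le_trans h2)// (_ : eps * (t - (m - h)) = eps * h + eps * (t - m)); last by ring.
  exact: lerD.
by lra.
Qed.

(** * Transition maps of the flow and invariance of integrals *)

Section Transition.
Context {R : realType}.
Local Notation T := (R * R)%type.
Local Notation T' := (measurableTypeR R * measurableTypeR R)%type.
Variables (x : R -> T -> T) (B : R -> T -> T) (L C : R).
Hypotheses (L0 : 0 <= L) (C0 : 0 <= C).
Hypothesis x_init : forall u, x 0 u = u.
Hypothesis x_derive : forall u (t : R), 0 <= t -> forall eps : R, 0 < eps ->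
  exists2 delta : R, 0 < delta & forall h : R, `|h| < delta -> 0 <= t + h ->
    `|x (t + h) u - x t u - h *: B t (x t u)| <= eps * `|h|.
Hypothesis B_lip : forall (t : R) u v, 0 <= t -> `|B t u - B t v| <= L * `|u - v|.
Hypothesis B_growth : forall (t : R) u, 0 <= t -> `|B t u| <= C * (1 + `|u|).

(** For [t >= 0] the default 0 is never taken, by surjectivity, and the preimage is unique. In
    [transition] the two times may come in either order, so that [transition t 0] is the inverse
    flow. *)
Definition flow_inv (t : R) (z : T) : T := xget 0 [set u | x t u = z].

Definition transition (s t : R) (z : T) : T := x t (flow_inv s z).

Lemma flow_invK t z : 0 <= t -> x t (flow_inv t z) = z.
Proof.
move=> t0; have [u xu] := flow_surjective L0 x_init x_derive B_lip t0 z.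
exact: (@xgetPex _ 0 [set u | x t u = z] (ex_intro _ u xu)).
Qed.

Lemma flowK t u : 0 <= t -> flow_inv t (x t u) = u.
Proof.
move=> t0; apply: (flow_injective L0 x_init x_derive B_lip t0).
exact: flow_invK.
Qed.

Lemma transition0l t z : transition 0 t z = x t z.
Proof. by rewrite /transition -[X in flow_inv 0 X]x_init flowK. Qed.

Lemma transition_comp r s t z : 0 <= s ->
  transition s t (transition r s z) = transition r t z.
Proof. by move=> s0; rewrite /transition flowK. Qed.

Lemma transition_id t z : 0 <= t -> transition t t z = z.
Proof. exact: flow_invK. Qed.

Lemma growth_const_ge0 tau : 0 <= growth_const C tau.
Proof. by rewrite mulr_ge0// expR_ge0. Qed.

Lemma flow_const_ge0 tau : 0 <= flow_const L tau.
Proof. by rewrite mulr_ge0// expR_ge0. Qed.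

Lemma growth_const_mono (s t : R) : s <= t -> growth_const C s <= growth_const C t.
Proof. by move=> st; rewrite ler_wpM2l// ler_expR ler_wpM2l// mulr_ge0. Qed.

(** The forward and backward halves of [flow_lip] treat the two orders of the times. *)
Lemma transition_lip s t z w : 0 <= s -> 0 <= t ->
  `|transition s t z - transition s t w| <= flow_const L `|t - s| * `|z - w|.
Proof.
move=> s0 t0; rewrite -{2}(flow_invK z s0) -{2}(flow_invK w s0).
have [st|/ltW ts] := leP s t.
  rewrite ger0_norm ?subr_ge0//.
  exact: (flow_lip L0 x_derive B_lip _ _ s0 st).1.
rewrite (distrC t) ger0_norm ?subr_ge0//.
exact: (flow_lip L0 x_derive B_lip _ _ t0 ts).2.
Qed.

Lemma transition_growth s t z : 0 <= s -> 0 <= t ->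
  1 + `|transition s t z| <= growth_const C `|t - s| * (1 + `|z|).
Proof.
move=> s0 t0; rewrite -{2}(flow_invK z s0).
have [st|/ltW ts] := leP s t.
  rewrite ger0_norm ?subr_ge0//.
  exact: (flow_growth C0 x_derive B_growth _ s0 st).1.
rewrite (distrC t) ger0_norm ?subr_ge0//.
exact: (flow_growth C0 x_derive B_growth _ t0 ts).2.
Qed.

Lemma transition_speed s t z : 0 <= s -> s <= t ->
  `|transition s t z - z| <= (t - s) * (C * growth_const C (t - s) * (1 + `|z|)).
Proof.
move=> s0 st; rewrite -{2 3}(flow_invK z s0).
exact: (flow_speed C0 x_derive B_growth).
Qed.

Lemma transition_increment_lip s t z w : 0 <= s -> s <= t ->
  `|(transition s t z - z) - (transition s t w - w)| <=
    (t - s) * (L * flow_const L (t - s) * `|z - w|).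
Proof.
move=> s0 st; rewrite -{2 3}(flow_invK z s0) -{2 3}(flow_invK w s0).
exact: (flow_increment_lip L0 x_derive B_lip).
Qed.

Lemma transition_continuous s t : 0 <= s -> 0 <= t -> continuous (transition s t).
Proof.
move=> s0 t0; apply: (@continuous_field _ _ (flow_const L `|t - s|)).
  exact: flow_const_ge0.
by move=> u v; exact: transition_lip.
Qed.

(** The growth bound applied to the reverse transition. *)
Lemma transition_proper s t N u : 0 <= s -> 0 <= t -> `|transition s t u| <= N ->
  `|u| <= growth_const C `|t - s| * (1 + N).
Proof.
move=> s0 t0 uN; have := transition_growth (transition s t u) t0 s0.
rewrite transition_comp// transition_id// (distrC s) => h.
have : growth_const C `|t - s| * (1 + `|transition s t u|) <=
    growth_const C `|t - s| * (1 + N) by rewrite ler_wpM2l ?growth_const_ge0// lerD2l.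
lra.
Qed.

Lemma supported_transition psi N s t : 0 <= s -> 0 <= t -> supported N psi ->
  supported (growth_const C `|t - s| * (1 + N)) (fun u => psi (transition s t u)).
Proof.
move=> s0 t0 spsi u uN; apply: spsi; rewrite ltNge; apply/negP.
by move=> /(transition_proper s0 t0); lra.
Qed.

Lemma test_transition psi s t : 0 <= s -> 0 <= t -> test psi ->
  test (fun u => psi (transition s t u)).
Proof.
move=> s0 t0 /test_supp[K [N [K0 N0 psiK spsi]]]; split; last first.
  by eexists; exact: supported_transition spsi.
exists (K * flow_const L `|t - s|) => u v.
by rewrite (le_trans (psiK _ _))// -mulrA ler_wpM2l// transition_lip.
Qed.

Lemma transition_derive_right (t : R) u (eps : R) : 0 <= t -> 0 < eps ->
  exists2 delta : R, 0 < delta & forall h : R, 0 < h < delta ->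
    `|transition t (t + h) u - u - h *: B t u| <= eps * h.
Proof.
move=> t0 e0; have [d d0 Hd] := x_derive (flow_inv t u) t0 e0.
exists d => // h /andP[h0 hd]; have := Hd h; rewrite gtr0_norm// flow_invK//.
by apply => //; rewrite addr_ge0// ltW.
Qed.

(* Follow the trajectory through [u] at time [s] back to [u'] at time [s - h]:
   there the increment is [u - u'], known from the equation at time [s], and the
   increments at [u] and [u'] differ by [O(h |u - u'|) = O(h^2)]. *)
Lemma transition_derive_left (s : R) u (eps : R) : 0 < s -> 0 < eps ->
  exists2 delta : R, 0 < delta & forall h : R, 0 < h < delta -> h <= s ->
    `|transition (s - h) s u - u - h *: B s u| <= eps * h.
Proof.
move=> s0 e0; have s0' := ltW s0; have e20 : 0 < eps / 2 by lra.
have [d d0 Hd] := x_derive (flow_inv s u) s0' e20.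
(* [h^2 * K] bounds the gap between the increments at [u] and [u']: a Lipschitz constant of order
   [h] times [|u - u'| <= h * (|B s u| + eps / 2)]. *)
pose K := L * flow_const L s * (`|B s u| + eps / 2).
have K0 : 0 <= K.
  by rewrite !mulr_ge0 ?flow_const_ge0// addr_ge0// ltW.
have K1 : 0 < K + 1 by rewrite ltr_wpDl.
exists (Num.min d (eps / 2 / (K + 1))); first by rewrite lt_min d0 divr_gt0.
move=> h /andP[h0]; rewrite lt_min => /andP[hd hK] hs.
have sh0 : 0 <= s - h by rewrite subr_ge0.
pose u' := x (s - h) (flow_inv s u).
have tu' : transition (s - h) s u' = u by rewrite /transition /u' flowK// flow_invK.
have h1 : `|u' - u + h *: B s u| <= eps / 2 * h.
  have := Hd (- h); rewrite normrN gtr0_norm// flow_invK// scaleNr opprK.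
  by apply.
have hs' : s - h <= s by rewrite lerBlDr lerDl ltW.
have h2 := transition_increment_lip u u' sh0 hs'.
have sE : s - (s - h) = h by ring.
rewrite tu' sE in h2.
have h3 : `|u - u'| <= h * (`|B s u| + eps / 2).
  have := ler_normB (u' - u + h *: B s u) (h *: B s u).
  rewrite addrK normrZ gtr0_norm// distrC mulrDr [h * (eps / 2)]mulrC; lra.
have h4 : h * (L * flow_const L h * `|u - u'|) <= h * (h * K).
  rewrite ler_wpM2l ?(ltW h0)//.
  rewrite (_ : h * K = (L * flow_const L s) * (h * (`|B s u| + eps / 2))); last by rewrite /K; ring.
  apply: ler_pM => //; first by rewrite mulr_ge0// flow_const_ge0.
  by rewrite ler_wpM2l// flow_const_mono.
have h5 : h * (h * K) <= h * (eps / 2).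
  rewrite ler_wpM2l ?(ltW h0)// (@le_trans _ _ (h * (K + 1)))//.
    by rewrite ler_wpM2l ?(ltW h0)// lerDl.
  by rewrite -ler_pdivlMr// ltW.
have -> : transition (s - h) s u - u - h *: B s u =
    (transition (s - h) s u - u - (u - u')) - (u' - u + h *: B s u).
  by apply: injective_projections => /=; ring.
rewrite (le_trans (ler_normB _ _))//; lra.
Qed.

Variable p : T -> R.
Hypotheses (p_lip : loc_lip p) (p_ge0 : forall u, 0 <= p u).

Let p_cont : continuous p := loc_lip_continuous p_lip.

Definition test_invariant := forall (t : R) (psi : T -> R), 0 <= t -> test psi ->
  J (fun u => psi (x t u) * p u) = J (fun u => psi u * p u).

(** Since [x t] is a bijection with continuous inverse, images and preimages can be traded. Layer
    cakes lead from sets to test functions, rectangle bumps from test functions to sets. *)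
Lemma preserves_test_invariant :
  preserves x (density_measure p) <-> test_invariant.
Proof.
have cx (t : R) : 0 <= t -> continuous (x t).
  move=> t0; rewrite (_ : x t = transition 0 t); first exact: transition_continuous.
  by apply/funext => u; rewrite transition0l.
have properx (t : R) : 0 <= t -> forall N, exists N', forall u, `|x t u| <= N -> `|u| <= N'.
  move=> t0 N; eexists => u; rewrite -transition0l; exact: transition_proper.
split=> [H t psi t0 tpsi|H t A t0 mA _].
  apply: J_preimage => //; [exact: cx|exact: properx|].
  move=> A N mA AN.
  have mx : measurable_fun setT (x t : T' -> T').
    by apply: continuous_measurable_plane2; exact: cx.
  (* [preserves] speaks of images of bounded sets; the preimage of [A] is bounded by properness, and
     its image is [A] by surjectivity. *)
  have <- : x t @` (x t @^-1` A) = A.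
    apply/seteqP; split=> [_ [u Au <-]//|z Az].
    by exists (flow_inv t z); rewrite /= flow_invK.
  rewrite H//; first by congr (density_measure p _); apply/seteqP; split=> u /=;
    [move=> [v Av /(flow_injective L0 x_init x_derive B_lip t0) <-]|move=> ?; exists u].
    by rewrite -[X in measurable X]setTI; exact: mx.
  have [N' xN] := properx t t0 N.
  exists N'; split; first exact: num_real.
  by move=> M NM u /AN /boxP /xN; move: NM => /ltW; exact: (fun a b => le_trans b a).
have tE : x t @` A = flow_inv t @^-1` A.
  apply/seteqP; split=> [_ [u Au <-]|z Az]; first by rewrite /= flowK.
  by exists (flow_inv t z); rewrite // flow_invK.
have fE : flow_inv t = transition t 0.
  by apply/funext => z; rewrite /transition x_init.
have minv : measurable_fun setT (flow_inv t : T' -> T').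
  by rewrite fE; apply: continuous_measurable_plane2; exact: transition_continuous.
have mxA : measurable (x t @` A : set T').
  by rewrite tE -[X in measurable X]setTI; exact: minv.
rewrite -(density_measure_preimage p_cont p_ge0 (cx t t0) (properx t t0) _ mxA); last first.
  by move=> psi; exact: H.
congr (density_measure p _); apply/seteqP; split=> u /=; last by move=> ?; exists u.
by move=> [v Av /(flow_injective L0 x_init x_derive B_lip t0) <-].
Qed.

Lemma J_incr (psi f : T -> R) (h : R) : test psi -> test f ->
  J (fun u => h^-1 * ((f u - psi u) * p u)) =
  h^-1 * (J (fun u => f u * p u) - J (fun u => psi u * p u)).
Proof.
move=> tpsi tf.
have j g : test g -> Jable (fun u => g u * p u).
  move=> tg; have [_ [N [_ _ _ sg]]] := test_supp tg.
  apply: (@continuous_Jable _ _ N); last exact: supportedMl.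
  by apply: continuousM_plane => //; exact: test_continuous.
have jpsi := j _ tpsi; have jf := j _ tf.
rewrite -JB// -JZ; first by congr J; apply/funext => u; ring.
rewrite (_ : (fun u => _) = (fun u => f u * p u + (-1) * (psi u * p u))).
  by apply: JableD => //; exact: JableZ.
by apply/funext => u; ring.
Qed.

Lemma test_invariant_advection : test_invariant ->
  forall (t : R) psi, 0 <= t -> test psi -> advection p (B t) psi h @[h --> 0^'+] --> 0.
Proof.
move=> inv t psi t0 tpsi.
have Bl u v : `|B t u - B t v| <= L * `|u - v| by exact: B_lip.
have lim : (J (fun u => h^-1 * ((psi (transition t (t + h) u) - psi u) * p u)) -
    advection p (B t) psi h) @[h --> 0^'+] --> 0.
  apply: (@push_advection_cvg _ p (B t) L p_cont L0 Bl
    (fun h => transition t (t + h)) (C * growth_const C 1) 1) => //.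
  - by rewrite mulr_ge0// growth_const_ge0.
  - by move=> h /andP[h0 _]; apply: transition_continuous => //; rewrite addr_ge0// ltW.
  - move=> h u /andP[h0 h1]; rewrite (le_trans (transition_speed _ t0 _))//.
      by rewrite lerDl ltW.
    rewrite [t + h]addrC addrK ler_wpM2l ?(ltW h0)// ler_wpM2r ?addr_ge0// ler_wpM2l//.
    by apply: growth_const_mono; exact: ltW.
  - by move=> u eps e0; exact: transition_derive_right.
move/cvg_at_right0P in lim; apply/cvg_at_right0P => eps e0.
have [d d0 Hd] := lim _ e0; exists d => // h hd; have := Hd h hd.
have th0 : 0 <= t + h by case/andP: hd => h0 _; rewrite addr_ge0// ltW.
have tt : test (fun u => psi (transition t (t + h) u)) by exact: test_transition.
(* Invariance at time [t] inserts [x t], which turns the transition map into [x (t + h)]; invariance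
   at time [t + h] then makes the exact quotient vanish. *)
rewrite (J_incr h tpsi tt) -(inv t _ t0 tt).
rewrite (_ : (fun u => psi (transition t (t + h) (x t u)) * p u) =
  (fun u => psi (x (t + h) u) * p u)).
  by rewrite inv// subrr mulr0 sub0r normrN.
by apply/funext => u; rewrite /transition flowK.
Qed.

(** [g] interpolates between the two integrals. Its derivative is taken from the left because
    [transition (s - h) t] is [transition s t] after the near-identity map [transition (s - h) s]:
    the test function [theta] then stays the same for all [h], and the field is [B s] itself. *)
Lemma advection_test_invariant :
  (forall (t : R) psi, 0 <= t -> test psi -> advection p (B t) psi h @[h --> 0^'+] --> 0) ->
  test_invariant.
Proof.
move=> adv t psi t0 tpsi; have [K [N [K0 N0 psiK spsi]]] := test_supp tpsi.
pose g s := J (fun u => psi (transition s t u) * p u).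
have tt s : 0 <= s -> test (fun u => psi (transition s t u)).
  by move=> s0; exact: test_transition.
have gE0 : J (fun u => psi (x t u) * p u) = g 0.
  by congr J; apply/funext => u; rewrite transition0l.
have gEt : J (fun u => psi u * p u) = g t.
  by congr J; apply/funext => u; rewrite transition_id.
rewrite gE0 gEt.
(* One support radius for all starting times [s] in [[0, t]]. *)
pose N' := growth_const C t * (1 + N).
have N'0 : 0 <= N' by rewrite mulr_ge0 ?growth_const_ge0// addr_ge0.
have supp s : 0 <= s -> s <= t -> supported N' (fun u => psi (transition s t u)).
  move=> s0 st u uN; apply: (supported_transition s0 t0 spsi).
  rewrite (le_lt_trans _ uN)// ler_wpM2r ?addr_ge0//.
  by rewrite ger0_norm ?subr_ge0//; apply: growth_const_mono; rewrite gerBl.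
have [P P0 pP] := continuous_bounded_box N' p_cont.
pose V := flow_const L t * (C * growth_const C t * (1 + N')).
have V0 : 0 <= V.
  by rewrite !mulr_ge0 ?flow_const_ge0 ?growth_const_ge0// addr_ge0.
have dist r s u : 0 <= r -> r <= s -> s <= t -> `|u| <= N' ->
    `|transition r t u - transition s t u| <= (s - r) * V.
  move=> r0 rs st uN; have s0 := le_trans r0 rs.
  (* The path from [r] to [t] passes through time [s]: the displacement between [r] and [s] is then
     magnified by at most the Lipschitz constant of [transition s t]. *)
  rewrite -(transition_comp r t u s0) (le_trans (transition_lip _ _ s0 t0))//.
  rewrite /V mulrCA ler_pM ?flow_const_ge0//.
    by rewrite ger0_norm ?subr_ge0//; apply: flow_const_mono => //; rewrite gerBl.
  rewrite (le_trans (transition_speed _ r0 rs))// ler_wpM2l ?subr_ge0//.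
  apply: ler_pM; rewrite ?addr_ge0// ?mulr_ge0 ?growth_const_ge0// ?lerD2l//.
  by rewrite ler_wpM2l// growth_const_mono// lerBlDr; lra.
apply: (@zero_left_derivative _ g t (K * V * P * (2 * N') ^+ 2) t0).
- move=> r s r0 rs st; have s0 := le_trans r0 rs.
  have c1 : continuous (fun u => psi (transition r t u) * p u).
    by apply: continuousM_plane => //; exact: (test_continuous (tt r r0)).
  have c2 : continuous (fun u => psi (transition s t u) * p u).
    by apply: continuousM_plane => //; exact: (test_continuous (tt s s0)).
  rewrite /g -JB; last first.
  - by apply: (@continuous_Jable _ _ N') => //; apply: supportedMl; exact: supp.
  - apply: (@continuous_Jable _ _ N') => //; apply: supportedMl.
    by apply: supp => //; exact: le_trans st.
  rewrite (_ : _ * (s - r) = (K * ((s - r) * V)) * P * (2 * N') ^+ 2); last by ring.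
  apply: J_dominated => //.
    by apply: continuous_measurable_plane; exact: continuousB_plane.
  apply: supported_dominated => u uN.
    by rewrite !supp ?mul0r ?subrr//; exact: le_trans st.
  rewrite -mulrBl normrM ler_pM//; last exact: pP.
  by rewrite (le_trans (psiK _ _))// ler_wpM2l// dist.
move=> s /andP[s0 st] eps e0; have s0' := ltW s0.
have Bl u v : `|B s u - B s v| <= L * `|u - v| by exact: B_lip.
pose theta u := psi (transition s t u).
have lim : (J (fun u => h^-1 * ((theta (transition (s - h) s u) - theta u) * p u)) -
    advection p (B s) theta h) @[h --> 0^'+] --> 0.
  apply: (@push_advection_cvg _ p (B s) L p_cont L0 Bl
    (fun h => transition (s - h) s) (C * growth_const C s) s) => //.
  - by rewrite mulr_ge0// growth_const_ge0.
  - by move=> h /andP[h0 /ltW hs]; apply: transition_continuous => //; rewrite subr_ge0.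
  - move=> h u /andP[h0 /ltW hs]; have sE : s - (s - h) = h by ring.
    rewrite (le_trans (transition_speed _ _ _)) ?subr_ge0//.
      by rewrite lerBlDr lerDl ltW.
    rewrite sE ler_wpM2l ?(ltW h0)// ler_wpM2r ?addr_ge0// ler_wpM2l//.
    exact: growth_const_mono.
  - move=> u e e1; have [d d0 Hd] := transition_derive_left u s0 e1.
    exists (Num.min d s); first by rewrite lt_min d0.
    move=> h /andP[h0]; rewrite lt_min => /andP[hd /ltW hs].
    by apply: Hd => //; rewrite h0.
  - exact: tt.
have ladv := adv s theta s0' (tt s s0').
move/cvg_at_right0P in lim; move/cvg_at_right0P in ladv.
have e20 : 0 < eps / 2 by lra.
have [d d0 Hd] := lim _ e20; have [d' d'0 Hd'] := ladv _ e20.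
exists (Num.min d d'); first by rewrite lt_min d0.
move=> h /andP[h0]; rewrite lt_min => /andP[hd hd'] hs.
have sh0 : 0 <= s - h by rewrite subr_ge0.
have := Hd h (introT andP (conj h0 hd)); have := Hd' h (introT andP (conj h0 hd')).
have tth : test (fun u => theta (transition (s - h) s u)).
  by apply: test_transition => //; exact: tt.
rewrite (J_incr h (tt s s0') tth) -/(g s).
rewrite (_ : (fun u => theta (transition (s - h) s u) * p u) =
  (fun u => psi (transition (s - h) t u) * p u)); last first.
  by apply/funext => u; rewrite /theta transition_comp.
rewrite -/(g (s - h)) => a1 a2.
have a3 : `|h^-1 * (g (s - h) - g s)| <= eps.
  by have := ler_normD (h^-1 * (g (s - h) - g s) - advection p (B s) theta h)
    (advection p (B s) theta h); rewrite subrK; lra.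
move: a3; rewrite normrM gtr0_norm ?invr_gt0// => a3.
by rewrite mulrC -ler_pdivrMl.
Qed.

End Transition.

(** * Uniform bounds on the field generated by the interaction *)

Section InteractionCoefficient.
Context {R : realType}.
Local Notation T := (R * R)%type.

Lemma enorm_ge0 (u : T) : 0 <= enorm u. Proof. exact: sqrtr_ge0. Qed.

Lemma norm_le_enorm (u : T) : `|u| <= enorm u.
Proof.
rewrite norm_pair_le -!sqrtr_sqr; apply/andP; split; apply: ler_wsqrtr.
  by rewrite lerDl sqr_ge0.
by rewrite lerDr sqr_ge0.
Qed.

Lemma enorm_le_norm (u : T) : enorm u <= 2 * `|u|.
Proof.
have u0 : 0 <= 2 * `|u| by rewrite mulr_ge0.
rewrite -(ger0_norm u0) -sqrtr_sqr; apply: ler_wsqrtr.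
have h1 : u.1 ^+ 2 <= `|u| ^+ 2.
  by rewrite -real_normK ?num_real// ler_sqr ?nnegrE// norm_fst_le.
have h2 : u.2 ^+ 2 <= `|u| ^+ 2.
  by rewrite -real_normK ?num_real// ler_sqr ?nnegrE// norm_snd_le.
by rewrite exprMn; have := sqr_ge0 `|u|; lra.
Qed.

Lemma enorm0 : enorm (0 : T) = 0.
Proof. by apply/eqP; rewrite eq_le enorm_ge0 andbT (le_trans (enorm_le_norm _))// normr0 mulr0. Qed.

Definition transport_cost (z : T * T) : R :=
  enorm (z.1 - z.2) / (1 + enorm (z.1 - z.2)).

Lemma transport_cost_ge0 z : 0 <= transport_cost z.
Proof. by rewrite divr_ge0// ?addr_ge0// enorm_ge0. Qed.

Lemma transport_cost_le1 z : transport_cost z <= 1.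
Proof.
rewrite ler_pdivrMr ?mul1r ?lerDr//.
by rewrite (lt_le_trans ltr01)// lerDl enorm_ge0.
Qed.

Lemma measurable_transport_cost : measurable_fun setT transport_cost.
Proof.
pose q (r : R) := `|r| / (1 + `|r|).
have cq : continuous q.
  move=> r; apply: cvgM; first exact: norm_continuous.
  apply: cvgV; first by rewrite gt_eqF// (lt_le_trans ltr01)// lerDl.
  by apply: cvgD; [exact: cvg_cst|exact: norm_continuous].
rewrite (_ : transport_cost = q \o Num.sqrt \o
    (fun z : T * T => (z.1.1 - z.2.1) ^+ 2 + (z.1.2 - z.2.2) ^+ 2)); last first.
  by apply/funext => z; rewrite /q /= ger0_norm ?sqrtr_ge0.
apply: measurableT_comp; first apply: measurableT_comp.
- exact: continuous_measurable_fun.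
- by apply: continuous_measurable_fun; exact: sqrt_continuous.
have m1 : measurable_fun setT (fun z : T * T => z.1.1).
  by apply: measurableT_comp; [exact: measurable_fst|exact: measurable_fst].
have m2 : measurable_fun setT (fun z : T * T => z.1.2).
  by apply: measurableT_comp; [exact: measurable_snd|exact: measurable_fst].
have m3 : measurable_fun setT (fun z : T * T => z.2.1).
  by apply: measurableT_comp; [exact: measurable_fst|exact: measurable_snd].
have m4 : measurable_fun setT (fun z : T * T => z.2.2).
  by apply: measurableT_comp; [exact: measurable_snd|exact: measurable_snd].
apply: measurable_funD; rewrite -/(measurable_fun _ _).
  by apply: (measurable_funX 2); exact: measurable_funB.
by apply: (measurable_funX 2); exact: measurable_funB.
Qed.

Lemma gamma0_ge0 (mu nu : probability T R) : (0 <= gamma0 mu nu)%E.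
Proof.
apply: le_ereal_inf_tmp => _ [kappa _ <-].
by apply: integral_ge0 => z _; rewrite lee_fin transport_cost_ge0.
Qed.

Variables (mu0 : probability T R) (x : R -> {mfun T >-> T}).

Section Coupling.
Variables s t : R.

Let pair_map : T -> T * T := fun u => (x s u, x t u).

Let measurable_pair_map : measurable_fun setT pair_map.
Proof. exact: measurable_fun_pair. Qed.

HB.instance Definition _ := isMeasurableFun.Build _ _ _ _ pair_map measurable_pair_map.

(** The joint law of the positions at two times. Optimality does not matter, as only the bound 1 and
    the value 0 at equal times are drawn from it. *)
Definition flow_coupling : probability (T * T)%type R :=
  distribution mu0 [the {mfun T >-> (T * T)%type} of pair_map].

Lemma is_coupling_flow :
  is_coupling flow_coupling (image_measure mu0 x s) (image_measure mu0 x t).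
Proof. by move=> A mA; split. Qed.

Lemma gamma0_flow_le : (gamma0 (image_measure mu0 x s) (image_measure mu0 x t) <=
  \int[mu0]_u (transport_cost (x s u, x t u))%:E)%E.
Proof.
rewrite (_ : (\int[mu0]_u _)%E = (\int[flow_coupling]_z (transport_cost z)%:E)%E).
  by apply: ereal_inf_lbound; exists flow_coupling => //; exact: is_coupling_flow.
rewrite /flow_coupling [RHS]ge0_integral_pushforward ?preimage_setT//.
- by apply/measurable_EFinP; exact: measurable_transport_cost.
- by move=> z _; rewrite lee_fin transport_cost_ge0.
Qed.

End Coupling.

Lemma gamma0_flow_le1 s t :
  (gamma0 (image_measure mu0 x s) (image_measure mu0 x t) <= 1)%E.
Proof.
rewrite (le_trans (gamma0_flow_le s t))//.
have -> : (1 = \int[mu0]_u (cst 1 u))%E.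
  by rewrite integral_cst// mul1e; exact/esym/(@probability_setT _ _ _ mu0).
apply: ge0_le_integral => //.
- by move=> u _; rewrite lee_fin transport_cost_ge0.
- apply/measurable_EFinP; apply: (measurableT_comp measurable_transport_cost).
  exact: measurable_fun_pair.
- by move=> u _; rewrite lee_fin transport_cost_le1.
Qed.

Lemma gamma0_flow_id t : gamma0 (image_measure mu0 x t) (image_measure mu0 x t) = 0%E.
Proof.
apply/eqP; rewrite eq_le gamma0_ge0 andbT (le_trans (gamma0_flow_le t t))//.
by rewrite integral0_eq// => u _; rewrite /transport_cost /= subrr enorm0 mul0r.
Qed.

Variable a : T -> probability T R -> T.
Hypothesis a_lipschitz : lipschitz_coefficient a.

Let B t u := a u (image_measure mu0 x t).

(** At equal times the distance term is 0, leaving a Lipschitz bound in space; at different times it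
    is at most 1, and comparison with the origin at time 0 gives linear growth, uniformly in
    time. *)
Lemma interaction_field_bounds : exists L C, [/\ 0 <= L, 0 <= C,
  forall t u v, `|B t u - B t v| <= L * `|u - v| &
  forall t u, `|B t u| <= C * (1 + `|u|)].
Proof.
have [K aK] := a_lipschitz.
have aK' s t u v g : (gamma0 (image_measure mu0 x s) (image_measure mu0 x t) <= g%:E)%E ->
    `|B s u - B t v| <= `|K| * (2 * `|u - v| + g).
  move=> h; rewrite (le_trans (norm_le_enorm _))// -lee_fin (le_trans (aK _ _ _ _))//.
  have g0 := gamma0_ge0 (image_measure mu0 x s) (image_measure mu0 x t).
  rewrite (@le_trans _ _ (`|K|%:E * ((enorm (u - v))%:E +
      gamma0 (image_measure mu0 x s) (image_measure mu0 x t)))%E)//.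
    rewrite lee_wpmul2r// ?lee_fin ?ler_norm//.
    by rewrite adde_ge0// lee_fin enorm_ge0.
  rewrite EFinM lee_wpmul2l ?lee_fin// EFinD leeD// lee_fin.
  exact: enorm_le_norm.
(* The 2 is the loss from the max norm to the Euclidean one; [|K| * (2 * |u| + 1)] gives the 3.
   Absolute values are taken as the sign of [K] is unknown. *)
exists (`|K| * 2), (`|K| * 3 + `|B 0 0|); split.
- by rewrite mulr_ge0.
- by rewrite addr_ge0// mulr_ge0.
- move=> t u v; rewrite -mulrA -[2 * _]addr0; apply: aK'.
  by rewrite gamma0_flow_id.
- move=> t u; have := @aK' t 0 u 0 1 (gamma0_flow_le1 t 0); rewrite subr0 => h.
  have h1 := ler_normD (B t u - B 0 0) (B 0 0); rewrite subrK in h1.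
  have h2 : 0 <= `|K| * `|u| by rewrite mulr_ge0.
  have h3 : 0 <= `|B 0 0| * `|u| by rewrite mulr_ge0.
  have h4 : 0 <= `|K| by [].
  by rewrite !mulrDl !mulrDr; lra.
Qed.

Lemma solution_derive : solves_interaction_equation a mu0 x ->
  forall u (t : R), 0 <= t -> forall eps : R, 0 < eps ->
  exists2 delta : R, 0 < delta & forall h : R, `|h| < delta -> 0 <= t + h ->
    `|x (t + h) u - x t u - h *: B t (x t u)| <= eps * `|h|.
Proof.
move=> [_ xd] u t t0 eps e0; have /cvgrPdist_le /(_ _ e0) := xd u t t0.
move=> -[d /= d0 Hd]; exists d => // h hd th.
have [->|h0] := eqVneq h 0; first by rewrite addr0 subrr scale0r subr0 !normr0 mulr0.
have := Hd h; rewrite /ball_ /= sub0r normrN => /(_ hd h0 th) H.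
rewrite (_ : x (t + h) u - x t u - h *: B t (x t u) =
   h *: (h^-1 *: (x (t + h) u - x t u) - B t (x t u))).
  by rewrite normrZ mulrC distrC ler_wpM2r.
by rewrite scalerBr scalerA divff// scale1r.
Qed.

End InteractionCoefficient.

Lemma cvg0_addl {R : realType} (f g : R -> R) (F : set_system R) {FF : Filter F} :
  f h + g h @[h --> F] --> 0 -> f h @[h --> F] --> 0 -> g h @[h --> F] --> 0.
Proof.
move=> fg f0; rewrite (_ : g = fun h => f h + g h - f h).
  by rewrite -[X in _ --> X](subrr 0); exact: cvgB.
by apply/funext => h; rewrite addrC addKr.
Qed.

Theorem theorem4p3 (R : realType)
    (a : R * R -> probability (R * R)%type R -> R * R)
    (mu0 : probability (R * R)%type R)
    (x : R -> {mfun (R * R)%type >-> (R * R)%type})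
    (p : R * R -> R)
    (a_lipschitz : lipschitz_coefficient a)
    (x_solution : solves_interaction_equation a mu0 x)
    (p_C1 : C1 p)
    (p_bounded : exists M : R, forall u, p u <= M)
    (p_ge0 : forall u, 0 <= p u) :
  preserves x (density_measure p) <->
  (forall t : R, 0 <= t ->
     let pa := fun u => p u *: a u (image_measure mu0 x t) in
     {ae lebesgue2, forall u, divergence_exists pa u /\ divergence pa u = 0} /\
     (forall u, differentiable pa u -> divergence pa u = 0)).
Proof.
have [L [C [L0 C0 B_lip B_growth]]] := interaction_field_bounds mu0 x a_lipschitz.
pose B t u := a u (image_measure mu0 x t); pose X t : R * R -> R * R := x t.
have X_init u : X 0 u = u by have [xi _] := x_solution; exact: xi.
have X_derive := solution_derive x_solution : forall u (t : R), 0 <= t ->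
  forall eps : R, 0 < eps -> exists2 delta : R, 0 < delta & forall h : R,
  `|h| < delta -> 0 <= t + h ->
    `|X (t + h) u - X t u - h *: B t (X t u)| <= eps * `|h|.
have B_lip' t u v : 0 <= t -> `|B t u - B t v| <= L * `|u - v| by move=> _; exact: B_lip.
have B_growth' t u : 0 <= t -> `|B t u| <= C * (1 + `|u|) by move=> _; exact: B_growth.
have p_lip := C1_loc_lip p_C1; have p_frechet := fun u => C1_frechet u p_C1.
pose G t u := p u *: B t u.
have G1_lip t : loc_lip (fun u => (G t u).1) := loc_lip_flux1 p_lip (B_lip t).
have G2_lip t : loc_lip (fun u => (G t u).2) := loc_lip_flux2 p_lip (B_lip t).
(* The pivot of both directions: the sum of the advection and flux terms tends to 0, so each tends
   to 0 as soon as the other does. *)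
have flux t psi (tpsi : test psi) :=
  advection_flux_cvg p_lip p_frechet L0 (B_lip t) tpsi.
rewrite (preserves_test_invariant L0 C0 X_init X_derive B_lip' B_growth' p_lip p_ge0).
split=> [inv t t0 /=|div0].
  have adv := test_invariant_advection L0 C0 X_init X_derive B_lip' B_growth' p_lip inv.
  have Gweak : weak_div_free (G t).
    move=> psi tpsi; exact: (cvg0_addl (flux t psi tpsi) (adv t psi t0 tpsi)).
  split; last by move=> u; exact: (weak_div0_differentiable (G1_lip t) (G2_lip t) Gweak).
  apply: ae2I; first exact: (divergence_exists_ae (G1_lip t) (G2_lip t)).
  exact: (weak_div0_ae (G1_lip t) (G2_lip t)).
apply: (advection_test_invariant L0 C0 X_init X_derive B_lip' B_growth' p_lip).
move=> t psi t0 tpsi; have [div_ae _] := div0 t t0.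
have Gweak : weak_div_free (G t).
  by apply: (ae_div0_weak (G1_lip t) (G2_lip t)); apply: ae2S div_ae => u [].
apply: (cvg0_addl _ (Gweak psi tpsi)).
have := flux t psi tpsi; under eq_fun do rewrite addrC.
exact.
Qed.
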